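(* Assume $c>0$, $\Omega<0$, and $s=\mathrm{sgn}(k)=1$. Let $U_0(\xi)=3c\,\mathrm{sech}^2\left(\frac{\sqrt c}{2}\xi\right)$, $$\Omega_c=-\frac{c}{16}\left(\sqrt{1+48k}-1\right)^2,\qquad g(\xi)=\mathrm{sech}^p\left(\frac{\sqrt c}{2}\xi\right),\quad p=\frac{\sqrt{1+48k}-1}{2},$$ and $L_1=-\partial_\xi^2+c-U_0$. Assume that $\langle g^2,L_1^{-1}g^2\rangle\neq0$. For every $\Omega$ near $\Omega_c$ such that $$\mathrm{sgn}(\Omega-\Omega_c)=-\mathrm{sgn}\left(\langle g^2,L_1^{-1}g^2\rangle\right),$$ there exists a unique family of solutions of the system $$U''-cU+\tfrac12U^2+sA^2=0,\qquad A''+(\Omega+kU)A=0$$ with the profile $(U,A)\in H^2_{\rm even}(\mathbb{R})\times H^2_{\rm even}(\mathbb{R})$ satisfying $$\|U-U_0\|_{H^2}\le C|\Omega-\Omega_c|,\qquad \|A\|_{H^2}\le C\sqrt{|\Omega-\Omega_c|},$$ for some $\Omega$-independent constant $C>0$.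
   Context: $H^2_{\rm even}(\mathbb{R})$ is the subspace of even functions in the real Sobolev space $H^2(\mathbb{R})$, and $\langle\cdot,\cdot\rangle$ is the $L^2(\mathbb{R})$ inner product. The operator $L_1$ on $L^2(\mathbb{R})$ with domain $H^2(\mathbb{R})$ has kernel spanned by the odd function $U_0'$; $L_1^{-1}$ denotes its bounded inverse on the subspace of even functions. The function $g$ spans the kernel of $-\partial_\xi^2-\Omega_c-kU_0$. The system describes the profiles of solitary waves $u=U(\xi)$, $\psi=e^{-i\omega t}A(\xi)e^{ic\xi/2}$, $\xi=x-ct$, $\Omega=\omega+\frac{c^2}{4}$, of the equations $u_t+uu_x+u_{xxx}+s(|\psi|^2)_x=0$, $i\psi_t+\psi_{xx}+ku\psi=0$; it has the solution $(U_0,0)$ for every $\Omega$ (the uncoupled KdV soliton), and the family in the claim is the branch of coupled solitary waves bifurcating from it at $\Omega=\Omega_c$.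
   Formalization: Uniqueness is stated among solutions with A not identically zero and up to the sign change A -> -A, since (U0,0) and (U,-A) also satisfy the system and the bounds, so literal uniqueness fails. *)

(* Defs.v *)
From HB Require Import structures.
From mathcomp Require Import all_boot all_order all_algebra.
From mathcomp Require Import all_classical all_reals all_analysis.

Set Implicit Arguments.
Unset Strict Implicit.
Unset Printing Implicit Defensive.

Import Order.TTheory GRing.Theory Num.Theory.
Import numFieldNormedType.Exports.

Local Open Scope classical_set_scope.
Local Open Scope ring_scope.

(* Elements of L^2(R) and H^2(R) are represented by functions R -> R; two
   functions are the same element when they agree almost everywhere. *)

Section sobolev.
Context {R : realType}.
Local Notation mu := (@lebesgue_measure R).
Implicit Types u v phi : R -> R.

Definition L2 : set (R -> R) := [set u | u \in Lfun mu 2%:E].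

Definition L2inner u v : R := \int[mu]_x (u x * v x).

Definition test_function phi :=
  (forall n x, derivable (derive1n n phi) x 1) /\
  compact (closure [set x | phi x != 0]).

Definition is_weak_derivative u v :=
  forall phi, test_function phi ->
    \int[mu]_x (u x * derive1 phi x) = - \int[mu]_x (v x * phi x).

Definition H1 : set (R -> R) :=
  [set u | L2 u /\ exists2 v, L2 v & is_weak_derivative u v].

(* A representative of the weak derivative, which is unique up to null sets;
   meaningful only for u in H1. *)
Definition wderiv u : R -> R :=
  xget (cst 0) [set v | L2 v /\ is_weak_derivative u v].

Definition H2 : set (R -> R) := [set u | H1 u /\ H1 (wderiv u)].

Definition H2norm u : R :=
  Num.sqrt (L2inner u u + L2inner (wderiv u) (wderiv u)
            + L2inner (wderiv (wderiv u)) (wderiv (wderiv u))).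

Definition H2even : set (R -> R) :=
  [set u | H2 u /\ {ae mu, forall x, u (- x) = u x}].

End sobolev.

Section solitary_waves.
Context {R : realType}.
Local Notation mu := (@lebesgue_measure R).
Implicit Types (c k s Omega : R) (U A f h : R -> R).

Definition sech (x : R) : R := 2 / (expR x + expR (- x)).

Definition U0 c : R -> R := fun x => 3 * c * sech (Num.sqrt c / 2 * x) ^+ 2.

Definition Omega_c c k : R := - (c / 16) * (Num.sqrt (1 + 48 * k) - 1) ^+ 2.

Definition p_exp k : R := (Num.sqrt (1 + 48 * k) - 1) / 2.

Definition g c k : R -> R := fun x => sech (Num.sqrt c / 2 * x) `^ p_exp k.

Definition L_1 c f : R -> R :=
  fun x => - wderiv (wderiv f) x + c * f x - U0 c x * f x.

(* The inverse of L_1 restricted to even functions, applied to an even h in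
   L^2: the even f in H^2, unique up to null sets, such that L_1 f = h. *)
Definition L_1inv c h : R -> R :=
  xget (cst 0) [set f | H2even f /\ L_1 c f = h %[ae mu]].

Definition profile_system c k s Omega U A :=
  {ae mu, forall x,
     wderiv (wderiv U) x - c * U x + 2^-1 * U x ^+ 2 + s * A x ^+ 2 = 0} /\
  {ae mu, forall x, wderiv (wderiv A) x + (Omega + k * U x) * A x = 0}.

(* A != 0 excludes the uncoupled soliton (U0, 0), which solves the system for
   every Omega and satisfies both bounds trivially. *)
Definition coupled_profile c k s Omega C U A :=
  [/\ H2even U /\ H2even A,
      profile_system c k s Omega U A,
      ~ (A = cst 0 %[ae mu]),
      H2norm (U \- U0 c) <= C * `|Omega - Omega_c c k| &
      H2norm A <= C * Num.sqrt `|Omega - Omega_c c k| ].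

End solitary_waves.

(* Main.v *)
Require Import Defs.
From HB Require Import structures.
From mathcomp Require Import all_boot all_order all_algebra.
From mathcomp Require Import all_classical all_reals all_analysis.
From mathcomp Require Import measurable_realfun ring lra.
Set Implicit Arguments.
Unset Strict Implicit.
Unset Printing Implicit Defensive.
Import Order.TTheory GRing.Theory Num.Theory.
Import numFieldNormedType.Exports.
Local Open Scope classical_set_scope.
Local Open Scope ring_scope.

(* Write [U = U_0 + alpha^2 w] and [A = alpha (g + h)] with [h(0) = 0], and
   [delta = Omega - Omega_c]. On even bounded functions the two linearized
   operators are inverted by explicit Green operators: [L_1] always, since its
   kernel is odd, and [- d^2/dx^2 - Omega_c - k U_0] exactly on the orthogonal
   complement of [g]. Orthogonality in the second equation forces
   [alpha^2 = delta * e], with [e = - <g, g + h> / (k <g, w (g + h)>)]; its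
   denominator stays away from 0 by nondegeneracy, and its sign is opposite to
   that of [<g^2, L_1^-1 g^2>]. What remains is a fixed-point equation for
   [(w, h)] whose map is [O(delta)]-Lipschitz near [(L_1^-1 g^2, 0)] in the sup
   norm with weight [exp (- eta |x|)]. Taking [eta > 0] yields solutions in
   [H^2]. Taking [eta = 0] yields uniqueness: an [H^2] profile is [C^2] up to a
   null set, because functions with a weak derivative satisfy the fundamental
   theorem of calculus at their Lebesgue points, and a bootstrap in the Green
   representation places it in the ball where the map contracts. *)

(** * Differential calculus on the line *)

(** A fixed point in an exponentially weighted ball lies in H^2, but a competing H^2 profile comes
    with boundedness only and no decay rate; hence the two weights. They can be compared because the
    operator bounds [Kc], [Ktc], [Kgc] do not depend on [eta]: both balls have the same radius, and
    the weighted one lies in the unweighted one.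

    The amplitude [alpha] is the value [A(0)], not a projection on [g]. As [g(0) = 1], this gives
    [h(0) = 0], which is the boundary condition built into the Green operator of the second
    equation. By evenness all integrals run over the half-line, so the pairing in the theorem is
    twice [N0].

    The equations determine only [alpha^2], so uniqueness holds up to the sign of [A]. The
    neighbourhood of [Omega_c] depends on [C] because [C] fixes how large a competing profile may
    be, and the bootstrap has to absorb terms of that size; the existence part works with one
    threshold for [C]. *)

Section calculus.
Context {R : realType}.
Local Notation mu := (@lebesgue_measure R).
Implicit Types (f g u v : R -> R) (a b x y : R).

Definition has_deriv f f' := forall x, is_derive x 1 f (f' x).

Lemma contD f g : continuous f -> continuous g -> continuous (fun x => f x + g x).
Proof. by move=> cf cg x; apply: (@continuousD _ R _ f g x); [exact: cf|exact: cg]. Qed.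

Lemma contB f g : continuous f -> continuous g -> continuous (fun x => f x - g x).
Proof. by move=> cf cg x; apply: (@continuousB _ R _ f g x); [exact: cf|exact: cg]. Qed.

Lemma contM f g : continuous f -> continuous g -> continuous (fun x => f x * g x).
Proof. by move=> cf cg x; apply: (@continuousM R _ f g x); [exact: cf|exact: cg]. Qed.

Lemma cont_cst a : continuous (fun _ : R => a).
Proof. by move=> x; exact: cst_continuous. Qed.

Lemma contZ a f : continuous f -> continuous (fun x => a * f x).
Proof. by move=> cf; apply: contM => //; exact: cont_cst. Qed.

Lemma contN f : continuous f -> continuous (fun x => - f x).
Proof. by move=> cf; under eq_fun do rewrite -mulN1r; exact: contZ. Qed.

Lemma contX n f : continuous f -> continuous (fun x => f x ^+ n).
Proof.
move=> cf; elim: n => [|n IH]; first exact: cont_cst.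
by under eq_fun do rewrite exprS; exact: contM.
Qed.

Lemma has_deriv_derivable f f' x : has_deriv f f' -> derivable f x 1.
Proof. by move=> fd; have [] := fd x. Qed.

Lemma has_deriv_cont f f' : has_deriv f f' -> continuous f.
Proof.
move=> fd x; apply: differentiable_continuous.
by apply/derivable1_diffP; exact: has_deriv_derivable fd.
Qed.

Lemma has_deriv_derive1 f f' : has_deriv f f' -> derive1 f = f'.
Proof. by move=> fd; apply/funext => x; rewrite derive1E; have := fd x => /@derive_val. Qed.

Lemma has_deriv_eq f f' df : has_deriv f f' -> f' =1 df -> has_deriv f df.
Proof. by move=> fd e x; rewrite -e. Qed.

Lemma has_derivD f f' g g' : has_deriv f f' -> has_deriv g g' ->
  has_deriv (fun x => f x + g x) (fun x => f' x + g' x).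
Proof. by move=> fd gd x; exact: is_deriveD. Qed.

Lemma has_derivB f f' g g' : has_deriv f f' -> has_deriv g g' ->
  has_deriv (fun x => f x - g x) (fun x => f' x - g' x).
Proof. by move=> fd gd x; exact: is_deriveB. Qed.

Lemma has_derivN f f' : has_deriv f f' ->
  has_deriv (fun x => - f x) (fun x => - f' x).
Proof. by move=> fd x; exact: is_deriveN. Qed.

Lemma has_derivM f f' g g' : has_deriv f f' -> has_deriv g g' ->
  has_deriv (fun x => f x * g x) (fun x => f' x * g x + f x * g' x).
Proof.
move=> fd gd x; have fx := fd x; have gx := gd x.
by apply: is_derive_eq (is_deriveM fx gx) _; rewrite /GRing.scale/=; ring.
Qed.

Lemma has_deriv_cst a : has_deriv (fun _ => a) (fun _ => 0).
Proof. by move=> x; exact: is_derive_cst. Qed.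

Lemma has_deriv_id : has_deriv (fun x : R => x) (fun _ => 1).
Proof. by move=> x; exact: is_derive_id. Qed.

Lemma has_derivZ a f f' : has_deriv f f' ->
  has_deriv (fun x => a * f x) (fun x => a * f' x).
Proof.
move=> fd; apply: has_deriv_eq (has_derivM (has_deriv_cst a) fd) _ => x.
by rewrite mul0r add0r.
Qed.

Lemma is_derive_comp f g x (df dg : R) : is_derive (g x) 1 f df -> is_derive x 1 g dg ->
  is_derive x 1 (fun x => f (g x)) (dg * df).
Proof. by move=> fx gx; apply: is_derive_eq (is_derive1_comp fx gx) _; rewrite mulrC. Qed.

Lemma has_deriv_comp f f' g g' : has_deriv f f' -> has_deriv g g' ->
  has_deriv (fun x => f (g x)) (fun x => g' x * f' (g x)).
Proof.
by move=> fd gd x; apply: is_derive_comp.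
Qed.

Lemma has_deriv_affine f f' a b : has_deriv f f' ->
  has_deriv (fun x => f (a * x + b)) (fun x => a * f' (a * x + b)).
Proof.
move=> fd; have := has_deriv_comp fd (has_derivD (has_derivZ a has_deriv_id) (has_deriv_cst b)).
by move=> /has_deriv_eq; apply => x; ring.
Qed.

Lemma has_deriv_expR f f' : has_deriv f f' ->
  has_deriv (fun x => expR (f x)) (fun x => f' x * expR (f x)).
Proof. by move=> fd; apply: has_deriv_comp fd => x; exact: is_derive_expR. Qed.

Lemma has_derivV f f' : has_deriv f f' -> (forall x, f x != 0) ->
  has_deriv (fun x => (f x)^-1) (fun x => - (f' x / f x ^+ 2)).
Proof.
move=> fd f0 x; have [fx fxE] := fd x.
apply: DeriveDef; first exact: derivableV.
by rewrite deriveV// fxE /GRing.scale/= mulNr mulrC.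
Qed.

Lemma has_deriv_ge0_le f f' a b : has_deriv f f' -> a <= b ->
  (forall x, a <= x -> x <= b -> 0 <= f' x) -> f a <= f b.
Proof.
move=> fd ab f'0.
have [||c cab e] := @MVT_segment _ f f' a b ab.
- by move=> x _; exact: fd.
- exact/continuous_subspaceT/(has_deriv_cont fd).
rewrite -subr_ge0 e mulr_ge0 ?subr_ge0//.
by move: cab; rewrite in_itv/= => /andP[]; exact: f'0.
Qed.

Lemma has_deriv_dominated f f' g g' a b : has_deriv f f' -> has_deriv g g' ->
  a <= b -> (forall x, a <= x -> x <= b -> `|f' x| <= g' x) ->
  `|f b - f a| <= g b - g a.
Proof.
move=> fd gd ab le.
have h1 := has_deriv_ge0_le (has_derivB gd fd) ab.
have h2 := has_deriv_ge0_le (has_derivD gd fd) ab.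
rewrite ler_norml; apply/andP; split.
  have : g a + f a <= g b + f b.
    by apply: h2 => x ax xb; have := le x ax xb; rewrite ler_norml; lra.
  lra.
have : g a - f a <= g b - f b.
  by apply: h1 => x ax xb; have := le x ax xb; rewrite ler_norml; lra.
lra.
Qed.

Lemma has_deriv0_cst f a b : has_deriv f (fun _ => 0) -> f a = f b.
Proof.
move=> fd; wlog ab : a b / a <= b.
  by move=> h; have [/h//|/ltW/h->] := leP a b.
apply/eqP; rewrite eq_sym -subr_eq0 -normr_le0.
have := has_deriv_dominated fd (has_deriv_cst 0) ab.
by rewrite subrr; apply => x _ _; rewrite normr0.
Qed.

Lemma has_deriv_near_cst f f' a x : has_deriv f f' -> (\forall y \near x, f y = a) ->
  f' x = 0.
Proof.
move=> fd near_a; have [_ <-] := fd x.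
rewrite -(@near_eq_derive _ _ _ (fun _ => a) f).
- by have [_ ->] := has_deriv_cst a x.
- by near=> y; apply/esym; near: y.
Unshelve. all: by end_near. Qed.

End calculus.

(** * Primitives and the fundamental theorem of calculus *)

Section primitive.
Context {R : realType}.
Local Notation mu := (@lebesgue_measure R).
Implicit Types (f g u v : R -> R) (a b x y : R).

(** The signed integral from 0: away from 0 one of the two intervals is empty. A single function on
    both half-lines lets parity be read off derivatives. *)
Definition prim u x : R :=
  (\int[mu]_(t in `[0%R, x]) u t) - (\int[mu]_(t in `[x, 0%R]) u t).

Lemma continuous_integrable_itv u a b : continuous u ->
  mu.-integrable `[a, b] (EFin \o u).
Proof.
move=> cu; apply: continuous_compact_integrable; first exact: segment_compact.
exact: continuous_subspaceT.
Qed.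

Definition itv_integrable u := forall a b, mu.-integrable `[a, b] (EFin \o u).

Lemma Rintegral_itv_cat u a b c : itv_integrable u -> a <= b -> b <= c ->
  \int[mu]_(t in `[a, c]) u t =
  (\int[mu]_(t in `[a, b]) u t) + (\int[mu]_(t in `[b, c]) u t).
Proof.
move=> iu ab bc; have := @Rintegral_itvB R u (BLeft a) (BRight c) b.
rewrite Rintegral_itv_obnd_cbnd; last first.
  by apply: (@integrableS _ _ _ mu `[b, c]) (iu b c) => //; exact: subset_itv_oc_cc.
move=> /(_ (iu a c)) <- //; [|by rewrite bnd_simp..].
by rewrite addrC subrK.
Qed.

Lemma prim0 u : prim u 0 = 0.
Proof. by rewrite /prim subrr. Qed.

Lemma primB_integrable u a b : itv_integrable u -> a <= b ->
  prim u b - prim u a = \int[mu]_(t in `[a, b]) u t.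
Proof.
move=> cu ab; rewrite /prim.
have empty x y : x < y -> \int[mu]_(t in `[y, x]) u t = 0.
  by move=> xy; rewrite set_itv_ge ?Rintegral_set0// bnd_simp -ltNge.
have [a0|a0|a0] := ltgtP a 0.
- rewrite (empty _ _ a0); have [b0|b0|->] := ltgtP b 0.
  + by rewrite (empty _ _ b0) (Rintegral_itv_cat (b := b) cu ab (ltW b0)); lra.
  + by rewrite (empty _ _ b0) (Rintegral_itv_cat (b := 0) cu (ltW a0) (ltW b0)); lra.
  + lra.
- have b0 := lt_le_trans a0 ab.
  by rewrite (empty _ _ a0) (empty _ _ b0) (Rintegral_itv_cat (b := a) cu (ltW a0) ab); lra.
- rewrite a0 subrr subr0; rewrite a0 le_eqVlt in ab.
  case/orP : ab => [/eqP <-|/empty->]; last by rewrite subr0.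
  by rewrite subrr set_itv1 Rintegral_set1.
Qed.

Lemma primB u a b : continuous u -> a <= b ->
  prim u b - prim u a = \int[mu]_(t in `[a, b]) u t.
Proof. by move=> cu; apply: primB_integrable => x y; exact: continuous_integrable_itv. Qed.

(** Local integrability is the right generality: a weak derivative need not be continuous, yet its
    primitive has to be a continuous representative. *)
Lemma continuous_prim u : itv_integrable u -> continuous (prim u).
Proof.
move=> iu x.
have := @parameterized_integral_continuous R (x - 1) (x + 1) u _ (iu _ _).
rewrite continuous_within_itvP; last lra.
move=> /(_ _)[|+ _ _]; first lra.
have xI : x \in `](x - 1), (x + 1)[ by rewrite in_itv/=; apply/andP; split; lra.
move=> /(_ _ xI) c.
have c2 : {for x, continuous (fun y => parameterized_integral mu (x - 1) y u + prim u (x - 1))}.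
  by apply: continuousD; [exact: c|exact: cst_continuous].
have E y : x - 1 <= y -> parameterized_integral mu (x - 1) y u + prim u (x - 1) = prim u y.
  by move=> xy; rewrite /parameterized_integral -primB_integrable// subrK.
rewrite /continuous_at -(E x); last lra.
apply: cvg_trans c2; apply: near_eq_cvg; near=> y; rewrite E//.
by apply: ltW; near: y; apply: lt_nbhsr; lra.
Unshelve. all: by end_near. Qed.

Lemma has_deriv_prim u : continuous u -> has_deriv (prim u) u.
Proof.
move=> cu x.
have /= := @continuous_FTC1_closed R u (x - 1) x (x + 1) _
  (continuous_integrable_itv _ _ cu).
move=> /(_ _ _ (cu x))[||dF FE]; [lra|lra|].
apply: (@near_eq_is_derive _ _ _ (fun y => (\int[mu]_(t in `[x - 1, y]) u t) + prim u (x - 1))).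
- near=> y.
  rewrite -(@primB _ (x - 1)) ?subrK//.
  by apply: ltW; near: y; apply: lt_nbhsr; lra.
- rewrite -[u x]addr0.
  apply: is_deriveD.
  by apply: DeriveDef; [exact: dF|rewrite -derive1E; exact: FE].
Unshelve. all: by end_near. Qed.

(** [f] and the primitive of [f'] have the same derivative, so they differ by a constant. *)
Lemma Rintegral_deriv f f' a b : has_deriv f f' -> continuous f' -> a <= b ->
  \int[mu]_(t in `[a, b]) f' t = f b - f a.
Proof.
move=> fd cf ab; rewrite -primB//.
have := has_deriv0_cst b a (has_deriv_eq (has_derivB fd (has_deriv_prim cf)) (fun x => subrr (f' x))).
lra.
Qed.

Lemma prim_uniq f f' x : has_deriv f f' -> continuous f' ->
  prim f' x = f x - f 0.
Proof.
move=> fd cf.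
have := has_deriv0_cst x 0 (has_deriv_eq (has_derivB fd (has_deriv_prim cf)) (fun x => subrr (f' x))).
rewrite prim0; lra.
Qed.

Lemma primD u v x : continuous u -> continuous v ->
  prim (fun y => u y + v y) x = prim u x + prim v x.
Proof.
move=> cu cv; rewrite (@prim_uniq (fun y => prim u y + prim v y)) ?prim0 ?addr0 ?subr0//.
  exact: has_derivD (has_deriv_prim cu) (has_deriv_prim cv).
by move=> y; apply: continuousD; [exact: cu|exact: cv].
Qed.

Lemma primZ u a x : continuous u -> prim (fun y => a * u y) x = a * prim u x.
Proof.
move=> cu; rewrite (@prim_uniq (fun y => a * prim u y)) ?prim0 ?mulr0 ?subr0//.
  exact: has_derivZ (has_deriv_prim cu).
by move=> y; apply: continuousM; [exact: cst_continuous|exact: cu].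
Qed.

Lemma prim_ge0 u x : continuous u -> (forall y, 0 <= u y) -> 0 <= x -> 0 <= prim u x.
Proof.
move=> cu u0 x0; rewrite -(prim0 u); apply: (has_deriv_ge0_le (has_deriv_prim cu)) => // y _ _; exact: u0.
Qed.

Lemma has_deriv_opp f f' : has_deriv f f' ->
  has_deriv (fun x => f (- x)) (fun x => - f' (- x)).
Proof.
move=> fd; have d := has_deriv_comp fd (has_derivN has_deriv_id).
by apply: has_deriv_eq d _ => x; rewrite mulN1r.
Qed.

(** The sum [prim u y + prim u (- y)] has derivative 0 and vanishes at 0. *)
Lemma prim_even u x : continuous u -> (forall y, u (- y) = u y) ->
  prim u (- x) = - prim u x.
Proof.
move=> cu eu; have du := has_deriv_prim cu.
have d : has_deriv (fun y => prim u y + prim u (- y)) (fun=> 0).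
  by apply: has_deriv_eq (has_derivD du (has_deriv_opp du)) _ => y; rewrite eu subrr.
have := has_deriv0_cst x 0 d.
rewrite oppr0 prim0 addr0; lra.
Qed.

Lemma prim_odd u x : continuous u -> (forall y, u (- y) = - u y) ->
  prim u (- x) = prim u x.
Proof.
move=> cu eu; have du := has_deriv_prim cu.
have d : has_deriv (fun y => prim u y - prim u (- y)) (fun=> 0).
  by apply: has_deriv_eq (has_derivB du (has_deriv_opp du)) _ => y; rewrite eu opprK subrr.
have := has_deriv0_cst x 0 d.
rewrite oppr0 prim0 subr0; lra.
Qed.

End primitive.

(** * Weak derivatives and regular representatives *)

Section smooth.
Context {R : realType}.
Implicit Types (f g u v : R -> R) (a b x y : R) (n m : nat).

(** Recursion on the derivative turns the closure rules into short inductions; [nderivable_derive1n]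
    converts to the iterated derivatives of [test_function]. *)
Fixpoint nderivable n f : Prop :=
  if n is m.+1 then (forall x, derivable f x 1) /\ nderivable m (derive1 f)
  else True.

Lemma nderivable_has_deriv n f : nderivable n.+1 f -> has_deriv f (derive1 f).
Proof. by move=> [df _] x; apply: DeriveDef => //; rewrite derive1E. Qed.

Lemma nderivableS n f f' : has_deriv f f' -> nderivable n f' -> nderivable n.+1 f.
Proof.
move=> fd nf; split=> [x|]; first exact: has_deriv_derivable fd.
by rewrite (has_deriv_derive1 fd).
Qed.

Lemma nderivableW n f : nderivable n.+1 f -> nderivable n f.
Proof.
elim: n f => // n IH f [df nf]; split => //; exact: IH.
Qed.

Lemma nderivable_derive1n f : (forall n, nderivable n f) ->
  forall n x, derivable (derive1n n f) x 1.
Proof.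
move=> nf n; elim: n f nf => [f nf x|n IH f nf x]; first by have [] := nf 1%N.
by rewrite derive1Sn; apply: IH => m; have [] := nf m.+1.
Qed.

Lemma nderivable_cst n a : nderivable n (fun=> a).
Proof. by elim: n a => // n IH a; apply: nderivableS (has_deriv_cst a) _. Qed.

Lemma nderivableD n f g : nderivable n f -> nderivable n g ->
  nderivable n (fun x => f x + g x).
Proof.
elim: n f g => // n IH f g nf ng.
apply: nderivableS (has_derivD (nderivable_has_deriv nf) (nderivable_has_deriv ng)) _.
by apply: IH; [case: nf|case: ng].
Qed.

Lemma nderivableM n f g : nderivable n f -> nderivable n g ->
  nderivable n (fun x => f x * g x).
Proof.
elim: n f g => // n IH f g nf ng.
apply: nderivableS (has_derivM (nderivable_has_deriv nf) (nderivable_has_deriv ng)) _.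
have [_ nf'] := nf; have [_ ng'] := ng.
by apply: nderivableD; apply: IH => //; exact: nderivableW.
Qed.

Lemma nderivable_affine n f a b : nderivable n f ->
  nderivable n (fun x => f (a * x + b)).
Proof.
elim: n f => // n IH f nf.
apply: nderivableS (has_deriv_affine a b (nderivable_has_deriv nf)) _.
apply: nderivableM; first exact: nderivable_cst.
by apply: IH; case: nf.
Qed.

(** Serves the functions [flat] at 0, the one point where the differentiation rules do not apply. *)
Lemma is_derive0_quadratic f C : f 0 = 0 -> (forall y, `|f y| <= C * y ^+ 2) ->
  is_derive (0 : R) (1 : R) f 0.
Proof.
move=> f0 fC.
have C0 : 0 <= C by have := fC 1; rewrite expr1n mulr1; exact: le_trans.
have h0 : h^-1 *: (f (h *: 1 + 0) - f 0) @[h --> (0 : R)^'] --> (0 : R).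
  apply/cvgr0Pnorm_le => e e0; near=> h.
  have hn0 : h != 0 by near: h; exact: nbhs_dnbhs_neq.
  have he : `|h| < e / (C + 1).
    by near: h; apply: dnbhs0_lt; rewrite divr_gt0// ltr_wpDl.
  rewrite f0 subr0 addr0 /GRing.scale/= mulr1 normrM normfV.
  rewrite ler_pdivrMl ?normr_gt0//; apply: le_trans (fC h) _.
  rewrite -[h ^+ 2]ger0_norm ?sqr_ge0// normrX expr2 mulrCA ler_wpM2l//.
  rewrite ltr_pdivlMr ?ltr_wpDl// in he.
  by apply: le_trans (ltW he); rewrite mulrC ler_wpM2l// lerDl.
apply: DeriveDef; first by apply/cvg_ex; exists 0.
exact: cvg_lim h0.
Unshelve. all: by end_near. Qed.

(* The functions [x ^- m * exp (- 1 / x)] for [x > 0] form a family closed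
   under derivation up to linear combinations. *)
Definition flat m x : R := if 0 < x then x^-1 ^+ m * expR (- x^-1) else 0.

Lemma flat_ge0 m x : 0 <= flat m x.
Proof.
rewrite /flat; case: ifPn => // x0.
by rewrite mulr_ge0 ?expR_ge0// exprn_ge0// invr_ge0 ltW.
Qed.

(** With [y = 1 / x], the exponential series gives [y^(m+2) <= (m+2)! exp y]; the two extra powers
    of [y] become [x^2], which is enough for a zero derivative at 0. *)
Lemma flat_le_sqr m x : flat m x <= m.+2`!%:R * x ^+ 2.
Proof.
have mge0 : 0 <= m.+2`!%:R * x ^+ 2 by rewrite mulr_ge0 ?sqr_ge0// ler0n.
rewrite /flat; case: ifPn => // x0.
have y0 : 0 < x^-1 by rewrite invr_gt0.
have := expR_ge1Dxn m.+1 (ltW y0); set y := x^-1 in y0 *.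
have -> : x = y^-1 by rewrite /y invrK.
rewrite expRN ler_pdivrMr ?expR_gt0// => h.
have fg : 0 < m.+2`!%:R :> R by rewrite ltr0n fact_gt0.
have h2 : y ^+ m.+2 <= m.+2`!%:R * expR y.
  by rewrite mulrC -ler_pdivrMr//; apply: le_trans h; rewrite lerDr.
have -> : y ^+ m = y ^+ m.+2 * y^-1 ^+ 2.
  by rewrite -addn2 exprD -mulrA -exprMn mulfV ?gt_eqF// expr1n mulr1.
by rewrite [leRHS]mulrAC ler_wpM2r// exprn_ge0// invr_ge0 ltW//.
Qed.

Lemma has_deriv_flat m :
  has_deriv (flat m) (fun x => flat m.+2 x - m%:R * flat m.+1 x).
Proof.
move=> x; have [x0|x0|->] := ltgtP x 0.
- apply: (@near_eq_is_derive _ _ _ (cst 0)).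
    by near=> y; rewrite /flat ltNge ltW//; near: y; exact: lt_nbhsl.
  by rewrite /flat !ltNge !ltW//= mulr0 subr0; exact: is_derive_cst.
- apply: (@near_eq_is_derive _ _ _ (fun y => y^-1 ^+ m * expR (- y^-1))).
    by near=> y; rewrite /flat ifT//; near: y; exact: lt_nbhsr.
  rewrite /flat x0.
  have dV : is_derive x 1 (fun y : R => y^-1) (- (x ^- 2)).
    apply: DeriveDef; first by apply: derivableV => //; rewrite gt_eqF.
    by rewrite deriveV ?gt_eqF// derive_id /GRing.scale/= mulr1.
  have dE := is_derive1_comp (is_derive_expR _) (is_deriveN dV).
  have dX := is_deriveX m dV.
  have dM := is_deriveM dX dE.
  have -> : (fun y : R => y^-1 ^+ m * expR (- y^-1)) =
      (fun y : R => y^-1) ^+ m * (expR \o (- (fun y : R => y^-1))).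
    by apply/funext => y; rewrite /= fctE exprfctE.
  apply: is_derive_eq dM _; rewrite /GRing.scale/= exprfctE.
  have -> : (- (fun y : R => y^-1)) x = - x^-1 by [].
  rewrite -exprVn opprK; set E := expR _; set y := x^-1.
  by case: (m) => [|m']; rewrite /= !exprS; ring.
- have -> : flat m.+2 0 - m%:R * flat m.+1 0 = 0.
    by rewrite /flat ltxx mulr0 subr0.
  apply: (@is_derive0_quadratic _ m.+2`!%:R) => [|y].
    by rewrite /flat ltxx.
  by rewrite ger0_norm ?flat_ge0// flat_le_sqr.
Unshelve. all: by end_near. Qed.

Lemma nderivable_flat n m : nderivable n (flat m).
Proof.
elim: n m => // n IH m; apply: nderivableS (has_deriv_flat m) _.
have -> : (fun x => flat m.+2 x - m%:R * flat m.+1 x) =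
    (fun x => flat m.+2 x + (- m%:R) * flat m.+1 x).
  by apply/funext => x; rewrite mulNr.
by apply: nderivableD => //; apply: nderivableM => //; exact: nderivable_cst.
Qed.

(** Each factor vanishes to infinite order at one end of [[-1, 1]]. The arguments are in the affine
    form that [nderivable_affine] expects. *)
Definition bump x : R := flat 0 (1 * x + 1) * flat 0 (-1 * x + 1).

Lemma nderivable_bump n : nderivable n bump.
Proof. by apply: nderivableM; apply: nderivable_affine; exact: nderivable_flat. Qed.

Lemma continuous_bump : continuous bump.
Proof. exact: has_deriv_cont (nderivable_has_deriv (nderivable_bump 1)). Qed.

Lemma bump_ge0 x : 0 <= bump x.
Proof. by rewrite mulr_ge0// flat_ge0. Qed.

Lemma bump_gt0 x : `|x| < 1 -> 0 < bump x.
Proof.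
rewrite ltr_norml => /andP[? ?]; rewrite /bump /flat !ifT; [|lra..].
by rewrite !expr0 !mul1r mulr_gt0 ?expR_gt0.
Qed.

Lemma bump_le1 x : bump x <= 1.
Proof.
have fl y : flat 0 y <= 1.
  rewrite /flat; case: ifPn => // y0; rewrite expr0 mul1r -expR0 ler_expR.
  by rewrite lerNl oppr0 invr_ge0 ltW.
by rewrite mulr_ile1 ?flat_ge0.
Qed.

Lemma bump_out x : 1 <= `|x| -> bump x = 0.
Proof.
rewrite ler_normr => /orP[|] x1; rewrite /bump /flat.
  by rewrite [X in _ * X]ifF ?mulr0//; apply/negbTE; rewrite -leNgt; lra.
by rewrite ifF ?mul0r//; apply/negbTE; rewrite -leNgt; lra.
Qed.

End smooth.

(** * Local integrability and compactly supported factors *)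

Section local_integrability.
Context {R : realType}.
Local Notation mu := (@lebesgue_measure R).
Implicit Types (f g u v phi : R -> R) (a b x y r : R) (n m : nat).

Definition loc_int u :=
  measurable_fun setT u /\ itv_integrable u.

Lemma L2_measurable u : L2 u -> measurable_fun setT u.
Proof. by rewrite /L2/= => /sub_Lfun_mfun; rewrite inE. Qed.

Lemma L2_sqr_integrable u : L2 u -> mu.-integrable setT (EFin \o (fun x => u x ^+ 2)).
Proof. by move=> /Lfun2_integrable_sqr. Qed.

(** On a bounded interval [1 + u^2] is integrable, and it dominates [|u|]. *)
Lemma L2_loc_int u : L2 u -> loc_int u.
Proof.
move=> Lu; have mu_ := L2_measurable Lu; split=> // a b.
have i1 : mu.-integrable `[a, b] (EFin \o (fun=> 1)).
  by apply: continuous_integrable_itv; exact: cst_continuous.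
have i2 : mu.-integrable `[a, b] (EFin \o (fun x => u x ^+ 2)).
  by apply: integrableS (L2_sqr_integrable Lu).
apply: le_integrable (integrableD _ i1 i2) => //.
  by apply/measurable_EFinP; apply: measurable_funS mu_.
move=> x _ /=; rewrite lee_fin [leRHS]ger0_norm ?addr_ge0 ?sqr_ge0//.
rewrite -[u x ^+ 2]real_normK ?num_real//.
have := sqr_ge0 (`|u x| - 2^-1); rewrite sqrrB; lra.
Qed.

Lemma continuous_loc_int u : continuous u -> loc_int u.
Proof.
move=> cu; split; first exact: continuous_measurable_fun.
by move=> a b; exact: continuous_integrable_itv.
Qed.

Lemma loc_intD u v : loc_int u -> loc_int v -> loc_int (fun x => u x + v x).
Proof.
move=> [mu_ iu] [mv iv]; split; first exact: measurable_funD.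
by move=> a b; apply: integrableD (iu a b) (iv a b).
Qed.

Lemma loc_int_locally_integrable u : loc_int u -> locally_integrable setT u.
Proof.
move=> [mu_ iu]; split => // [|K _ cK]; first exact: openT.
have [M [_ HM]] := compact_bounded cK.
have KM : K `<=` `[- (`|M| + 1), `|M| + 1].
  move=> x Kx; have := HM (`|M| + 1) _ x Kx.
  rewrite /= in_itv/= -ler_norml; apply.
  by rewrite (le_lt_trans (ler_norm _))// ltrDl.
have /integrableP[_] := iu (- (`|M| + 1)) (`|M| + 1).
apply: le_lt_trans; apply: ge0_subset_integral => //=.
  exact: compact_measurable.
by apply/measurable_EFinP; apply: measurableT_comp => //; apply: measurable_funS mu_.
Qed.

Lemma loc_int_lebesgue_pt u : loc_int u -> {ae mu, forall x, lebesgue_pt u x}.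
Proof. by move=> iu; apply/lebesgue_differentiation/loc_int_locally_integrable. Qed.

Lemma continuous_bounded_itv phi a b : continuous phi -> [bounded phi x | x in `[a, b]].
Proof.
move=> cphi.
have : compact [set phi x | x in `[a, b]].
  by apply: continuous_compact; [exact: continuous_subspaceT|exact: segment_compact].
move=> /compact_bounded[M [Mr HM]]; exists M; split => // r Mr' x abx.
by apply: (HM _ Mr'); exists x.
Qed.

Lemma loc_intM_itv u phi a b : loc_int u -> continuous phi ->
  mu.-integrable `[a, b] (EFin \o (fun x => u x * phi x)).
Proof.
move=> [mu_ iu] cphi.
rewrite (_ : EFin \o (fun x => u x * phi x) = ((EFin \o u) \* (EFin \o phi))%E); last first.
  by apply/funext => x /=; rewrite EFinM.
apply: integrableMl => //; last exact: continuous_bounded_itv.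
by apply: measurable_funTS; exact: continuous_measurable_fun.
Qed.

Section compact_support.
Variables (phi : R -> R) (a b : R).
Hypotheses (cphi : continuous phi) (phi0 : forall x, ~~ (a <= x <= b) -> phi x = 0).

Lemma mul_supp_restrict u : (fun x => u x * phi x) = (fun x => u x * phi x) \_ `[a, b].
Proof.
apply/funext => x; rewrite patchE; case: ifPn => // /negP xab.
rewrite phi0 ?mulr0//; apply/negP => h; apply: xab.
by rewrite inE/= in_itv.
Qed.

Lemma loc_intM_supp u : loc_int u ->
  mu.-integrable setT (EFin \o (fun x => u x * phi x)).
Proof.
move=> iu; have /integrable_mkcond := loc_intM_itv a b iu cphi.
by rewrite restrict_EFin -mul_supp_restrict; apply.
Qed.

Lemma Rintegral_supp u : \int[mu]_x (u x * phi x) = \int[mu]_(x in `[a, b]) (u x * phi x).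
Proof. by rewrite [RHS]Rintegral_mkcond -mul_supp_restrict. Qed.

End compact_support.

End local_integrability.

(** * Smooth steps, mollifiers and plateaus *)

Section mollifier.
Context {R : realType}.
Local Notation mu := (@lebesgue_measure R).
Implicit Types (f g u v phi : R -> R) (a b x y r : R) (n m : nat).

Lemma has_deriv_bumpI : has_deriv (prim (@bump R)) bump.
Proof. exact/has_deriv_prim/continuous_bump. Qed.

Definition bump_mass : R := prim bump 1 - prim bump (-1).

Lemma bump_mass_gt0 : 0 < bump_mass.
Proof.
have [|||c] := @MVT R (prim bump) bump (-1) 1; first lra.
- by move=> x _; exact: has_deriv_bumpI.
- exact/continuous_subspaceT/(has_deriv_cont has_deriv_bumpI).
rewrite in_itv/= => /andP[c1 c2] e; rewrite /bump_mass e; apply: mulr_gt0; last lra.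
by apply: bump_gt0; rewrite ltr_norml c1 c2.
Qed.

(** A smooth monotone transition from 0 on the left of -1 to 1 on the right of 1. *)
Definition step x := bump_mass^-1 * (prim bump x - prim bump (-1)).

Lemma has_deriv_step : has_deriv step (fun x => bump_mass^-1 * bump x).
Proof.
apply: has_derivZ; apply: has_deriv_eq (has_derivB has_deriv_bumpI (has_deriv_cst _)) _ => x.
by rewrite subr0.
Qed.

Lemma nderivable_step n : nderivable n step.
Proof.
apply: nderivableW; apply: nderivableS has_deriv_step _.
by apply: nderivableM; [exact: nderivable_cst|exact: nderivable_bump].
Qed.

Lemma bump_prim_cst a b : a <= b -> (forall x, a <= x -> x <= b -> 1 <= `|x|) ->
  prim bump b = prim bump a :> R.
Proof.
move=> ab h.
have := has_deriv_dominated has_deriv_bumpI (has_deriv_cst 0) ab.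
rewrite subrr => /(_ _)/[dup]; rewrite normr_le0 subr_eq0 => H _.
apply/eqP/H => x ax xb; by rewrite bump_out ?normr0// h.
Qed.

Lemma step_lo x : x <= -1 -> step x = 0.
Proof.
move=> x1; rewrite /step (bump_prim_cst x1) ?subrr ?mulr0// => y _ y1.
by rewrite ler_normr; lra.
Qed.

Lemma step_hi x : 1 <= x -> step x = 1.
Proof.
move=> x1; rewrite /step (bump_prim_cst x1).
  by rewrite mulVf// gt_eqF// bump_mass_gt0.
by move=> y y1 _; rewrite ler_normr y1.
Qed.

Lemma step_le x y : x <= y -> step x <= step y.
Proof.
move=> xy; apply: (has_deriv_ge0_le has_deriv_step) => // z _ _.
by rewrite mulr_ge0 ?bump_ge0// invr_ge0 ltW ?bump_mass_gt0.
Qed.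

Lemma step_ge0 x : 0 <= step x.
Proof.
have [x1|x1] := leP x (-1); first by rewrite step_lo.
by rewrite -(step_lo (lexx (-1))) step_le// ltW.
Qed.

Lemma step_le1 x : step x <= 1.
Proof.
have [x1|x1] := leP 1 x; first by rewrite step_hi.
by rewrite -(step_hi (lexx 1)) step_le// ltW.
Qed.

(** The derivative of the step rescaled to half-width [1 / r] around [a]: an approximate identity at
    [a] as [r] grows. *)
Definition moll r a x := r * (bump_mass^-1 * bump (r * x - r * a)).

Lemma has_deriv_step_scaled r a :
  has_deriv (fun x => step (r * x - r * a)) (moll r a).
Proof. exact: has_deriv_affine has_deriv_step. Qed.

Lemma nderivable_moll r a n : nderivable n (moll r a).
Proof.
apply: nderivableM; first exact: nderivable_cst.
apply: nderivableM; first exact: nderivable_cst.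
exact/nderivable_affine/nderivable_bump.
Qed.

Lemma continuous_moll r a : continuous (moll r a).
Proof. exact: has_deriv_cont (nderivable_has_deriv (nderivable_moll r a 1)). Qed.

Lemma moll_ge0 r a x : 0 <= r -> 0 <= moll r a x.
Proof.
by move=> r0; rewrite mulr_ge0// mulr_ge0 ?bump_ge0// invr_ge0 ltW ?bump_mass_gt0.
Qed.

Lemma moll_le r a x : 0 <= r -> moll r a x <= r / bump_mass.
Proof.
move=> r0; rewrite ler_wpM2l// -[leRHS]mulr1 ler_wpM2l ?bump_le1//.
by rewrite invr_ge0 ltW ?bump_mass_gt0.
Qed.

Lemma moll_out r a x : 0 < r -> r^-1 <= `|x - a| -> moll r a x = 0.
Proof.
move=> r0 h; rewrite /moll -mulrBr bump_out ?mulr0// normrM gtr0_norm//.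
by rewrite mulrC -ler_pdivrMr// div1r.
Qed.

Lemma moll_supp r a x : 0 < r -> ~~ (a - r^-1 <= x <= a + r^-1) -> moll r a x = 0.
Proof.
move=> r0 h; apply: moll_out => //; rewrite leNgt ltr_norml; apply: contra h => /andP[].
by move=> ? ?; apply/andP; split; lra.
Qed.

Lemma test_function_supp phi a b : (forall n, nderivable n phi) ->
  (forall x, ~~ (a <= x <= b) -> phi x = 0) -> test_function phi.
Proof.
move=> sphi phi0; split; first exact: nderivable_derive1n.
apply: (@subclosed_compact _ _ [set` `[a, b]]); [exact: closed_closure|exact: segment_compact|].
have <- : closure [set` `[a, b]] = [set` `[a, b]].
  by apply/esym/closure_id; exact: itv_closed.
apply: closure_subset => x /= /eqP; apply: contra_notT => xab; apply: phi0.
by move: xab; rewrite in_itv.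
Qed.

Lemma test_function_moll r a : 0 < r -> test_function (moll r a).
Proof.
move=> r0; apply: test_function_supp => [n|x]; first exact: nderivable_moll.
exact: moll_supp.
Qed.

(** A smooth approximation of the indicator of [[a, b]]. Its derivative is a mollifier at [a] minus
    one at [b], so testing a weak derivative against it produces, up to sign, the increment of the
    function. *)
Definition plateau r a b x := step (r * x - r * a) - step (r * x - r * b).

Lemma has_deriv_plateau r a b :
  has_deriv (plateau r a b) (fun x => moll r a x - moll r b x).
Proof. exact: has_derivB (has_deriv_step_scaled _ _) (has_deriv_step_scaled _ _). Qed.

Lemma plateau_supp r a b x : a <= b -> 1 <= r -> ~~ (a - 1 <= x <= b + 1) ->
  plateau r a b x = 0.
Proof.
move=> ab r1; rewrite negb_and -!ltNge => /orP[] h; rewrite /plateau.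
  by rewrite !step_lo ?subrr//; nra.
by rewrite !step_hi ?subrr//; nra.
Qed.

Lemma test_function_plateau r a b : a <= b -> 1 <= r -> test_function (plateau r a b).
Proof.
move=> ab r1; apply: test_function_supp => [n|x]; last exact: plateau_supp.
apply: nderivableD; first exact/nderivable_affine/nderivable_step.
have -> : (fun x => - step (r * x - r * b)) = (fun x => -1 * step (r * x + (- (r * b)))).
  by apply/funext => x; rewrite mulN1r.
apply: nderivableM; first exact: nderivable_cst.
exact/nderivable_affine/nderivable_step.
Qed.

Lemma plateau_bound r a b x : `|plateau r a b x| <= 1.
Proof.
have := step_ge0 (r * x - r * a); have := step_le1 (r * x - r * a).
have := step_ge0 (r * x - r * b); have := step_le1 (r * x - r * b).
by rewrite /plateau ler_norml; lra.
Qed.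

Lemma Rintegral_moll r a : 0 < r -> \int[mu]_x moll r a x = 1.
Proof.
move=> r0.
have -> : \int[mu]_x moll r a x = \int[mu]_x (cst 1 x * moll r a x).
  by apply: eq_Rintegral => x _; rewrite mul1r.
rewrite (@Rintegral_supp _ _ (a - r^-1) (a + r^-1)); last by move=> x; exact: moll_supp.
under eq_Rintegral do rewrite mul1r.
rewrite (Rintegral_deriv (has_deriv_step_scaled r a)); [|exact: continuous_moll|].
  rewrite step_hi; last by rewrite mulrDr mulfV ?gt_eqF//; lra.
  by rewrite step_lo ?subr0// mulrBr mulfV ?gt_eqF//; lra.
have : 0 < r^-1 by rewrite invr_gt0.
lra.
Qed.

End mollifier.

(** * Mollification at Lebesgue points and the fundamental lemma *)

Section du_bois_reymond.
Context {R : realType}.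
Local Notation mu := (@lebesgue_measure R).
Implicit Types (f g u v phi : R -> R) (a b x y r : R) (n m : nat).

Lemma aeS (P Q : R -> Prop) : (forall x, P x -> Q x) ->
  {ae mu, forall x, P x} -> {ae mu, forall x, Q x}.
Proof. by move=> PQ; apply: (@filterS _ _ (ae_filter_ringOfSetsType mu)). Qed.

Lemma aeI2 (P Q S : R -> Prop) : (forall x, P x -> Q x -> S x) ->
  {ae mu, forall x, P x} -> {ae mu, forall x, Q x} -> {ae mu, forall x, S x}.
Proof. by move=> PQ; apply: (@filterS2 _ _ (ae_filter_ringOfSetsType mu)). Qed.

Lemma davgE u a r : loc_int u -> 0 < r ->
  davg u a r^-1 = (r / 2 * \int[mu]_(x in ball a r^-1) `|u x - u a|)%:E.
Proof.
move=> iu r0; rewrite /davg /iavg lebesgue_measure_ball ?invr_ge0 ?ltW//.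
rewrite inver ifF; last by rewrite mulrn_eq0/= invr_eq0 gt_eqF.
rewrite EFinM; congr (_%:E * _)%E.
  by field; rewrite gt_eqF.
rewrite /Rintegral fineK//.
have : mu.-integrable `[a - r^-1, a + r^-1] (EFin \o (fun x => `|u x - u a|)).
  have [_ h] : loc_int (fun x => u x + cst (- u a) x).
    by apply: loc_intD => //; apply: continuous_loc_int; exact: cst_continuous.
  exact: (integrable_norm (h _ _)).
move=> /(integrableS _ _ _) h; apply: integrable_fin_num.
  exact: measurable_ball.
apply: h => //; first exact: measurable_ball.
by rewrite ball_itv; exact: subset_itv_oo_cc.
Qed.

(** As [moll] has mass 1, the error is the integral of [(u - u a) * moll]. The bound
    [moll <= r / bump_mass] on a ball of length [2 / r] gives the factor [2 / bump_mass]. *)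
Lemma moll_approx u a r : loc_int u -> 0 < r ->
  (`|\int[mu]_x (u x * moll r a x) - u a|%:E <= (2 / bump_mass)%:E * davg u a r^-1)%E.
Proof.
move=> iu r0; rewrite davgE// -EFinM lee_fin.
have supp := @moll_supp R r a _ r0.
have iu' : loc_int (fun x => u x + cst (- u a) x).
  by apply: loc_intD => //; apply: continuous_loc_int; exact: cst_continuous.
have ic : loc_int (cst (u a)) by apply: continuous_loc_int; exact: cst_continuous.
have cm := @continuous_moll R r a.
have -> : \int[mu]_x (u x * moll r a x) - u a =
    \int[mu]_x ((u x - u a) * moll r a x).
  rewrite [X in _ - X = _](_ : _ = u a * \int[mu]_x moll r a x); last first.
    by rewrite Rintegral_moll// mulr1.
  rewrite -RintegralZl//; last first.
    have i1 : loc_int (cst 1 : R -> R) by apply: continuous_loc_int; exact: cst_continuous.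
    have := loc_intM_supp cm supp i1.
    by congr (mu.-integrable _ _); apply/funext => x /=; rewrite mul1r.
  rewrite -RintegralB//.
  - by apply: eq_Rintegral => x _; rewrite mulrBl.
  - exact: (loc_intM_supp cm supp iu).
  - exact: (loc_intM_supp cm supp ic).
pose D := ball a r^-1.
have mD : measurable D by exact: measurable_ball.
have iD f : mu.-integrable `[a - r^-1, a + r^-1] (EFin \o f) -> mu.-integrable D (EFin \o f).
  apply: integrableS => //.
  by rewrite /D ball_itv; exact: subset_itv_oo_cc.
have -> : \int[mu]_x ((u x - u a) * moll r a x) = \int[mu]_(x in D) ((u x - u a) * moll r a x).
  rewrite [RHS]Rintegral_mkcond; congr Rintegral; apply/funext => x.
  rewrite patchE; case: ifPn => //; rewrite notin_setE /D/ball/= distrC => /negP.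
  by rewrite -leNgt => h; rewrite moll_out ?mulr0.
have i1 : mu.-integrable D (EFin \o (fun x => (u x - u a) * moll r a x)).
  exact: iD (loc_intM_itv _ _ iu' cm).
apply: le_trans (le_normr_Rintegral _ i1) _ => //.
have i2 : mu.-integrable D (EFin \o (fun x => `|u x - u a|)).
  exact: iD (integrable_norm (iu'.2 (a - r^-1) (a + r^-1))).
rewrite mulrA -RintegralZl//.
apply: le_Rintegral => //.
- exact: integrable_norm.
- by apply: eq_integrable (integrableZl _ (2 / bump_mass * (r / 2)) i2).
- move=> x Dx; rewrite normrM mulrC ler_wpM2r// ger0_norm; last exact/moll_ge0/ltW.
  apply: le_trans (moll_le _ _ (ltW r0)) _.
  by rewrite le_eqVlt; apply/orP; left; apply/eqP; field; rewrite gt_eqF// bump_mass_gt0.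
Qed.

Lemma moll_cvg u a e : loc_int u -> lebesgue_pt u a -> 0 < e ->
  exists r0, forall r, r0 <= r -> `|\int[mu]_x (u x * moll r a x) - u a| <= e.
Proof.
move=> iu /fine_cvg/cvgr0Pnorm_lt lu e0.
have m0 := @bump_mass_gt0 R.
have /lu[d /= d0 H] : 0 < e * bump_mass / 2 by rewrite divr_gt0 ?mulr_gt0.
(* The 1 makes [1 / r < d] strict, as membership in the open ball requires. *)
exists (d^-1 + 1) => r rd.
have r0 : 0 < r by apply: lt_le_trans rd; rewrite ltr_wpDl// invr_ge0 ltW.
rewrite -lee_fin; apply: le_trans (moll_approx a iu r0) _.
have := H r^-1; rewrite /ball/= sub0r normrN gtr0_norm ?invr_gt0// davgE//=.
rewrite -EFinM lee_fin => /(_ _ _)/(le_lt_trans (ler_norm _)) h.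
have {}h : r / 2 * \int[mu]_(x in ball a r^-1) `|u x - u a| < e * bump_mass / 2.
  apply: h => //.
  by rewrite invf_plt ?posrE//; apply: lt_le_trans rd; rewrite ltrDl.
rewrite mulrAC ler_pdivrMr// mulrC; lra.
Qed.

(** At a Lebesgue point [a] the mollified values, all equal to 0, converge to [v a]. *)
Lemma fundamental_lemma v : L2 v ->
  (forall phi, test_function phi -> \int[mu]_x (v x * phi x) = 0) ->
  v = cst 0 %[ae mu].
Proof.
move=> /L2_loc_int iv h; apply: aeS (loc_int_lebesgue_pt iv) => a la _ /=.
apply/eqP; rewrite -normr_le0; apply/ler_addgt0Pl => e e0; rewrite addr0.
have [r0 H] := moll_cvg iv la e0.
have := H (`|r0| + 1) _; rewrite h ?sub0r ?normrN.
  by apply; rewrite (le_trans (ler_norm _))// lerDl.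
by apply: test_function_moll; rewrite ltr_wpDl.
Qed.

End du_bois_reymond.

(** * The fundamental theorem of calculus for weak derivatives *)

Section weak_ftc.
Context {R : realType}.
Local Notation mu := (@lebesgue_measure R).
Implicit Types (f g u v phi : R -> R) (a b x y r : R) (n m : nat).

Lemma ae_neq a : {ae mu, forall x, x != a}.
Proof.
exists [set a]; split; [exact: measurable_set1|exact: lebesgue_measure_set1|].
by move=> x /= /negP; rewrite negbK => /eqP.
Qed.

(** Away from the two endpoints the sequence is eventually constant. *)
Lemma plateau_pointwise a b x : a < b -> x != a -> x != b ->
  (plateau n.+1%:R a b x @[n --> \oo] --> ((a <= x <= b)%R%:R : R)).
Proof.
move=> ab xa xb.
have away y : x != y -> step (n.+1%:R * x - n.+1%:R * y) @[n --> \oo] --> ((y < x)%R%:R : R).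
  move=> xy; apply: cvg_near_cst; near=> n.
  have : `|x - y|^-1 <= n.+1%:R.
    apply: (@le_trans _ _ n%:R); last by rewrite ler_nat.
    by near: n; exact: nbhs_infty_ger.
  rewrite invf_ple ?posrE ?normr_gt0 ?subr_eq0// ?ltr0n// => h.
  have h1 : 1 <= n.+1%:R * `|x - y|.
    by rewrite mulrC -ler_pdivrMr ?ltr0n// div1r.
  move: h1; rewrite -mulrBr; case: (ltgtP x y) xy => // xy _.
    rewrite ltr0_norm ?subr_lt0// => h1; rewrite step_lo//; nra.
  by rewrite gtr0_norm ?subr_gt0// => h1; rewrite step_hi.
have -> : (a <= x <= b)%R%:R = (a < x)%R%:R - (b < x)%R%:R :> R.
  case: (ltgtP a x) xa; case: (ltgtP b x) xb => //= h1 _ h2 _; rewrite ?subrr ?subr0//.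
  exfalso; lra.
exact: cvgB (away a xa) (away b xb).
Unshelve. all: by end_near. Qed.

(** Dominated convergence. The index [n.+1] keeps the scale at least 1, so all plateaus live in
    [[a - 1, b + 1]], where [|v|] dominates. *)
Lemma plateau_cvg v a b : loc_int v -> a < b ->
  \int[mu]_x (v x * plateau n.+1%:R a b x) @[n --> \oo] -->
  \int[mu]_(x in `[a, b]) v x.
Proof.
move=> [mv iv] ab.
pose fn n (x : R) := (v x * plateau n.+1%:R a b x)%:E.
pose fl := (EFin \o v) \_ `[a, b].
pose gd := (EFin \o (fun x => `|v x|)) \_ `[a - 1, b + 1].
have [|||||] := @dominated_convergence _ _ _ mu setT measurableT fn fl gd.
- move=> n; apply/measurable_EFinP; apply: measurable_funM => //.
  apply: continuous_measurable_fun; exact: has_deriv_cont (has_deriv_plateau _ _ _).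
- apply/(measurable_restrictT _ _).1 => //.
  by apply/measurable_EFinP; apply: measurable_funS mv.
- apply: aeI2 (ae_neq a) (ae_neq b) => x xa xb _.
  rewrite /fn /fl patchE.
  have -> : (if x \in [set` `[a, b]] then (EFin \o v) x else 0%E) = (v x * (a <= x <= b)%R%:R)%:E.
    rewrite mem_setE in_itv/=; case: ifP => _; by rewrite ?mulr1 ?mulr0.
  apply/cvg_EFin; first by apply: nearW.
  by apply: cvgM; [exact: cvg_cst|exact: plateau_pointwise].
- have /integrable_mkcond := integrable_norm (iv (a - 1) (b + 1)).
  by apply.
- apply: aeW => x n _; rewrite /fn /gd patchE mem_setE in_itv/=; case: ifPn => h.
    by rewrite lee_fin normrM ler_piMr// plateau_bound.
  by rewrite plateau_supp ?mulr0 ?normr0 ?ler1n// ltW.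
move=> _ _ /=.
rewrite /fl -integral_mkcond.
have fi := integrable_fin_num _ (iv a b).
rewrite -[X in _ --> X -> _]fineK; last exact: fi.
by move=> /fine_cvg.
Qed.

(** Test against the plateaus: one side tends to [u a - u b] because [a] and [b] are Lebesgue
    points, the other to minus the integral of [v]. The three limits cost [e / 3] each. *)
Lemma weak_derivative_ftc u v a b : loc_int u -> loc_int v ->
  is_weak_derivative u v -> a < b -> lebesgue_pt u a -> lebesgue_pt u b ->
  u b - u a = \int[mu]_(x in `[a, b]) v x.
Proof.
move=> iu iv uv ab la lb; apply/eqP; rewrite -subr_eq0 -normr_le0.
apply/ler_addgt0Pl => e e0; rewrite addr0.
have e3 : 0 < e / 3 by rewrite divr_gt0.
have [ra Ha] := moll_cvg iu la e3.
have [rb Hb] := moll_cvg iu lb e3.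
have /cvgrPdist_le /(_ _ e3) Hv := plateau_cvg iv ab.
near \oo => n.
have rn : 0 < n.+1%:R :> R by [].
have Ha' : `|\int[mu]_x (u x * moll n.+1%:R a x) - u a| <= e / 3.
  apply: Ha; apply: (@le_trans _ _ n%:R); last by rewrite ler_nat.
  by near: n; exact: nbhs_infty_ger.
have Hb' : `|\int[mu]_x (u x * moll n.+1%:R b x) - u b| <= e / 3.
  apply: Hb; apply: (@le_trans _ _ n%:R); last by rewrite ler_nat.
  by near: n; exact: nbhs_infty_ger.
have Hv' : `|\int[mu]_(x in `[a, b]) v x - \int[mu]_x (v x * plateau n.+1%:R a b x)| <= e / 3.
  by near: n; exact: Hv.
have := uv _ (test_function_plateau (ltW ab) _); move=> /(_ n.+1%:R).
rewrite ler1n => /(_ isT).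
rewrite (has_deriv_derive1 (has_deriv_plateau n.+1%:R a b)).
have -> : \int[mu]_x (u x * (moll n.+1%:R a x - moll n.+1%:R b x)) =
   \int[mu]_x (u x * moll n.+1%:R a x) - \int[mu]_x (u x * moll n.+1%:R b x).
  rewrite -RintegralB//.
  - by apply: eq_Rintegral => x _; rewrite mulrBr.
  - exact: (loc_intM_supp (@continuous_moll _ _ _) (fun x => moll_supp rn) iu).
  - exact: (loc_intM_supp (@continuous_moll _ _ _) (fun x => moll_supp rn) iu).
move: Ha' Hb' Hv'; rewrite !ler_norml.
move: (\int[mu]_x (u x * moll n.+1%:R a x)) (\int[mu]_x (u x * moll n.+1%:R b x))
  (\int[mu]_x (v x * plateau n.+1%:R a b x)) (\int[mu]_(x in `[a, b]) v x) (u a) (u b).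
by move=> A B J I ua ub /andP[? ?] /andP[? ?] /andP[? ?] E; apply/andP; split; lra.
Unshelve. all: by end_near. Qed.

End weak_ftc.

(** * Almost-everywhere equality and continuous representatives *)

Section representatives.
Context {R : realType}.
Local Notation mu := (@lebesgue_measure R).
Implicit Types (f g u v phi : R -> R) (a b x y r : R) (n m : nat).

(** An interval without such a point would lie in a null set. *)
Lemma ae_dense (P : R -> Prop) a b : {ae mu, forall x, P x} -> a < b ->
  exists2 x, P x & a < x < b.
Proof.
move=> [N [mN N0 PN]] ab; apply: contrapT => h.
have abN : [set` `]a, b[] `<=` N.
  move=> x /=; rewrite in_itv/= => xab; apply: PN => Px; apply: h; by exists x.
have : (mu [set` `]a, b[] <= mu N)%E by apply: le_measure => //; rewrite inE//; exact: measurable_itv.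
by rewrite lebesgue_measure_itv/= lte_fin ab N0 -EFinD lee_fin; lra.
Qed.

Lemma ae_continuous_eq f g x : continuous f -> continuous g -> f = g %[ae mu] ->
  f x = g x.
Proof.
move=> cf cg fg; apply/eqP; rewrite -subr_eq0; apply/negPn/negP => fgx.
have /(_ x) ch : continuous (fun y => f y - g y).
  by move=> y; apply: continuousB; [exact: cf|exact: cg].
have nz : \forall y \near x, f y - g y != 0 by apply: cvgr_neq0 ch fgx.
have /nbhs_ballP[e /= e0 he] := nz.
have xe : x - e < x + e by lra.
have [y E /andP[y1 y2]] := ae_dense fg xe.
have : f y - g y != 0.
  by apply: he; rewrite /ball/= ltr_distlC ; apply/andP; split; lra.
by rewrite E// subrr eqxx.
Qed.

Lemma ae_eq_sym f g : f = g %[ae mu] -> g = f %[ae mu].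
Proof. by apply: aeS => x h /h ->. Qed.

Lemma ae_eq_trans f g h : f = g %[ae mu] -> g = h %[ae mu] -> f = h %[ae mu].
Proof. by apply: aeI2 => x h1 h2 t; rewrite h1// h2. Qed.

Lemma ae_eqW f g : f =1 g -> f = g %[ae mu].
Proof. by move=> fg; apply: aeW => x _; rewrite fg. Qed.

Lemma ae_eq_Rintegral f g : measurable_fun setT f -> measurable_fun setT g ->
  f = g %[ae mu] -> \int[mu]_x f x = \int[mu]_x g x.
Proof.
move=> mf mg fg; rewrite /Rintegral; congr fine; apply: ae_eq_integral => //.
- exact/measurable_EFinP.
- exact/measurable_EFinP.
- by apply: aeS fg => x h /h ->.
Qed.

Lemma ae_eq_L2inner f f' g g' : L2 f -> L2 g -> L2 f' -> L2 g' ->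
  f = f' %[ae mu] -> g = g' %[ae mu] -> L2inner f g = L2inner f' g'.
Proof.
move=> /L2_measurable mf /L2_measurable mg /L2_measurable mf' /L2_measurable mg' ff gg.
apply: ae_eq_Rintegral; [exact: measurable_funM..|].
by apply: aeI2 ff gg => x h1 h2 t; rewrite h1// h2.
Qed.

(** [u - prim v] takes the same value at all Lebesgue points of [u], and these have full measure. *)
Lemma weak_derivative_rep u v : loc_int u -> loc_int v -> is_weak_derivative u v ->
  exists K, u = (fun x => prim v x + K) %[ae mu].
Proof.
move=> iu iv uv; have lu := loc_int_lebesgue_pt iu.
have [a la _] := ae_dense lu (ltr01 : 0 < 1 :> R).
exists (u a - prim v a); apply: aeS lu => x lx _.
have [xa|xa|->] := ltgtP x a; last by rewrite addrC subrK.
- have := weak_derivative_ftc iu iv uv xa lx la.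
  by rewrite -(primB_integrable iv.2 (ltW xa)); lra.
- have := weak_derivative_ftc iu iv uv xa la lx.
  by rewrite -(primB_integrable iv.2 (ltW xa)); lra.
Qed.

Lemma test_function_C1 phi : test_function phi ->
  has_deriv phi (derive1 phi) /\ continuous (derive1 phi).
Proof.
move=> [dphi _]; split.
  by move=> x; apply: DeriveDef; [exact: (dphi 0%N)|rewrite derive1E].
move=> x; apply: differentiable_continuous; apply/derivable1_diffP.
exact: (dphi 1%N).
Qed.

(** The strict form kills the boundary terms at [- M] and [M] in an integration by parts; the other
    two allow integrals to be cut to [[- M, M]]. *)
Lemma test_function_bounded_supp phi : test_function phi -> exists2 M, 0 < M &
  [/\ forall x, ~~ (- M < x < M) -> phi x = 0,
   forall x, ~~ (- M <= x <= M) -> phi x = 0 &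
   forall x, ~~ (- M <= x <= M) -> derive1 phi x = 0].
Proof.
move=> tphi; have [dphi cphi] := tphi.
have [M [_ HM]] := compact_bounded cphi.
have K x : `|M| + 1 < `|x| -> phi x = 0.
  move=> xM; apply/eqP/negPn/negP => px.
  have cx : closure [set x0 | phi x0 != 0] x by apply: subset_closure.
  have Mlt : M < `|M| + 1 by rewrite (le_lt_trans (ler_norm _))// ltrDl.
  by have := HM _ Mlt x cx; rewrite /= leNgt xM.
have out x : ~~ (- (`|M| + 2) < x < `|M| + 2) -> `|M| + 1 < `|x|.
  by rewrite -ltr_norml -leNgt; apply: lt_le_trans; rewrite ltrD2l ltr1n.
have out2 x : ~~ (- (`|M| + 2) <= x <= `|M| + 2) -> `|M| + 1 < `|x|.
  by rewrite -ler_norml -ltNge; apply: lt_trans; rewrite ltrD2l ltr1n.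
(* [phi] vanishes where [|x|] exceeds [|M| + 1]; one more unit includes the endpoints. *)
exists (`|M| + 2); first by rewrite ltr_wpDl.
split=> x; [by move=> /out; exact: K|by move=> /out2; exact: K|move=> /out2 xM].
apply: (@has_deriv_near_cst _ phi _ 0) (test_function_C1 tphi).1 _.
have nx : \forall y \near x, `|M| + 1 < `|y|.
  apply/nbhs_ballP; exists (`|x| - (`|M| + 1)); first by rewrite /= subr_gt0.
  by move=> y; rewrite /ball/= => h; have := lerB_dist x y; lra.
by apply: filterS nx => y; exact: K.
Qed.

Lemma C1_weak_derivative u u' : has_deriv u u' -> continuous u' -> is_weak_derivative u u'.
Proof.
move=> du cu' phi tphi.
have [dphi cphi'] := test_function_C1 tphi.
have [M M0 [s0 s1 s2]] := test_function_bounded_supp tphi.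
have cu := has_deriv_cont du; have cphi := has_deriv_cont dphi.
rewrite (Rintegral_supp s2) (Rintegral_supp s1).
apply/eqP; rewrite -addr_eq0 addrC -RintegralD//; first last.
- exact: loc_intM_itv (continuous_loc_int cu) cphi'.
- exact: loc_intM_itv (continuous_loc_int cu') cphi.
rewrite (Rintegral_deriv (has_derivM du dphi)); last 2 first.
- by apply: contD; apply: contM.
- lra.
by rewrite (s0 M) ?(s0 (- M)) ?mulr0 ?subrr// ltxx ?andbF.
Qed.

End representatives.

(** * Square-integrable functions and a Sobolev inequality *)

Section square_integrable.
Context {R : realType}.
Local Notation mu := (@lebesgue_measure R).
Implicit Types (f g u v phi : R -> R) (a b x y r J : R) (n m : nat).

Lemma L2_intro u : measurable_fun setT u ->
  (\int[mu]_x (u x ^+ 2)%:E < +oo)%E -> L2 u.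
Proof.
move=> mu_ fin; rewrite /L2/= inE; apply/andP; split; first by rewrite inE.
rewrite inE/= /finite_norm unlock/=; apply: poweR_lty.
apply: le_lt_trans fin; rewrite le_eqVlt; apply/orP; left; apply/eqP.
by apply: eq_integral => x _ /=; rewrite powR_mulrn// real_normK ?num_real.
Qed.

Lemma restrict_itv_cvg (f : R -> \bar R) x :
  (f \_ [set` `[- n%:R, n%:R]]) x @[n --> \oo] --> f x.
Proof.
apply: cvg_near_cst; near=> n; rewrite patchE mem_setE in_itv/= -ler_norml ifT//.
by near: n; exact: nbhs_infty_ger.
Unshelve. all: by end_near. Qed.

(** Monotone convergence along the truncations to [[- n, n]]. *)
Lemma ge0_integral_le_itv f J : measurable_fun setT f -> (forall x, 0 <= f x) ->
  (forall n, (\int[mu]_(x in `[(- n%:R)%R, n%:R%R]) (f x)%:E <= J%:E)%E) ->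
  (\int[mu]_x (f x)%:E <= J%:E)%E.
Proof.
move=> mf f0 h.
pose In n : set R := [set` `[- n%:R, n%:R]].
pose gn n : R -> \bar R := (EFin \o f) \_ (In n).
have mgn n : measurable_fun setT (gn n).
  apply/(measurable_restrictT _ _).1; first exact: measurable_itv.
  by apply/measurable_EFinP; apply: measurable_funS mf.
have -> : (\int[mu]_x (f x)%:E = \int[mu]_x (limn (gn ^~ x)))%E.
  by apply: eq_integral => x _; apply/esym/cvg_lim => //; exact: restrict_itv_cvg.
rewrite monotone_convergence//; first last.
- move=> x _ n m nm; rewrite /gn /In !patchE !mem_setE !in_itv/= -!ler_norml.
  case: ifPn => xn; last by case: ifPn => // _; rewrite lee_fin.
  by rewrite ifT// (le_trans xn)// ler_nat.
- by move=> n x _; rewrite /gn patchE; case: ifPn => // _; rewrite lee_fin.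
apply: lime_le.
  apply: ereal_nondecreasing_is_cvgn => n m nm; apply: ge0_le_integral => //.
  - by move=> x _; rewrite /gn patchE; case: ifPn => // _; rewrite lee_fin.
  - exact: mgn.
  - exact: mgn.
  - move=> x _; rewrite /gn /In !patchE !mem_setE !in_itv/= -!ler_norml.
    case: ifPn => xn; last by case: ifPn => // _; rewrite lee_fin.
    by rewrite ifT// (le_trans xn)// ler_nat.
by apply: nearW => n; rewrite /gn -integral_mkcond; exact: h.
Qed.

Lemma continuous_L2 u J : continuous u ->
  (forall n, prim (fun x => u x ^+ 2) n%:R - prim (fun x => u x ^+ 2) (- n%:R) <= J) ->
  L2 u /\ L2inner u u <= J.
Proof.
move=> cu h; have cu2 := contX (n := 2) cu.
have mu_ := continuous_measurable_fun cu.
have le : (\int[mu]_x (u x ^+ 2)%:E <= J%:E)%E.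
  apply: ge0_integral_le_itv => [|x|n]; [exact: continuous_measurable_fun|exact: sqr_ge0|].
  have fi := integrable_fin_num _ (continuous_integrable_itv (- n%:R) n%:R cu2).
  rewrite -[leLHS]fineK; last exact: fi.
  rewrite lee_fin; apply: le_trans (h n).
  by rewrite primB//; have n0 : (0 : R) <= n%:R by []; lra.
split; first by apply: L2_intro => //; apply: le_lt_trans le _; rewrite ltry.
rewrite /L2inner /Rintegral; under eq_integral do rewrite -expr2.
rewrite -lee_fin fineK// ge0_fin_numE; first by apply: le_lt_trans le _; rewrite ltry.
by apply: integral_ge0 => x _; rewrite lee_fin sqr_ge0.
Qed.

Lemma L2inner_ge0 u : 0 <= L2inner u u.
Proof. by apply: Rintegral_ge0 => x _; rewrite -expr2 sqr_ge0. Qed.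

Lemma continuous_L2_le u a b : continuous u -> L2 u -> a <= b ->
  prim (fun x => u x ^+ 2) b - prim (fun x => u x ^+ 2) a <= L2inner u u.
Proof.
move=> cu Lu ab; have cu2 := contX (n := 2) cu; rewrite primB//.
have iu := L2_sqr_integrable Lu.
rewrite -lee_fin /L2inner /Rintegral !fineK; last 2 first.
- under eq_integral do rewrite -expr2.
  exact: integrable_fin_num iu.
- exact: integrable_fin_num (continuous_integrable_itv _ _ cu2).
under [leRHS]eq_integral do rewrite -expr2.
apply: ge0_subset_integral => //.
- by apply/measurable_EFinP; exact: continuous_measurable_fun.
- by move=> x _; rewrite lee_fin sqr_ge0.
Qed.

Lemma ae_eq_L2 u v : measurable_fun setT v -> u = v %[ae mu] -> L2 u -> L2 v.
Proof.
move=> mv uv Lu; apply: L2_intro => //.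
have -> : (\int[mu]_x (v x ^+ 2)%:E = \int[mu]_x (u x ^+ 2)%:E)%E.
  apply: ae_eq_integral => //.
  - by apply/measurable_EFinP; exact: measurable_funX.
  - by apply/measurable_EFinP; apply: measurable_funX; exact: L2_measurable.
  - by apply: aeS uv => x h /h ->.
have /integrableP[_] := L2_sqr_integrable Lu; apply: le_lt_trans.
rewrite le_eqVlt; apply/orP; left; apply/eqP; apply: eq_integral => x _ /=.
by rewrite ger0_norm ?sqr_ge0.
Qed.

(* [u^2] oscillates by at most [\int (u^2 + u'^2)], and its mean value over
   [[x, x + 1]] is at most [\int u^2]. *)
Lemma sobolev_sup u u' x : has_deriv u u' -> continuous u' -> L2 u -> L2 u' ->
  u x ^+ 2 <= 2 * (L2inner u u + L2inner u' u').
Proof.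
move=> du cu' Lu Lu'; have cu := has_deriv_cont du.
have x1 : x < x + 1 by lra.
have dp := has_deriv_prim (contX (n := 2) cu).
have [|y] := @MVT R _ _ x (x + 1) x1 (fun z _ => dp z).
  exact/continuous_subspaceT/(has_deriv_cont dp).
rewrite in_itv/= => /andP[xy y1] E.
have := continuous_L2_le cu Lu (ltW x1); rewrite E [x + 1 - x]addrAC subrr add0r mulr1 => uy.
have cS := contD (contX (n := 2) cu) (contX (n := 2) cu').
have dS := has_deriv_prim cS.
have du2 := has_derivM du du.
have := has_deriv_dominated du2 dS (ltW xy).
have -> : prim (fun z => u z ^+ 2 + u' z ^+ 2) y - prim (fun z => u z ^+ 2 + u' z ^+ 2) x =
  (prim (fun z => u z ^+ 2) y - prim (fun z => u z ^+ 2) x) +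
  (prim (fun z => u' z ^+ 2) y - prim (fun z => u' z ^+ 2) x).
  by rewrite !primD; try exact: contX; lra.
have := continuous_L2_le cu Lu (ltW xy).
have := continuous_L2_le cu' Lu' (ltW xy) => h1 h2 h3.
have /h3 : forall z, x <= z -> z <= y -> `|u' z * u z + u z * u' z| <= u z ^+ 2 + u' z ^+ 2.
  move=> z _ _; rewrite ler_norml; apply/andP; split; last by have := sqr_ge0 (u z - u' z); nra.
  by have := sqr_ge0 (u z + u' z); nra.
rewrite -!expr2 ler_norml => /andP[h4 h5].
have := L2inner_ge0 u'; lra.
Qed.

End square_integrable.

(** * Weak derivatives in H^1 and H^2 compared with classical ones *)

Section sobolev_space.
Context {R : realType}.
Local Notation mu := (@lebesgue_measure R).
Implicit Types (f g u v w phi : R -> R) (a b x y r J : R) (n m : nat).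

(** [wderiv] is a representative picked by [xget], so weak derivatives must be transported along
    almost-everywhere equality. *)
Lemma weak_derivative_ae u v u' v' : measurable_fun setT u -> measurable_fun setT v ->
  measurable_fun setT u' -> measurable_fun setT v' ->
  u = u' %[ae mu] -> v = v' %[ae mu] -> is_weak_derivative u v -> is_weak_derivative u' v'.
Proof.
move=> mu1 mv mu2 mv2 uu vv h phi tphi.
have [dphi cphi'] := test_function_C1 tphi; have cphi := has_deriv_cont dphi.
have mphi := continuous_measurable_fun cphi.
have mphi' := continuous_measurable_fun cphi'.
have -> : \int[mu]_x (u' x * derive1 phi x) = \int[mu]_x (u x * derive1 phi x).
  apply: ae_eq_Rintegral; [exact: measurable_funM..|].
  by apply: aeS uu => x hx t; rewrite hx.
rewrite h//; congr (- _); apply: ae_eq_Rintegral; [exact: measurable_funM..|].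
by apply: aeS vv => x hx t; rewrite hx.
Qed.

Lemma wderivP u : H1 u -> L2 (wderiv u) /\ is_weak_derivative u (wderiv u).
Proof.
move=> [_ [v Lv uv]].
exact: (@xgetPex _ (cst 0) [set v | L2 v /\ is_weak_derivative u v] (ex_intro _ v (conj Lv uv))).
Qed.

Lemma L2D u v : L2 u -> L2 v -> L2 (fun x => u x + v x).
Proof.
move=> Lu Lv; have := L2_measurable Lu; have := L2_measurable Lv => mv mu_.
apply: L2_intro; first exact: measurable_funD.
have /integrableP[_] : mu.-integrable setT
    (fun x => (2%:E * (u x ^+ 2)%:E + 2%:E * (v x ^+ 2)%:E)%E).
  apply: integrableD => //; apply: integrableZl => //; exact: L2_sqr_integrable.
apply: le_lt_trans; apply: ge0_le_integral => //.
- by move=> x _; rewrite lee_fin sqr_ge0.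
- by apply/measurable_EFinP; apply: measurable_funX; exact: measurable_funD.
- apply: measurableT_comp => //; apply: emeasurable_funD; apply: emeasurable_funM => //;
  by apply/measurable_EFinP; exact: measurable_funX.
- move=> x _; rewrite -!EFinM -EFinD /= lee_fin ger0_norm.
    by have := sqr_ge0 (u x - v x); nra.
  by rewrite addr_ge0// mulr_ge0// sqr_ge0.
Qed.

Lemma L2Z a u : L2 u -> L2 (fun x => a * u x).
Proof.
move=> Lu; have mu_ := L2_measurable Lu.
apply: L2_intro; first exact: measurable_funM.
have /integrableP[_] : mu.-integrable setT (fun x => (a ^+ 2)%:E * (u x ^+ 2)%:E)%E.
  by apply: integrableZl => //; exact: L2_sqr_integrable.
apply: le_lt_trans; rewrite le_eqVlt; apply/orP; left; apply/eqP.
apply: eq_integral => x _ /=.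
by rewrite exprMn ger0_norm// mulr_ge0// sqr_ge0.
Qed.

Lemma L2B u v : L2 u -> L2 v -> L2 (fun x => u x - v x).
Proof.
move=> Lu Lv; have := L2D Lu (L2Z (-1) Lv).
by under eq_fun do rewrite mulN1r.
Qed.

Lemma weak_derivative_uniq u v w : L2 v -> L2 w ->
  is_weak_derivative u v -> is_weak_derivative u w -> v = w %[ae mu].
Proof.
move=> Lv Lw uv uw.
suff : (fun x => v x - w x) = cst 0 %[ae mu].
  by apply: aeS => x h /h /=/eqP; rewrite subr_eq0 => /eqP.
apply: fundamental_lemma; first exact: L2B.
move=> phi tphi; have [M M0 [_ s1 _]] := test_function_bounded_supp tphi.
have cphi := has_deriv_cont (test_function_C1 tphi).1.
transitivity (\int[mu]_x (v x * phi x - w x * phi x)).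
  by apply: eq_Rintegral => x _; rewrite mulrBl.
rewrite RintegralB//.
- by have := uv _ tphi; rewrite (uw _ tphi); lra.
- exact: (loc_intM_supp cphi s1 (L2_loc_int Lv)).
- exact: (loc_intM_supp cphi s1 (L2_loc_int Lw)).
Qed.

Lemma wderivE u v : L2 u -> L2 v -> is_weak_derivative u v ->
  H1 u /\ wderiv u = v %[ae mu].
Proof.
move=> Lu Lv uv; have hu : H1 u by split=> //; exists v.
split=> //; have [Lw uw] := wderivP hu.
exact: weak_derivative_uniq Lw Lv uw uv.
Qed.

(** Identifies the chosen [wderiv] with classical derivatives, so that [H2norm] can be computed from
    them. *)
Lemma C2_H2 u f f1 f2 : measurable_fun setT u -> u = f %[ae mu] ->
  has_deriv f f1 -> has_deriv f1 f2 -> continuous f2 ->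
  L2 f -> L2 f1 -> L2 f2 ->
  [/\ H2 u, wderiv u = f1 %[ae mu], wderiv (wderiv u) = f2 %[ae mu] &
   H2norm u = Num.sqrt (L2inner f f + L2inner f1 f1 + L2inner f2 f2)].
Proof.
move=> mu_ uf d1 d2 c2 L0 L1 Lf2.
have c1 := has_deriv_cont d2.
have m0 := L2_measurable L0; have m1 := L2_measurable L1; have m2 := L2_measurable Lf2.
have Lu : L2 u := ae_eq_L2 mu_ (ae_eq_sym uf) L0.
have w1 : is_weak_derivative u f1.
  apply: (weak_derivative_ae m0 m1 mu_ m1 (ae_eq_sym uf) (ae_eqW (frefl f1))).
  exact: C1_weak_derivative.
have [h1 E1] := wderivE Lu L1 w1.
have [LW _] := wderivP h1; have mW := L2_measurable LW.
have w2 : is_weak_derivative (wderiv u) f2.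
  apply: (weak_derivative_ae m1 m2 mW m2 (ae_eq_sym E1) (ae_eqW (frefl f2))).
  exact: C1_weak_derivative.
have [h2 E2] := wderivE LW Lf2 w2.
have [LW2 _] := wderivP h2.
split=> //; rewrite /H2norm (ae_eq_L2inner Lu Lu L0 L0 uf uf).
by rewrite (ae_eq_L2inner LW LW L1 L1 E1 E1) (ae_eq_L2inner LW2 LW2 Lf2 Lf2 E2 E2).
Qed.

Lemma H1_rep_continuous u : H1 u -> exists2 f, continuous f & u = f %[ae mu].
Proof.
move=> hu; have [Lw uw] := wderivP hu; case: hu => Lu _.
have iw := L2_loc_int Lw.
have [K E] := weak_derivative_rep (L2_loc_int Lu) iw uw.
exists (fun x => prim (wderiv u) x + K) => //.
by apply: contD; [exact: continuous_prim iw.2|exact: cont_cst].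
Qed.

Lemma H1_rep_C1 u g : H1 u -> continuous g -> wderiv u = g %[ae mu] ->
  exists2 f, has_deriv f g & u = f %[ae mu].
Proof.
move=> hu cg ug; have [Lw uw] := wderivP hu; case: hu => Lu _.
have mg := continuous_measurable_fun cg.
have mu_ := L2_measurable Lu.
have {}uw : is_weak_derivative u g.
  exact: (weak_derivative_ae mu_ (L2_measurable Lw) mu_ mg (ae_eqW (frefl u)) ug).
have [K E] := weak_derivative_rep (L2_loc_int Lu) (continuous_loc_int cg) uw.
exists (fun x => prim g x + K) => //.
apply: has_deriv_eq (has_derivD (has_deriv_prim cg) (has_deriv_cst K)) _ => x.
by rewrite addr0.
Qed.

Lemma H2_rep_C1 u : H2 u -> exists f f1,
  [/\ has_deriv f f1, continuous f1, u = f %[ae mu] & wderiv u = f1 %[ae mu]].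
Proof.
move=> [h1 h2]; have [f1 c1 E1] := H1_rep_continuous h2.
by have [f d E] := H1_rep_C1 h1 c1 E1; exists f, f1.
Qed.

(** Regularity from the equation: a profile equation writes the second weak derivative as a
    continuous function of the profile, and the [C^1] representative is then [C^2]. *)
Lemma H2_rep_C2 u f f1 f2 : H2 u -> has_deriv f f1 -> continuous f1 ->
  wderiv u = f1 %[ae mu] -> continuous f2 ->
  wderiv (wderiv u) = f2 %[ae mu] -> has_deriv f1 f2.
Proof.
move=> [h1 h2] d c1 E1 c2 E2.
have [f1' d' E'] := H1_rep_C1 h2 c2 E2.
suff -> : f1 = f1' by [].
apply/funext => x; apply: ae_continuous_eq => //; first exact: has_deriv_cont d'.
exact: ae_eq_trans (ae_eq_sym E1) E'.
Qed.

End sobolev_space.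

(** * Bounded solutions of second-order linear equations *)

Section tail_integral.
Context {R : realType}.
Implicit Types (f g u v : R -> R) (a b x y M nu eta : R).

Lemma has_deriv_exp_lin a b : has_deriv (fun x => a * expR (b * x)) (fun x => a * b * expR (b * x)).
Proof.
have := has_derivZ a (has_deriv_expR (has_derivZ b has_deriv_id)).
by move=> /has_deriv_eq; apply => x; rewrite mulr1 mulrA.
Qed.

(** The improper integral over the half-line from 0 to [+oo], which is all that even integrands
    need. *)
Definition tint u : R := lim (prim u x @[x --> +oo]).

Definition tint_cvg u := prim u x @[x --> +oo] --> tint u.

Section decay.
Variables (u : R -> R) (M nu : R).
Hypotheses (cu : continuous u) (nu0 : 0 < nu)
  (uM : forall x, 0 <= x -> `|u x| <= M * expR (- nu * x)).

Lemma decay_M_ge0 : 0 <= M.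
Proof. by have := uM (lexx 0); rewrite mulr0 expR0 mulr1; exact: le_trans. Qed.

(** The threshold comes from [exp (- t) * (1 + t) <= 1] at [t = nu * x]. *)
Lemma exp_decay_le e : 0 < e -> exists2 X, 0 <= X &
  forall x, X <= x -> M / nu * expR (- nu * x) <= e.
Proof.
move=> e0; have M0 := decay_M_ge0.
exists (M / nu / (nu * e)); first by rewrite !divr_ge0// ltW// mulr_gt0.
move=> x; rewrite ler_pdivrMr ?mulr_gt0// => h.
have : expR (- nu * x) * (1 + nu * x) <= 1.
  rewrite -[leRHS](expRxMexpNx_1 (nu * x)) [leRHS]mulrC mulNr.
  by rewrite ler_wpM2l ?expR_ge0 ?expR_ge1Dx.
have := expR_ge0 (- nu * x); set E := expR _ => E0 hE.
have x0 : 0 <= x * (nu * e) by apply: le_trans h; rewrite divr_ge0// ltW.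
have {}x0 : 0 <= x by move: x0; rewrite pmulr_lge0// mulr_gt0.
have H : M / nu * E <= x * (nu * e) * E by rewrite ler_wpM2r.
apply: le_trans H _; nra.
Qed.

Lemma tail_exists : exists I, forall x, 0 <= x -> `|I - prim u x| <= M / nu * expR (- nu * x).
Proof.
pose G x := (M / nu) * expR (- nu * x).
have G0 x : 0 <= G x by rewrite mulr_ge0 ?expR_ge0// divr_ge0 ?decay_M_ge0// ltW.
have mono x y : 0 <= x -> x <= y -> `|prim u y - prim u x| <= G x - G y.
  move=> x0 xy.
  have dG : has_deriv (fun x => - G x) (fun x => M * expR (- nu * x)).
    apply: has_deriv_eq (has_derivN (has_deriv_exp_lin _ _)) _ => z.
    by field; rewrite gt_eqF.
  have : `|prim u y - prim u x| <= - G y - - G x.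
    apply: (has_deriv_dominated (has_deriv_prim cu) dG xy) => z xz zy.
    exact/uM/(le_trans x0).
  lra.
have lohi x y : 0 <= x -> 0 <= y -> prim u x - G x <= prim u y + G y.
  move=> x0 y0; case: (leP x y) => [|/ltW] xy.
    have := mono _ _ x0 xy; rewrite ler_norml => /andP[]; have := G0 y; lra.
  have := mono _ _ y0 xy; rewrite ler_norml => /andP[]; have := G0 x; lra.
(* Every [prim u x - G x] lies below every [prim u y + G y], so the supremum of the former is within
   [G] of the primitive everywhere. *)
pose S := [set prim u x - G x | x in [set x | 0 <= x]].
have ubS y : 0 <= y -> ubound S (prim u y + G y).
  by move=> y0 _ [x /= x0 <-]; exact: lohi.
have S0 : S !=set0 by exists (prim u 0 - G 0), 0 => /=.
exists (sup S) => x x0; rewrite ler_norml; apply/andP; split.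
  have : prim u x - G x <= sup S.
    by apply: ub_le_sup; [exists (prim u 0 + G 0); exact: ubS|exists x].
  rewrite /G; lra.
have : sup S <= prim u x + G x by apply: ge_sup => //; exact: ubS.
rewrite /G; lra.
Qed.

Lemma tail_cvg : tint_cvg u.
Proof.
have [I HI] := tail_exists.
suff cI : prim u x @[x --> +oo] --> I by rewrite /tint_cvg /tint (cvg_lim _ cI).
apply/cvgrPdist_le => e e0; have [X X0 HX] := exp_decay_le e0.
near=> x; have xX : X <= x by near: x; apply: nbhs_pinfty_ge; rewrite num_real.
apply: le_trans (HI x (le_trans X0 xX)) _; exact: HX.
Unshelve. all: by end_near. Qed.

Lemma tail_le x : 0 <= x -> `|tint u - prim u x| <= M / nu * expR (- nu * x).
Proof.
have [I HI] := tail_exists.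
suff -> : tint u = I by exact: HI.
apply: cvg_lim => //.
apply/cvgrPdist_le => e e0; have [X X0 HX] := exp_decay_le e0.
near=> y; have xX : X <= y by near: y; apply: nbhs_pinfty_ge; rewrite num_real.
apply: le_trans (HI y (le_trans X0 xX)) _; exact: HX.
Unshelve. all: by end_near. Qed.

End decay.

Lemma tintB u v : continuous u -> continuous v -> tint_cvg u -> tint_cvg v ->
  tint (fun x => u x - v x) = tint u - tint v.
Proof.
move=> cu cv Hu Hv; apply: cvg_lim => //.
have -> : prim (fun x => u x - v x) = (fun x => prim u x - prim v x).
  apply/funext => x; have -> : (fun x => u x - v x) = (fun x => u x + (-1) * v x).
    by apply/funext => y; rewrite mulN1r.
  by rewrite primD// ?primZ ?mulN1r//; exact: contZ.
exact: cvgB.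
Qed.

Lemma tintD u v : continuous u -> continuous v -> tint_cvg u -> tint_cvg v ->
  tint (fun x => u x + v x) = tint u + tint v.
Proof.
move=> cu cv Hu Hv; apply: cvg_lim => //.
have -> : prim (fun x => u x + v x) = (fun x => prim u x + prim v x).
  by apply/funext => x; rewrite primD.
exact: cvgD.
Qed.

Lemma tintZ a u : continuous u -> tint_cvg u -> tint (fun x => a * u x) = a * tint u.
Proof.
move=> cu Hu; apply: cvg_lim => //.
have -> : prim (fun x => a * u x) = (fun x => a * prim u x).
  by apply/funext => x; rewrite primZ.
by apply: cvgM => //; exact: cvg_cst.
Qed.

Lemma tint_le u M nu : continuous u -> 0 < nu ->
  (forall x, 0 <= x -> `|u x| <= M * expR (- nu * x)) -> `|tint u| <= M / nu.
Proof.
move=> cu nu0 h; have := tail_le cu nu0 h (lexx 0).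
by rewrite prim0 subr0 mulr0 expR0 mulr1.
Qed.

End tail_integral.

(* The Green operator of [- d^2/dx^2 + q] built on a solution [pd] of
   [y'' = q y] decaying at [+oo] and a solution [pg] growing there. *)
Section green.
Context {R : realType}.
Implicit Types (f h : R -> R) (x y M N eta : R).
Variables (q pd pd1 pg pg1 : R -> R) (m K W : R).
Hypotheses (m0 : 0 < m) (W0 : W != 0).
Hypotheses (dpd : has_deriv pd pd1) (dpd1 : has_deriv pd1 (fun x => q x * pd x)).
Hypotheses (dpg : has_deriv pg pg1) (dpg1 : has_deriv pg1 (fun x => q x * pg x)).
Hypothesis wronskian : forall x, pd x * pg1 x - pd1 x * pg x = W.
Hypotheses (pd_le : forall x, 0 <= x -> `|pd x| <= K * expR (- m * x))
  (pd1_le : forall x, 0 <= x -> `|pd1 x| <= K * expR (- m * x))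
  (pg_le : forall x, 0 <= x -> `|pg x| <= K * expR (m * x))
  (pg1_le : forall x, 0 <= x -> `|pg1 x| <= K * expR (m * x)).

Let cpd := has_deriv_cont dpd.
Let cpg := has_deriv_cont dpg.

(** Variation of parameters on the half-line. At 0 the value and the slope are those of [pg] up to a
    common factor, which is the boundary condition required in [green_uniq]. *)
Definition green h x :=
  W^-1 * (pg x * (tint (fun y => pd y * h y) - prim (fun y => pd y * h y) x)
          + pd x * prim (fun y => pg y * h y) x).

(** The derivative of [green]: the terms from differentiating the two integrals cancel. In the next
    derivative they form the Wronskian. *)
Definition green1 h x :=
  W^-1 * (pg1 x * (tint (fun y => pd y * h y) - prim (fun y => pd y * h y) x)
          + pd1 x * prim (fun y => pg y * h y) x).

Lemma has_deriv_green h : continuous h -> has_deriv (green h) (green1 h).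
Proof.
move=> ch.
have d1 := has_derivB (has_deriv_cst (tint (fun y => pd y * h y))) (has_deriv_prim (contM cpd ch)).
have d2 := has_deriv_prim (contM cpg ch).
apply: has_deriv_eq (has_derivZ W^-1 (has_derivD (has_derivM dpg d1) (has_derivM dpd d2))) _ => x.
rewrite /green1; congr (_ * _); ring.
Qed.

Lemma has_deriv_green1 h : continuous h ->
  has_deriv (green1 h) (fun x => q x * green h x - h x).
Proof.
move=> ch.
have d1 := has_derivB (has_deriv_cst (tint (fun y => pd y * h y))) (has_deriv_prim (contM cpd ch)).
have d2 := has_deriv_prim (contM cpg ch).
apply: has_deriv_eq (has_derivZ W^-1 (has_derivD (has_derivM dpg1 d1) (has_derivM dpd1 d2))) _ => x.
have E : h x = W^-1 * ((pd x * pg1 x - pd1 x * pg x) * h x) by rewrite wronskian mulKf.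
rewrite /green [X in _ = _ - X]E; ring.
Qed.

Let K0 : 0 <= K.
Proof. by have := pd_le (lexx 0); rewrite mulr0 expR0 mulr1; exact: le_trans. Qed.

Lemma pd_mul_le h M eta : (forall x, 0 <= x -> `|h x| <= M * expR (- eta * x)) ->
  forall x, 0 <= x -> `|pd x * h x| <= K * M * expR (- (m + eta) * x).
Proof.
move=> hM x x0; rewrite normrM opprD mulrDl expRD mulrACA.
by apply: ler_pM => //; [exact: pd_le|exact: hM].
Qed.

Lemma pd_tint_cvg h M : continuous h -> (forall x, 0 <= x -> `|h x| <= M) ->
  tint_cvg (fun y => pd y * h y).
Proof.
move=> ch hM; apply: (@tail_cvg _ _ (K * M) m (contM cpd ch) m0) => x x0.
have := @pd_mul_le h M 0 _ x x0; rewrite addr0; apply => y y0.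
by rewrite oppr0 mul0r expR0 mulr1; exact: hM.
Qed.

Section bound.
Variables (h : R -> R) (M eta : R).
Hypotheses (ch : continuous h) (eta0 : 0 <= eta) (eta_le : eta <= m / 2)
  (hM : forall x, 0 <= x -> `|h x| <= M * expR (- eta * x)).

Let M0 : 0 <= M.
Proof. by have := hM (lexx 0); rewrite mulr0 expR0 mulr1; exact: le_trans. Qed.

Lemma tail_part_le x : 0 <= x ->
  `|tint (fun y => pd y * h y) - prim (fun y => pd y * h y) x| <=
  K * M / m * expR (- (m + eta) * x).
Proof.
move=> x0; have meta : 0 < m + eta by rewrite ltr_wpDr.
apply: le_trans (tail_le (contM cpd ch) meta (pd_mul_le hM) x0) _.
rewrite ler_wpM2r ?expR_ge0// ler_wpM2l ?mulr_ge0// lef_pV2 ?posrE//.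
by rewrite lerDl.
Qed.

(** As [eta <= m / 2], the rate [m - eta] is at least [m / 2]; this trades a dependence on [eta] for
    a factor 2. *)
Lemma prim_part_le x : 0 <= x ->
  `|prim (fun y => pg y * h y) x| <= 2 * (K * M / m) * expR ((m - eta) * x).
Proof.
move=> x0; have meta : 0 < m - eta by move: m0 eta_le; lra.
have dG := has_deriv_exp_lin (K * M / (m - eta)) (m - eta).
have := has_deriv_dominated (has_deriv_prim (contM cpg ch)) dG x0.
rewrite prim0 subr0 mulr0 expR0 mulr1 => H.
have {}H : `|prim (fun y => pg y * h y) x| <=
    K * M / (m - eta) * expR ((m - eta) * x) - K * M / (m - eta).
  apply: H => y y0 _; rewrite normrM.
  have -> : K * M / (m - eta) * (m - eta) * expR ((m - eta) * y) =
      (K * expR (m * y)) * (M * expR (- eta * y)).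
    by rewrite mulrBl expRB -expRN -mulNr divfK ?gt_eqF//; ring.
  by apply: ler_pM => //; [exact: pg_le|exact: hM].
apply: le_trans H _; rewrite lerBlDr; apply: ler_wpDr.
  by rewrite divr_ge0// ?mulr_ge0// ltW.
rewrite ler_wpM2r ?expR_ge0//.
have -> : 2 * (K * M / m) = K * M * (m / 2)^-1.
  by field; rewrite gt_eqF.
rewrite ler_wpM2l ?mulr_ge0// lef_pV2 ?posrE ?divr_gt0//.
by move: eta_le; lra.
Qed.

Let combine (a b : R) x : 0 <= x -> `|a| <= K * expR (m * x) -> `|b| <= K * expR (- m * x) ->
  `|W^-1 * (a * (tint (fun y => pd y * h y) - prim (fun y => pd y * h y) x)
          + b * prim (fun y => pg y * h y) x)| <=
  3 * K ^+ 2 / (m * `|W|) * M * expR (- eta * x).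
Proof.
move=> x0 ha hb; rewrite normrM normfV.
have h1 := ler_pM (normr_ge0 _) (normr_ge0 _) ha (tail_part_le x0).
have h2 := ler_pM (normr_ge0 _) (normr_ge0 _) hb (prim_part_le x0).
rewrite -!normrM in h1 h2.
have e1 : K * expR (m * x) * (K * M / m * expR (- (m + eta) * x)) = K ^+ 2 * M / m * expR (- eta * x).
  rewrite opprD mulrDl expRD mulNr expRN; set E := expR (m * x).
  have : E != 0 by rewrite gt_eqF ?expR_gt0.
  by move=> ?; field; rewrite gt_eqF.
have e2 : K * expR (- m * x) * (2 * (K * M / m) * expR ((m - eta) * x)) = 2 * (K ^+ 2 * M / m * expR (- eta * x)).
  rewrite mulrBl expRD !mulNr !expRN; set E := expR (m * x).
  have : E != 0 by rewrite gt_eqF ?expR_gt0.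
  by move=> E0; field; rewrite E0 !gt_eqF ?expR_gt0.
rewrite e1 in h1; rewrite e2 in h2.
have -> : 3 * K ^+ 2 / (m * `|W|) * M * expR (- eta * x) =
   `|W|^-1 * (3 * (K ^+ 2 * M / m * expR (- eta * x))).
  by field; rewrite normr_eq0 W0 gt_eqF.
rewrite ler_wpM2l ?invr_ge0//.
apply: le_trans (ler_normD _ _) _; lra.
Qed.

(** In the 3, one unit is due to the tail and two to the primitive. That the constant is free of
    [eta] is what makes balls for different weights comparable. *)
Lemma green_le x : 0 <= x -> `|green h x| <= 3 * K ^+ 2 / (m * `|W|) * M * expR (- eta * x).
Proof. by move=> x0; apply: combine => //; [exact: pg_le|exact: pd_le]. Qed.

Lemma green1_le x : 0 <= x -> `|green1 h x| <= 3 * K ^+ 2 / (m * `|W|) * M * expR (- eta * x).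
Proof. by move=> x0; apply: combine => //; [exact: pg1_le|exact: pd1_le]. Qed.

End bound.

Lemma greenB h k M N x : continuous h -> continuous k ->
  (forall x, 0 <= x -> `|h x| <= M) -> (forall x, 0 <= x -> `|k x| <= N) ->
  green (fun y => h y - k y) x = green h x - green k x.
Proof.
move=> ch ck hM kN; rewrite /green -mulrBr; congr (_ * _).
have E (p : R -> R) : (fun y => p y * (h y - k y)) = (fun y => p y * h y - p y * k y).
  by apply/funext => y; rewrite mulrBr.
have P (p : R -> R) : continuous p ->
    prim (fun y => p y * (h y - k y)) x = prim (fun y => p y * h y) x - prim (fun y => p y * k y) x.
  move=> cp; rewrite (_ : (fun y => _) = (fun y => p y * h y + (-1) * (p y * k y))).
    by rewrite primD ?primZ ?mulN1r//; [exact: contM..|exact/contZ/contM].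
  by apply/funext => y; ring.
rewrite (P pd)// (P pg)// E tintB; [|exact: contM..| |]; last 2 first.
- exact: pd_tint_cvg hM.
- exact: pd_tint_cvg kN.
ring.
Qed.

Section uniqueness.
Variables (f f1 h : R -> R) (M N : R).
Hypotheses (ch : continuous h) (hM : forall x, 0 <= x -> `|h x| <= M).
Hypotheses (df : has_deriv f f1) (df1 : has_deriv f1 (fun x => q x * f x - h x)).
Hypotheses (fN : forall x, 0 <= x -> `|f x| <= N) (f1N : forall x, 0 <= x -> `|f1 x| <= N).

(** [f * pd1 - f1 * pd] has derivative [pd * h] and tends to 0 at infinity, so the integral is a
    boundary term at 0. The solvability condition of the second equation comes from here. *)
Lemma green_tint : tint (fun y => pd y * h y) = f1 0 * pd 0 - f 0 * pd1 0.
Proof.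
pose W1 x := f x * pd1 x - f1 x * pd x.
have dW1 : has_deriv W1 (fun x => pd x * h x).
  apply: has_deriv_eq (has_derivB (has_derivM df dpd1) (has_derivM df1 dpd)) _ => x.
  ring.
have N0 : 0 <= N by apply: le_trans (fN (lexx 0)).
have W1_le x : 0 <= x -> `|W1 x| <= (2 * N * K * m) / m * expR (- m * x).
  move=> x0; rewrite mulfK ?gt_eqF//; apply: le_trans (ler_normB _ _) _.
  rewrite !normrM.
  have := ler_pM (normr_ge0 _) (normr_ge0 _) (fN x0) (pd1_le x0).
  have := ler_pM (normr_ge0 _) (normr_ge0 _) (f1N x0) (pd_le x0).
  lra.
have cvgW1 : W1 x @[x --> +oo] --> 0.
  apply/cvgr0Pnorm_le => e e0.
  have M1 : forall x, 0 <= x -> `|(2 * N * K * m) * expR (- m * x)| <= (2 * N * K * m) * expR (- m * x).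
    by move=> x _; rewrite ger0_norm// !mulr_ge0 ?expR_ge0// ltW.
  have [X X0 HX] := exp_decay_le m0 M1 e0.
  near=> x; have xX : X <= x by near: x; apply: nbhs_pinfty_ge; rewrite num_real.
  exact: le_trans (W1_le x (le_trans X0 xX)) (HX x xX).
apply: cvg_lim => //.
have -> : f1 0 * pd 0 - f 0 * pd1 0 = 0 - W1 0 by rewrite /W1; ring.
have -> : prim (fun y => pd y * h y) = (fun x => W1 x - W1 0).
  by apply/funext => x; apply: prim_uniq => //; exact: contM.
by apply: cvgB => //; exact: cvg_cst.
Unshelve. all: by end_near. Qed.

(** The Wronskians of [f] with [pd] and with [pg] evaluate the integrals inside [green]. The
    condition at 0 removes the boundary term of [pg], and the Wronskian of [pd] and [pg] then
    isolates [f] and [f1]. *)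
Lemma green_uniq : f 0 * pg1 0 = f1 0 * pg 0 -> forall x, f x = green h x /\ f1 x = green1 h x.
Proof.
move=> f0 x.
have P1 : prim (fun y => pd y * h y) x = f x * pd1 x - f1 x * pd x - (f 0 * pd1 0 - f1 0 * pd 0).
  apply: (@prim_uniq _ (fun x => f x * pd1 x - f1 x * pd x)); last exact: contM.
  apply: has_deriv_eq (has_derivB (has_derivM df dpd1) (has_derivM df1 dpd)) _ => y.
  ring.
have P2 : prim (fun y => pg y * h y) x = f x * pg1 x - f1 x * pg x.
  rewrite (@prim_uniq _ (fun x => f x * pg1 x - f1 x * pg x)) ?f0 ?subrr ?subr0//.
    apply: has_deriv_eq (has_derivB (has_derivM df dpg1) (has_derivM df1 dpg)) _ => y.
    ring.
  exact: contM.
rewrite /green /green1 green_tint P1 P2; split.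
  have E : f x = W^-1 * ((pd x * pg1 x - pd1 x * pg x) * f x) by rewrite wronskian mulKf.
  rewrite [LHS]E; ring.
have E : f1 x = W^-1 * ((pd x * pg1 x - pd1 x * pg x) * f1 x) by rewrite wronskian mulKf.
rewrite [LHS]E; ring.
Qed.

End uniqueness.

(** The parities of the first operator: [tint] multiplies the even [pg], so no orthogonality is
    asked of [h]. *)
Lemma green_even_odd h x : continuous h -> (forall y, h (- y) = h y) ->
  (forall y, pd (- y) = - pd y) -> (forall y, pg (- y) = pg y) ->
  green h (- x) = green h x.
Proof.
move=> ch eh od eg; rewrite /green eg od prim_odd; [|exact: contM|by move=> y; rewrite od eh mulNr].
rewrite prim_even; [|exact: contM|by move=> y; rewrite eg eh].
by rewrite mulrNN.
Qed.

(** The parities of the second operator: [tint] multiplies the odd [pg], so an even result requires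
    [h] to be orthogonal to the kernel function [pd]. *)
Lemma green_even_even h x : continuous h -> (forall y, h (- y) = h y) ->
  (forall y, pd (- y) = pd y) -> (forall y, pg (- y) = - pg y) ->
  tint (fun y => pd y * h y) = 0 ->
  green h (- x) = green h x.
Proof.
move=> ch eh ed og t0; rewrite /green og ed t0 !sub0r.
rewrite prim_even; [|exact: contM|by move=> y; rewrite ed eh].
rewrite prim_odd; [|exact: contM|by move=> y; rewrite og eh mulNr].
by rewrite mulrNN.
Qed.

Lemma green0 h : pg 0 = 0 -> green h 0 = 0.
Proof. by move=> g0; rewrite /green g0 !prim0 mul0r mulr0 addr0 mulr0. Qed.

End green.

(** * The two linearized operators *)

Section hyperbolic.
Context {R : realType}.
Implicit Types (x y : R).

Let den x : R := expR x + expR (- x).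

Let den_gt0 x : 0 < den x.
Proof. by rewrite addr_gt0 ?expR_gt0. Qed.

Let has_deriv_den : has_deriv den (fun x => expR x - expR (- x)).
Proof.
have d1 := has_deriv_expR (@has_deriv_id R).
have d2 := has_deriv_expR (has_derivN (@has_deriv_id R)).
apply: has_deriv_eq (has_derivD d1 d2) _ => x; ring.
Qed.

Definition th x : R := (expR x - expR (- x)) / (expR x + expR (- x)).

Lemma has_deriv_sech : has_deriv (@sech R) (fun x => - (sech x * th x)).
Proof.
have dn0 x : den x != 0 by rewrite gt_eqF.
apply: has_deriv_eq (has_derivZ 2 (has_derivV has_deriv_den dn0)) _ => x.
by rewrite /sech /th -/(den x); field.
Qed.

Lemma sech_gt0 x : 0 < sech x.
Proof. by rewrite divr_gt0 ?den_gt0. Qed.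

Lemma sech_le x : sech x <= 2 * expR (- x).
Proof.
rewrite ler_wpM2l// [leRHS]expRN lef_pV2 ?posrE ?expR_gt0 ?den_gt0//.
by rewrite lerDl expR_ge0.
Qed.

Lemma sech_ge x : 0 <= x -> expR (- x) <= sech x.
Proof.
move=> x0; rewrite /sech ler_pdivlMr ?den_gt0// mulrDr -!expRD addNr expR0.
by rewrite -opprD -mulr2n; have : expR (- (x *+ 2)) <= 1; [rewrite expR_le1; lra|lra].
Qed.

Lemma sech2_th2 x : sech x ^+ 2 + th x ^+ 2 = 1.
Proof.
rewrite /sech /th -/(den x); have := den_gt0 x; rewrite lt0r => /andP[d0 _].
have : (2:R) ^+ 2 + (expR x - expR (- x)) ^+ 2 = den x ^+ 2.
  by rewrite /den; have := expRxMexpNx_1 x; rewrite !expr2; lra.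
by move=> E; rewrite !expr_div_n -mulrDl E mulfV// expf_neq0.
Qed.

Lemma sech_le1 x : sech x <= 1.
Proof.
have := sech2_th2 x; have := sech_gt0 x; have := sqr_ge0 (th x); nra.
Qed.

Lemma th_le1 x : `|th x| <= 1.
Proof.
have := sech2_th2 x; have := sqr_ge0 (sech x) => h1 h2.
by rewrite -(@expr_le1 _ 2)// real_normK ?num_real//; lra.
Qed.

Lemma has_deriv_th : has_deriv th (fun x => sech x ^+ 2).
Proof.
have dn0 x : den x != 0 by rewrite gt_eqF.
have d1 := has_deriv_expR (@has_deriv_id R).
have d2 := has_deriv_expR (has_derivN (@has_deriv_id R)).
apply: has_deriv_eq (has_derivM (has_derivB d1 d2) (has_derivV has_deriv_den dn0)) _ => x.
rewrite /sech -/(den x).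
have h : (expR x - expR (- x)) ^+ 2 = den x ^+ 2 - 4.
  by rewrite /den; have := expRxMexpNx_1 x; rewrite !expr2; lra.
have -> : 1 * expR x - -1 * expR (- x) = den x by rewrite /den; ring.
have -> : den x * (den x)^-1 + (expR x - expR (- x)) * - ((expR x - expR (- x)) / den x ^+ 2)
  = 1 - (expR x - expR (- x)) ^+ 2 / den x ^+ 2 by field.
by rewrite h; field.
Qed.

Lemma sechN x : sech (- x) = sech x.
Proof. by rewrite /sech opprK addrC. Qed.

Lemma thN x : th (- x) = - th x.
Proof. by rewrite /th opprK [X in _ / X]addrC -mulNr opprB. Qed.

Lemma th0 : th 0 = 0.
Proof. by rewrite /th oppr0 subrr mul0r. Qed.

End hyperbolic.

(** * Explicit solutions for the operator [L_1] *)

Section first_operator.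
Context {R : realType}.
Variable a : R.
Hypothesis a0 : 0 < a.
Implicit Types (x : R).

Let S x := sech (a * x).
Let t x := th (a * x).

Let dS : has_deriv S (fun x => - (a * (S x * t x))).
Proof.
have := has_deriv_comp has_deriv_sech (has_derivZ a (@has_deriv_id R)).
by move=> /has_deriv_eq; apply => x; rewrite mulr1 mulrN.
Qed.

Let dt : has_deriv t (fun x => a * S x ^+ 2).
Proof.
have := has_deriv_comp has_deriv_th (has_derivZ a (@has_deriv_id R)).
by move=> /has_deriv_eq; apply => x; rewrite mulr1.
Qed.

Let S_neq0 x : S x != 0.
Proof. by rewrite gt_eqF// sech_gt0. Qed.

Let dC : has_deriv (fun x => (S x)^-1 ^+ 2) (fun x => 2 * a * (t x * (S x)^-1 ^+ 2)).
Proof.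
have d := has_derivV dS S_neq0.
apply: has_deriv_eq (has_derivM d d) _ => x; field; exact: S_neq0.
Qed.

Let St x : t x ^+ 2 = 1 - S x ^+ 2.
Proof. by have := sech2_th2 (a * x); rewrite -/(S x) -/(t x); lra. Qed.

(** This is [c - U0] written with [a = sqrt c / 2], so that [c = 4 a^2]. *)
Definition pot1 x : R := 4 * a ^+ 2 - 12 * a ^+ 2 * sech (a * x) ^+ 2.

(** A multiple of the derivative of the soliton [U0], which spans the kernel of [L_1]. *)
Definition dec1 x := sech (a * x) ^+ 2 * th (a * x).
Definition dec1' x := a * (3 * sech (a * x) ^+ 4 - 2 * sech (a * x) ^+ 2).

(* Up to a factor, the associated Legendre function of the second kind
   [Q_3^2(tanh (a x))]. *)
Definition gro1 x := 15 * (a * x) * dec1 x + 5 - 15 * sech (a * x) ^+ 2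
  + 2 * (sech (a * x))^-1 ^+ 2.
Definition gro1' x := 45 * a * dec1 x + 15 * (a * x) * dec1' x
  + 4 * a * (th (a * x) * (sech (a * x))^-1 ^+ 2).

Lemma has_deriv_dec1 : has_deriv dec1 dec1'.
Proof.
apply: has_deriv_eq (has_derivM (has_derivM dS dS) dt) _ => x; rewrite /dec1' -/(S x).
transitivity (a * S x ^+ 4 - 2 * a * S x ^+ 2 * t x ^+ 2); first ring.
rewrite St; ring.
Qed.

Lemma has_deriv_dec1' : has_deriv dec1' (fun x => pot1 x * dec1 x).
Proof.
have dS2 := has_derivM dS dS.
have dS4 := has_derivM dS2 dS2.
have -> : dec1' = (fun x => a * (3 * (S x * S x * (S x * S x)) - 2 * (S x * S x))).
  by apply/funext => x; rewrite /dec1' -/(S x); ring.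
apply: has_deriv_eq (has_derivZ a (has_derivB (has_derivZ 3 dS4) (has_derivZ 2 dS2))) _ => x.
rewrite /pot1 /dec1 -/(S x) -/(t x); ring.
Qed.

Lemma has_deriv_gro1 : has_deriv gro1 gro1'.
Proof.
have d1 := has_derivM (has_derivZ 15 (has_derivZ a (@has_deriv_id R))) has_deriv_dec1.
have d2 := has_derivZ 15 (has_derivM dS dS).
have d3 := has_derivZ 2 dC.
have := has_derivD (has_derivB (has_derivD d1 (has_deriv_cst 5)) d2) d3.
move=> /has_deriv_eq; apply => x.
rewrite /gro1' /dec1 -/(S x) -/(t x); ring.
Qed.

Lemma has_deriv_gro1' : has_deriv gro1' (fun x => pot1 x * gro1 x).
Proof.
have d1 := has_derivZ (45 * a) has_deriv_dec1.
have d2 := has_derivM (has_derivZ 15 (has_derivZ a (@has_deriv_id R))) has_deriv_dec1'.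
have d3 := has_derivZ (4 * a) (has_derivM dt dC).
have := has_derivD (has_derivD d1 d2) d3.
move=> /has_deriv_eq; apply => x.
rewrite /gro1 /dec1 /dec1' /pot1 /dec1 -/(S x) -/(t x).
have Sx := S_neq0 x.
have -> : a * S x ^+ 2 * (S x)^-1 ^+ 2 + t x * (2 * a * (t x * (S x)^-1 ^+ 2)) =
  a + 2 * a * t x ^+ 2 * (S x)^-1 ^+ 2 by field.
rewrite St; field.
exact: Sx.
Qed.

Lemma wronskian1 x : dec1 x * gro1' x - dec1' x * gro1 x = 8 * a.
Proof.
have Sx := S_neq0 x.
rewrite /gro1 /gro1' /dec1' /dec1 -/(S x) -/(t x).
transitivity (a * (45 * S x ^+ 4 * t x ^+ 2 + 4 * t x ^+ 2 -
   (3 * S x ^+ 4 - 2 * S x ^+ 2) * (5 - 15 * S x ^+ 2) - 2 * (3 * S x ^+ 2 - 2))); first by field.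
rewrite St; ring.
Qed.

Let S2_le x : S x ^+ 2 <= 4 * expR (- (2 * a) * x).
Proof.
have h := sech_le (a * x); have := sech_gt0 (a * x); rewrite -/(S x) in h * => S0.
have -> : expR (- (2 * a) * x) = expR (- (a * x)) ^+ 2.
  by rewrite -expRM_natl; congr expR; ring.
have := expR_ge0 (- (a * x)); nra.
Qed.

Let S2_01 x : 0 <= S x ^+ 2 <= 1.
Proof.
rewrite sqr_ge0/=; have := sech_le1 (a * x); have := sech_gt0 (a * x).
rewrite -/(S x); nra.
Qed.

Let t_le x : `|t x| <= 1. Proof. exact: th_le1. Qed.

Let E_ge1 x : 0 <= x -> 1 <= expR (2 * a * x).
Proof. by move=> x0; rewrite -expR0 ler_expR !mulr_ge0// ltW. Qed.

(** Exponential decay of [sech^2] absorbs the linear factor in [gro1] and [gro1']. *)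
Let ySx x : 0 <= x -> 0 <= a * x * S x ^+ 2 <= 4.
Proof.
move=> x0; have ax0 : 0 <= a * x by rewrite mulr_ge0// ltW.
have /andP[S0 _] := S2_01 x.
rewrite mulr_ge0//=.
have h : a * x * S x ^+ 2 <= a * x * (4 * expR (- (2 * a) * x)) by rewrite ler_wpM2l.
apply: le_trans h _.
have h2 := expR_ge1Dx (2 * a * x).
have := expRxMexpNx_1 (2 * a * x); rewrite -!mulNr.
have := expR_ge0 (- (2 * a) * x); set E := expR (- (2 * a) * x) in h2 *; set E' := expR _ in h2 *.
move=> E0 EE; nra.
Qed.

Let C_le x : 0 <= x -> 0 <= (S x)^-1 ^+ 2 <= expR (2 * a * x).
Proof.
move=> x0; rewrite sqr_ge0/=.
have ax0 : 0 <= a * x by rewrite mulr_ge0// ltW.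
have h : (S x)^-1 <= expR (a * x).
  rewrite -[expR _]invrK lef_pV2 ?posrE ?sech_gt0 ?invr_gt0 ?expR_gt0// -expRN.
  exact: sech_ge.
have -> : expR (2 * a * x) = expR (a * x) ^+ 2 by rewrite -expRM_natl mulrA.
have : 0 < (S x)^-1 by rewrite invr_gt0 sech_gt0.
nra.
Qed.

(** 72 = 60 + 10 + 2 bounds the parts of [gro1], and 169 = 45 + 120 + 4 those of [gro1'] after a
    factor [a] is taken out. One constant serves all four functions. *)
Definition bnd1 : R := 72 + 169 * a.

Lemma dec1_le x : 0 <= x -> `|dec1 x| <= bnd1 * expR (- (2 * a) * x).
Proof.
move=> x0; rewrite /dec1 -/(S x) -/(t x) normrM.
have /andP[S0 _] := S2_01 x; rewrite (ger0_norm S0).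
have := S2_le x; have := t_le x; have := normr_ge0 (t x).
have := expR_ge0 (- (2 * a) * x); set E := expR _; rewrite /bnd1 => E0 t0 t1 S4.
have h : S x ^+ 2 * `|t x| <= 4 * E by nra.
by apply: le_trans h _; rewrite ler_wpM2r//; move: a0; lra.
Qed.

Let S3 x : `|3 * S x ^+ 4 - 2 * S x ^+ 2| <= 2 * S x ^+ 2.
Proof.
have /andP[S0 S1] := S2_01 x.
have -> : 3 * S x ^+ 4 - 2 * S x ^+ 2 = S x ^+ 2 * (3 * S x ^+ 2 - 2) by ring.
by rewrite ler_norml; apply/andP; split; nra.
Qed.

Lemma dec1'_le x : 0 <= x -> `|dec1' x| <= bnd1 * expR (- (2 * a) * x).
Proof.
move=> x0; rewrite /dec1' -/(S x) normrM gtr0_norm//.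
have := S3 x; have := S2_le x.
have := expR_ge0 (- (2 * a) * x); set E := expR _; rewrite /bnd1 => E0 S4 h.
have h2 : a * `|3 * S x ^+ 4 - 2 * S x ^+ 2| <= a * (8 * E).
  by apply: ler_wpM2l; [exact: ltW|lra].
apply: le_trans h2 _; rewrite mulrCA mulrA ler_wpM2r//; move: a0; lra.
Qed.

Lemma gro1_le x : 0 <= x -> `|gro1 x| <= bnd1 * expR (2 * a * x).
Proof.
move=> x0; rewrite /gro1 /dec1 -/(S x) -/(t x).
have := E_ge1 x0; have := C_le x0; have := ySx x0; have := S2_01 x.
set E := expR _; set C := _^-1 ^+ 2; rewrite /bnd1 => /andP[s0 s1] /andP[y0 y4] /andP[C0 CE] E1.
have -> : 15 * (a * x) * (S x ^+ 2 * t x) = 15 * (a * x * S x ^+ 2) * t x by ring.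
have := t_le x; rewrite ler_norml => /andP[t1 t2].
have aE : 0 <= a * E by rewrite mulr_ge0 ?ltW//; apply: lt_le_trans E1.
rewrite ler_norml; apply/andP; split; nra.
Qed.

Lemma gro1'_le x : 0 <= x -> `|gro1' x| <= bnd1 * expR (2 * a * x).
Proof.
move=> x0; rewrite /gro1' /dec1 /dec1' -/(S x) -/(t x).
have := E_ge1 x0; have := C_le x0; have := ySx x0; have := S2_01 x; have := S3 x.
set E := expR _; set C := _^-1 ^+ 2; set Q := 3 * _ - _.
rewrite /bnd1 => HQ /andP[s0 s1] /andP[y0 y4] /andP[C0 CE] E1.
have ax0 : 0 <= a * x by rewrite mulr_ge0// ltW.
have t1 := t_le x.
have h1 : `|S x ^+ 2 * t x| <= 1.
  by rewrite normrM (ger0_norm s0) mulr_ile1.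
have h2 : `|a * x * Q| <= 8.
  rewrite normrM (ger0_norm ax0).
  have : a * x * `|Q| <= a * x * (2 * S x ^+ 2) by rewrite ler_wpM2l.
  lra.
have h3 : `|t x * C| <= E.
  rewrite normrM (ger0_norm C0); have := normr_ge0 (t x); nra.
have -> : 45 * a * (S x ^+ 2 * t x) + 15 * (a * x) * (a * Q) + 4 * a * (t x * C) =
  a * (45 * (S x ^+ 2 * t x) + 15 * (a * x * Q) + 4 * (t x * C)) by ring.
rewrite normrM gtr0_norm//.
have h4 : `|45 * (S x ^+ 2 * t x) + 15 * (a * x * Q) + 4 * (t x * C)| <= 169 * E.
  move: h1 h2 h3; rewrite !ler_norml => /andP[? ?] /andP[? ?] /andP[? ?].
  by apply/andP; split; lra.
apply: le_trans (_ : a * (169 * E) <= _); first by apply: ler_wpM2l; [exact: ltW|].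
have : 0 <= E by lra.
lra.
Qed.

Lemma dec1N x : dec1 (- x) = - dec1 x.
Proof. by rewrite /dec1 mulrN sechN thN mulrN. Qed.

Lemma gro1N x : gro1 (- x) = gro1 x.
Proof. by rewrite /gro1 dec1N [a * - x]mulrN sechN; ring. Qed.

Lemma gro1'0 : gro1' 0 = 0.
Proof. by rewrite /gro1' /dec1 !mulr0 th0 mulr0 !mul0r !mulr0 !addr0. Qed.

End first_operator.

(** * Explicit solutions for the linearized amplitude equation *)

Section second_operator.
Context {R : realType}.
Variables a p : R.
Hypotheses (a0 : 0 < a) (p0 : 0 < p).
Implicit Types (x : R).

(** This is [- Omega_c - k U0], by [Omega_c = - a^2 p^2] and [p (p + 1) = 12 k]. *)
Definition pot2 x : R := a ^+ 2 * (p ^+ 2 - p * (p + 1) * sech (a * x) ^+ 2).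

Definition dec2 x := sech (a * x) `^ p.
Definition dec2' x := - (a * p) * (th (a * x) * dec2 x).

(** Reduction of order from [dec2]; starting the integral at 0 makes the solution odd, with
    Wronskian 1. *)
Definition gro2 x := dec2 x * prim (fun y => (dec2 y)^-1 ^+ 2) x.
Definition gro2' x := dec2' x * prim (fun y => (dec2 y)^-1 ^+ 2) x + (dec2 x)^-1.

Lemma dec2E x : dec2 x = expR (p * ln (sech (a * x))).
Proof. by rewrite /dec2 /powR gt_eqF// sech_gt0. Qed.

Lemma dec2_gt0 x : 0 < dec2 x.
Proof. by rewrite dec2E expR_gt0. Qed.

Let dec2_neq0 x : dec2 x != 0. Proof. by rewrite gt_eqF// dec2_gt0. Qed.

Let dS : has_deriv (fun x => sech (a * x)) (fun x => - (a * (sech (a * x) * th (a * x)))).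
Proof.
have := has_deriv_comp has_deriv_sech (has_derivZ a (@has_deriv_id R)).
by move=> /has_deriv_eq; apply => x; rewrite mulr1 mulrN.
Qed.

Let dt : has_deriv (fun x => th (a * x)) (fun x => a * sech (a * x) ^+ 2).
Proof.
have := has_deriv_comp has_deriv_th (has_derivZ a (@has_deriv_id R)).
by move=> /has_deriv_eq; apply => x; rewrite mulr1.
Qed.

Lemma has_deriv_dec2 : has_deriv dec2 dec2'.
Proof.
have dl : has_deriv (fun x => ln (sech (a * x))) (fun x => - a * th (a * x)).
  move=> x; have l := is_derive1_ln (sech_gt0 (a * x)); have s := dS x.
  apply: is_derive_eq (is_derive_comp (g := fun x => sech (a * x)) l s) _.
  by field; rewrite gt_eqF// sech_gt0.
have -> : dec2 = (fun x => expR (p * ln (sech (a * x)))) by apply/funext => x; exact: dec2E.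
apply: has_deriv_eq (has_deriv_expR (has_derivZ p dl)) _ => x.
by rewrite /dec2' dec2E; ring.
Qed.

Lemma has_deriv_dec2' : has_deriv dec2' (fun x => pot2 x * dec2 x).
Proof.
apply: has_deriv_eq (has_derivZ (- (a * p)) (has_derivM dt has_deriv_dec2)) _ => x.
rewrite /dec2' /pot2.
have St : th (a * x) ^+ 2 = 1 - sech (a * x) ^+ 2 by have := sech2_th2 (a * x); lra.
transitivity (- (a ^+ 2 * p) * (sech (a * x) ^+ 2 - p * th (a * x) ^+ 2) * dec2 x); first ring.
rewrite St; ring.
Qed.

Lemma continuous_dec2V2 : continuous (fun y => (dec2 y)^-1 ^+ 2).
Proof. by apply: contX; exact: has_deriv_cont (has_derivV has_deriv_dec2 dec2_neq0). Qed.

Lemma has_deriv_gro2 : has_deriv gro2 gro2'.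
Proof.
apply: has_deriv_eq (has_derivM has_deriv_dec2 (has_deriv_prim continuous_dec2V2)) _ => x.
by rewrite /gro2'; field.
Qed.

Lemma has_deriv_gro2' : has_deriv gro2' (fun x => pot2 x * gro2 x).
Proof.
have d1 := has_derivM has_deriv_dec2' (has_deriv_prim continuous_dec2V2).
apply: has_deriv_eq (has_derivD d1 (has_derivV has_deriv_dec2 dec2_neq0)) _ => x.
by rewrite /gro2; field.
Qed.

Lemma wronskian2 x : dec2 x * gro2' x - dec2' x * gro2 x = 1.
Proof. by rewrite /gro2 /gro2'; field. Qed.

Lemma dec2N x : dec2 (- x) = dec2 x.
Proof. by rewrite /dec2 mulrN sechN. Qed.

Lemma gro2N x : gro2 (- x) = - gro2 x.
Proof.
rewrite /gro2 dec2N prim_even; first exact: mulrN.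
- exact: continuous_dec2V2.
- by move=> y; rewrite dec2N.
Qed.

Lemma gro20 : gro2 0 = 0. Proof. by rewrite /gro2 prim0 mulr0. Qed.

Lemma dec20 : dec2 0 = 1.
Proof. by rewrite /dec2 mulr0 /sech oppr0 expR0 divff// powR1. Qed.

Lemma dec2'0 : dec2' 0 = 0.
Proof. by rewrite /dec2' mulr0 th0 mul0r mulr0. Qed.

Let m := p * a.

Let m0 : 0 < m. Proof. by rewrite mulr_gt0. Qed.

Lemma dec2_le x : dec2 x <= 2 `^ p * expR (- (p * a) * x).
Proof.
have -> : 2 `^ p * expR (- (p * a) * x) = expR (p * ln (2 * expR (- (a * x)))).
  rewrite /powR ifF; last by apply/negbTE; rewrite pnatr_eq0.
  rewrite -expRD lnM ?posrE ?expR_gt0// expRK; congr expR; ring.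
rewrite dec2E ler_expR ler_pM2l// ler_ln ?posrE ?sech_gt0 ?mulr_gt0 ?expR_gt0//.
exact: sech_le.
Qed.

Lemma dec2V_le x : 0 <= x -> (dec2 x)^-1 <= expR (p * a * x).
Proof.
move=> x0; rewrite -[leRHS]invrK lef_pV2 ?posrE ?dec2_gt0 ?invr_gt0 ?expR_gt0//.
rewrite -expRN dec2E ler_expR.
have -> : - (p * a * x) = p * ln (expR (- (a * x))) by rewrite expRK; ring.
rewrite ler_pM2l// ler_ln ?posrE ?sech_gt0 ?expR_gt0//.
by apply: sech_ge; rewrite mulr_ge0// ltW.
Qed.

Let P_le x : 0 <= x -> 0 <= prim (fun y => (dec2 y)^-1 ^+ 2) x <= (2 * m)^-1 * expR (m * x) ^+ 2.
Proof.
move=> x0; rewrite prim_ge0//=; last 2 first.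
- exact: continuous_dec2V2.
- by move=> y; rewrite sqr_ge0.
have dG := has_deriv_exp_lin (2 * m)^-1 (2 * m).
have := has_deriv_dominated (has_deriv_prim continuous_dec2V2) dG x0.
rewrite prim0 subr0 mulr0 expR0 mulr1 => H.
rewrite -expRM_natl mulrA.
have : `|prim (fun y => (dec2 y)^-1 ^+ 2) x| <= (2 * m)^-1 * expR (2 * m * x) - (2 * m)^-1.
  apply: H => y y0 _; rewrite mulVf; last by rewrite gt_eqF// mulr_gt0.
  rewrite mul1r ger0_norm ?sqr_ge0// -mulrA expRM_natl.
  have := dec2V_le y0; have : 0 < (dec2 y)^-1 by rewrite invr_gt0 dec2_gt0.
  rewrite -/m; nra.
move=> /(le_trans (ler_norm _)) h; apply: le_trans h _.
by rewrite gerBl invr_ge0 mulr_ge0// ltW.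
Qed.

(** [2^p] comes from [sech y <= 2 exp (- y)], [p a] from differentiating [dec2], [1 / (2 p a)] from
    integrating [exp (2 p a x)], and the last 1 from [1 / dec2]. *)
Definition bnd2 : R := 2 `^ p * (1 + p * a + (2 * (p * a))^-1) + 1.

Let q0 : 0 <= 2 `^ p :> R. Proof. exact: powR_ge0. Qed.
Let v0 : 0 <= (2 * m)^-1. Proof. by rewrite invr_ge0 mulr_ge0// ltW. Qed.

Lemma dec2_norm_le x : `|dec2 x| <= bnd2 * expR (- (p * a) * x).
Proof.
rewrite ger0_norm; last exact/ltW/dec2_gt0.
apply: le_trans (dec2_le x) _; rewrite ler_wpM2r ?expR_ge0// /bnd2 -/m.
move: m0 q0 v0; nra.
Qed.

Lemma dec2'_le x : `|dec2' x| <= bnd2 * expR (- (p * a) * x).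
Proof.
have t1 := th_le1 (a * x); have g0 := dec2_gt0 x.
rewrite /dec2' normrM normrN [`|th _ * _|]normrM (gtr0_norm g0).
have -> : `|a * p| = m by rewrite gtr0_norm ?mulr_gt0// mulrC.
have gE := dec2_le x.
apply: le_trans (_ : m * (2 `^ p * expR (- (p * a) * x)) <= _).
  apply: ler_wpM2l; first exact: ltW.
  by apply: le_trans gE; rewrite ler_piMl// ltW.
rewrite mulrA ler_wpM2r ?expR_ge0// /bnd2 -/m.
move: m0 q0 v0; nra.
Qed.

Lemma gro2_le x : 0 <= x -> `|gro2 x| <= bnd2 * expR (p * a * x).
Proof.
move=> x0; rewrite /gro2 normrM (gtr0_norm (dec2_gt0 x)).
have /andP[P0 P1] := P_le x0; rewrite (ger0_norm P0).
have := dec2_le x; have := dec2_gt0 x; rewrite mulNr expRN -/m.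
have := expR_gt0 (m * x); set g := dec2 x; set E := expR _; set P := prim _ _ in P0 P1 * => E0 g0 gE.
have h : g * P <= (2 `^ p / E) * ((2 * m)^-1 * E ^+ 2) by apply: ler_pM => //; exact: ltW.
apply: le_trans h _.
have -> : 2 `^ p / E * ((2 * m)^-1 * E ^+ 2) = 2 `^ p * (2 * m)^-1 * E.
  by field; rewrite !gt_eqF// mulr_gt0.
apply: ler_wpM2r; first exact: ltW.
by rewrite /bnd2 -/m; move: m0 q0 v0; nra.
Qed.

Lemma gro2'_le x : 0 <= x -> `|gro2' x| <= bnd2 * expR (p * a * x).
Proof.
move=> x0; rewrite /gro2' /dec2'.
have /andP[P0 P1] := P_le x0.
have := dec2_le x; have := dec2_gt0 x; rewrite mulNr expRN -/m.
have := dec2V_le x0; rewrite -/m.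
have t1 := th_le1 (a * x).
have := expR_gt0 (m * x); set E := expR _ in P1 *; set P := prim _ _ in P0 P1 * => E0 gE' g0 gE.
have V0 : 0 < (dec2 x)^-1 by rewrite invr_gt0.
have h : dec2 x * P <= (2 `^ p / E) * ((2 * m)^-1 * E ^+ 2) by apply: ler_pM => //; exact: ltW.
have h1 : `|- (a * p) * (th (a * x) * dec2 x) * P| <= m * (dec2 x * P).
  rewrite normrM (ger0_norm P0) normrM normrN [`|th _ * _|]normrM (gtr0_norm g0).
  have -> : `|a * p| = m by rewrite gtr0_norm ?mulr_gt0// mulrC.
  have -> : m * (`|th (a * x)| * dec2 x) * P = m * (`|th (a * x)| * (dec2 x * P)) by ring.
  apply: ler_wpM2l; first exact: ltW.
  by apply: ler_piMl => //; rewrite mulr_ge0// ltW. 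
have h2 : m * (dec2 x * P) <= 2 `^ p / 2 * E.
  have -> : 2 `^ p / 2 * E = m * (2 `^ p / E * ((2 * m)^-1 * E ^+ 2)).
    by field; rewrite !gt_eqF.
  by apply: ler_wpM2l; [exact: ltW|].
apply: le_trans (ler_normD _ _) _; rewrite (gtr0_norm V0).
have h3 : 2 `^ p / 2 * E + E <= bnd2 * E.
  rewrite -[X in _ + X <= _]mul1r -mulrDl; apply: ler_wpM2r; first exact: ltW.
  by rewrite /bnd2 -/m; move: m0 q0 v0; nra.
lra.
Qed.

End second_operator.

(** * The fixed-point problem *)

Section picard.
Context {R : realType}.

Lemma half_pow_small (C e : R) : 0 < e -> exists n : nat, C / 2 ^+ n <= e.
Proof.
move=> e0; have [C0|C0] := leP C 0.
  by exists 0%N; rewrite expr0 divr1 (le_trans C0)// ltW.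
have [n Hn] : exists n : nat, C / e <= n%:R.
  by exists (Num.bound (C / e)); apply: ltW; apply: archi_boundP; rewrite divr_ge0// ltW.
exists n; rewrite ler_pdivrMr ?exprn_gt0// mulrC -ler_pdivrMr//.
apply: le_trans Hn _; rewrite -natrX ler_nat; exact/ltnW/ltn_expl.
Qed.

Lemma le0_half_pow (C z : R) : (forall n : nat, z <= C / 2 ^+ n) -> z <= 0.
Proof.
move=> h; apply/ler_addgt0Pl => e e0; rewrite addr0.
have [n Hn] := half_pow_small C e0; exact: le_trans (h n) Hn.
Qed.

Lemma continuous_unif_limit (f : R -> R) C (fn : nat -> R -> R) :
  (forall n, continuous (fn n)) -> (forall n x, `|f x - fn n x| <= C / 2 ^+ n) ->
  continuous f.
Proof.
move=> cfn h x; apply/cvgrPdist_le => e e0.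
have e3 : 0 < e / 3 by rewrite divr_gt0.
have [n Hn] := half_pow_small C e3.
have /cvgrPdist_le /(_ _ e3) := cfn n x.
apply: filterS => y Hy.
have -> : f x - f y = (f x - fn n x) + (fn n x - fn n y) - (f y - fn n y) by ring.
have h1 := le_trans (h n x) Hn; have h2 := le_trans (h n y) Hn.
apply: le_trans (ler_normB _ _) _; apply: le_trans (lerD (ler_normD _ _) (lexx _)) _.
lra.
Qed.

Variables (I : Type) (rho : I -> R) (S : (I -> R) -> Prop) (T : (I -> R) -> I -> R)
  (p0 : I -> R) (M : R).
Hypotheses (rho0 : forall i, 0 <= rho i) (M0 : 0 <= M) (Sp0 : S p0)
  (ST : forall p, S p -> S (T p))
  (init : forall i, `|T p0 i - p0 i| <= M * rho i)
  (contr : forall p q d, 0 <= d -> S p -> S q -> (forall i, `|p i - q i| <= d * rho i) ->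
    forall i, `|T p i - T q i| <= d / 2 * rho i)
  (closed_S : forall (pn : nat -> I -> R) p, (forall n, S (pn n)) ->
    (forall n i, `|p i - pn n i| <= 2 * M / 2 ^+ n * rho i) -> S p).

(** At each index the intervals of centre [pn n] and radius [b n] are nested, and the limit is the
    supremum of their lower ends; no normed function space is involved. The index type is arbitrary
    so that a pair of functions can be treated as one. *)
Lemma picard_fixpoint : exists2 p, S p & T p = p.
Proof.
pose pn n := iter n T p0.
have Spn n : S (pn n) by elim: n => // n; exact: ST.
have stp n i : `|pn n.+1 i - pn n i| <= M / 2 ^+ n * rho i.
  elim: n i => [i|n IH i]; first by rewrite expr0 divr1; exact: init.
  have Mn : 0 <= M / 2 ^+ n by rewrite divr_ge0// exprn_ge0.
  have := contr Mn (Spn n.+1) (Spn n) IH i.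
  by rewrite exprSr invfM mulrA.
(* The sum of the geometric series bounding all the steps from the [n]-th on. *)
pose b n i := 2 * M / 2 ^+ n * rho i.
have b0 n i : 0 <= b n i by rewrite /b mulr_ge0// divr_ge0 ?mulr_ge0// exprn_ge0.
have bS n i : b n.+1 i = b n i - M / 2 ^+ n * rho i.
  by rewrite /b exprSr invfM; have : (2:R) ^+ n != 0; [rewrite expf_neq0|move=> ?; field].
have lo m n i : (m <= n)%N -> pn m i - b m i <= pn n i - b n i.
  move=> /subnKC <-; elim: (n - m)%N => [|j IH]; first by rewrite addn0.
  rewrite addnS; apply: le_trans IH _; rewrite bS.
  by have := stp (m + j)%N i; rewrite ler_norml => /andP[]; lra.
have hi m n i : (m <= n)%N -> pn n i + b n i <= pn m i + b m i.
  move=> /subnKC <-; elim: (n - m)%N => [|j IH]; first by rewrite addn0.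
  rewrite addnS; apply: le_trans IH; rewrite bS.
  by have := stp (m + j)%N i; rewrite ler_norml => /andP[]; lra.
have lohi m n i : pn m i - b m i <= pn n i + b n i.
  have [mn|/ltnW nm] := leqP m n.
    by have := lo _ _ i mn; have := b0 n i; lra.
  by have := hi _ _ i nm; have := b0 m i; lra.
pose A i := [set pn n i - b n i | n in [set: nat]].
pose p i := sup (A i).
have ub n i : ubound (A i) (pn n i + b n i) by move=> _ [m _ <-]; exact: lohi.
have pP n i : `|p i - pn n i| <= b n i.
  rewrite ler_norml; apply/andP; split.
    have : pn n i - b n i <= p i.
      by apply: ub_le_sup; [exists (pn 0%N i + b 0%N i); exact: ub|exists n].
    lra.
  have : p i <= pn n i + b n i.
    by apply: ge_sup; [exists (pn 0%N i - b 0%N i), 0%N|exact: ub].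
  lra.
have Sp : S p by apply: closed_S pP.
exists p => //; apply/funext => i; apply/eqP; rewrite -subr_eq0 -normr_le0.
apply: (@le0_half_pow (2 * M * rho i)) => n.
have Mn : 0 <= 2 * M / 2 ^+ n by rewrite divr_ge0 ?mulr_ge0// exprn_ge0.
have h1 := contr Mn Sp (Spn n) (pP n) i.
have h2 := pP n.+1 i; rewrite bS in h2.
(* Both [T p] and [p] are close to the iterate [pn n.+1], by contraction and by convergence. *)
have E : T p i - p i = (T p i - pn n.+1 i) - (p i - pn n.+1 i) by ring.
rewrite E; apply: le_trans (ler_normB _ _) _.
have e : 2 * M * rho i / 2 ^+ n = b n i by rewrite /b mulrAC.
have e2 : 2 * M / 2 ^+ n / 2 * rho i = b n i - M / 2 ^+ n * rho i.
  by rewrite /b; field; rewrite expf_neq0.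
rewrite e; move: h1; rewrite e2 /= => h1.
have e3 : M / 2 ^+ n * rho i = b n i / 2 by rewrite /b; field; rewrite expf_neq0.
move: h1 h2; rewrite e3; have -> : T (pn n) i = pn n.+1 i by []; lra.
Qed.

End picard.

(** * The contraction for [(w, h)], over abstract Green operators *)

Section reduced_equation.
Context {R : realType}.
Implicit Types (f w h F : R -> R) (x d M N delta : R).

(** The weight [r] enters through the differences alone, while the factors are bounded in plain
    absolute value; the result again carries exactly one weight. *)
Lemma mul_lip (x y x' y' X Y dx dy r : R) : 0 <= r ->
  `|x| <= X -> `|y'| <= Y -> `|x - x'| <= dx * r -> `|y - y'| <= dy * r ->
  `|x * y - x' * y'| <= (X * dy + Y * dx) * r.
Proof.
move=> r0 hx hy hdx hdy.
have -> : x * y - x' * y' = x * (y - y') + y' * (x - x') by ring.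
apply: le_trans (ler_normD _ _) _; rewrite !normrM mulrDl -!mulrA.
by apply: lerD; apply: ler_pM.
Qed.

Variables (k K Kt Kg : R) (rho g : R -> R).
Variables (G1 G2 : (R -> R) -> R -> R) (bt : (R -> R) -> R).

Definition wb M f := forall x, `|f x| <= M * rho x.

Definition adm f := [/\ continuous f, forall x, f (- x) = f x & exists M, wb M f].

Hypotheses (k0 : 0 < k) (K0 : 0 < K) (Kt0 : 0 < Kt) (Kg0 : 0 < Kg).
Hypotheses (rho0 : forall x, 0 <= rho x) (rho1 : forall x, rho x <= 1).
Hypotheses (adm_g : adm g) (wb_g : wb Kg g).
Hypotheses
  (adm_G1 : forall F, adm F -> adm (G1 F))
  (G1_le : forall F M, adm F -> wb M F -> wb (K * M) (G1 F))
  (G1B : forall F F', adm F -> adm F' -> forall x, G1 F x - G1 F' x = G1 (fun x => F x - F' x) x).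
Hypotheses
  (adm_G2 : forall F, adm F -> bt F = 0 -> adm (G2 F))
  (G2_le : forall F M, adm F -> bt F = 0 -> wb M F -> wb (K * M) (G2 F))
  (G2B : forall F F', adm F -> adm F' -> forall x, G2 F x - G2 F' x = G2 (fun x => F x - F' x) x).
Hypotheses
  (btB : forall F F', adm F -> adm F' -> bt (fun x => F x - F' x) = bt F - bt F')
  (btD : forall F F', adm F -> adm F' -> bt (fun x => F x + F' x) = bt F + bt F')
  (btZ : forall a F, adm F -> bt (fun x => a * F x) = a * bt F)
  (bt_le : forall F M, adm F -> wb M F -> `|bt F| <= Kt * M).

Lemma wb_le1 M f x : wb M f -> 0 <= M -> `|f x| <= M.
Proof. by move=> h M0; apply: le_trans (h x) _; rewrite ler_piMr. Qed.

Lemma wb_abs M f : wb M f -> exists2 M', 0 <= M' & wb M' f.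
Proof.
move=> h; exists `|M| => // x; apply: le_trans (h x) _.
by rewrite ler_wpM2r// ler_norm.
Qed.

Lemma adm_add f h : adm f -> adm h -> adm (fun x => f x + h x).
Proof.
move=> [cf ef [M hM]] [ch eh [N hN]]; split; [exact: contD|by move=> x; rewrite ef eh|].
exists (M + N) => x; apply: le_trans (ler_normD _ _) _; rewrite mulrDl; exact: lerD.
Qed.

Lemma adm_scale a f : adm f -> adm (fun x => a * f x).
Proof.
move=> [cf ef [M hM]]; split; [exact: contZ|by move=> x; rewrite ef|].
by exists (`|a| * M) => x; rewrite normrM -mulrA ler_wpM2l.
Qed.

Lemma adm_sub f h : adm f -> adm h -> adm (fun x => f x - h x).
Proof.
move=> af ah; have := adm_add af (adm_scale (-1) ah).
by under [in X in X -> _]eq_fun do rewrite mulN1r.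
Qed.

Lemma adm_mul f h : adm f -> adm h -> adm (fun x => f x * h x).
Proof.
move=> [cf ef [M0 hM0]] [ch eh [N0 hN0]]; split; [exact: contM|by move=> x; rewrite ef eh|].
have [M Mp hM] := wb_abs hM0; have [N Np hN] := wb_abs hN0.
exists (M * N) => x; rewrite normrM -mulrA; apply: ler_pM => //.
exact: wb_le1 hM Mp.
Qed.

(* The value for which [amp_source] is orthogonal to [g]. *)
Definition coupling w h := - bt (fun x => g x + h x) / (k * bt (fun x => w x * (g x + h x))).

(** The right-hand side of the amplitude equation divided by [alpha * delta], with
    [alpha^2 = delta * coupling w h] inserted. *)
Definition amp_source w h x := (1 + coupling w h * k * w x) * (g x + h x).

Definition amp_step delta w h x := delta * G2 (amp_source w h) x.

(** The slot [h1] receives the updated amplitude. With the old [h], the square would have a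
    Lipschitz constant of order 1 in [h]; the update varies by [O(delta)] only, and the map
    contracts. *)
Definition pot_source delta w h h1 x :=
  delta * coupling w h / 2 * (w x * w x) + (g x + h1 x) * (g x + h1 x).

Definition pot_step delta w h := G1 (pot_source delta w h (amp_step delta w h)).

Definition w0 := G1 (fun x => g x * g x).

(** Half of [<g^2, L_1^-1 g^2>], since [bt] integrates over the half-line. *)
Definition N0 := bt (fun x => w0 x * g x).

Hypotheses (N0_neq0 : N0 != 0) (D0_gt0 : 0 < bt g).

(** On the ball, [A] bounds [g + h], [B] bounds [w], [E] bounds [coupling] and [FB] bounds
    [amp_source]. The Lipschitz constants of the pairing in the denominator, of [coupling] and of
    [amp_source] are [NL], [EL], [FL]. Per unit of [delta], [HL] and [WL] are those of the two
    steps, and [WB] bounds the distance from [pot_step] to [w0]. *)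
Let A := Kg + 1.
Let B := K * (Kg * Kg) + 1.
Let NL := Kt * (A + B).
(** The entry 1 validates [A] and [B]; the second keeps the pairing in the denominator of [coupling]
    within [|N0| / 2] of [N0]; the third keeps [bt (g + h)] above half of [bt g]. *)
Definition ball_radius := Num.min 1 (Num.min (`|N0| / (2 * NL)) (bt g / (2 * Kt))).
Let r := ball_radius.
Let E := 2 * (Kt * A) / (k * `|N0|).
Let EL := (Kt * A * NL * 4 / N0 ^+ 2 + Kt * 2 / `|N0|) / k.
Let FB := (1 + E * k * B) * A.
Let FL := 1 + k * (A * B * EL + E * (A + B)).
Let HL := K * FL.
Let WL := K * ((EL * B * B + 2 * E * B) / 2 + 2 * A * HL).
Let WB := K * (E * B * B / 2 + 2 * A * (K * FB)).
Let Z := HL + WL + K * FB + WB + 1.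
(** Gives [|delta| * Z <= r / 2], where [Z] dominates the constants multiplying [delta]. As
    [r <= 1], the ball is preserved and the map contracts by 1/2. *)
Definition delta_radius := r / (2 * Z).

Let absN0 : 0 < `|N0|. Proof. by rewrite normr_gt0. Qed.
Let A1 : 1 <= A. Proof. by rewrite /A lerDr ltW. Qed.
Let A_gt0 : 0 < A. Proof. exact: lt_le_trans A1. Qed.
Let B1 : 1 <= B. Proof. by rewrite /B lerDr !mulr_ge0// ltW. Qed.
Let B_gt0 : 0 < B. Proof. exact: lt_le_trans B1. Qed.
Let NL_gt0 : 0 < NL. Proof. by rewrite mulr_gt0// addr_gt0. Qed.
Let r_gt0 : 0 < r.
Proof. by rewrite /r /ball_radius !lt_min ltr01 !divr_gt0// mulr_gt0//. Qed.
Let r1 : r <= 1. Proof. by rewrite /r /ball_radius ge_min lexx. Qed.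
Let rN : NL * r <= `|N0| / 2.
Proof.
have : r <= `|N0| / (2 * NL) by rewrite /r /ball_radius !ge_min lexx orbT.
rewrite ler_pdivlMr 1?mulr_gt0// => h; rewrite ler_pdivlMr//.
by have -> : NL * r * 2 = r * (2 * NL) by ring.
Qed.
Let rD : Kt * r <= bt g / 2.
Proof.
have : r <= bt g / (2 * Kt) by rewrite /r /ball_radius !ge_min lexx !orbT.
rewrite ler_pdivlMr 1?mulr_gt0// => h; rewrite ler_pdivlMr//.
by have -> : Kt * r * 2 = r * (2 * Kt) by ring.
Qed.
Let E_gt0 : 0 < E. Proof. by rewrite divr_gt0// !mulr_gt0. Qed.
Let N0sq : 0 < N0 ^+ 2.
Proof. by rewrite lt_def sqrf_eq0 N0_neq0 sqr_ge0. Qed.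
Let EL_gt0 : 0 < EL.
Proof.
apply: divr_gt0 => //; apply: addr_gt0; apply: divr_gt0 => //; last exact: mulr_gt0.
by apply: mulr_gt0 => //; apply: mulr_gt0 => //; exact: mulr_gt0.
Qed.
Let EkB : 0 < E * k * B.
Proof. by apply: mulr_gt0 => //; exact: mulr_gt0. Qed.
Let FB_gt0 : 0 < FB. Proof. by apply: mulr_gt0 => //; exact: addr_gt0. Qed.
Let FL_gt0 : 0 < FL.
Proof.
apply: addr_gt0 => //; apply: mulr_gt0 => //; apply: addr_gt0; apply: mulr_gt0 => //.
  exact: mulr_gt0.
exact: addr_gt0.
Qed.
Let HL_gt0 : 0 < HL. Proof. exact: mulr_gt0. Qed.
Let KFB : 0 < K * FB. Proof. exact: mulr_gt0. Qed.
Let WL_gt0 : 0 < WL.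
Proof.
apply: mulr_gt0 => //; apply: addr_gt0; last by apply: mulr_gt0 => //; exact: mulr_gt0.
by apply: divr_gt0 => //; apply: addr_gt0; apply: mulr_gt0 => //; exact: mulr_gt0.
Qed.
Let WB_gt0 : 0 < WB.
Proof.
apply: mulr_gt0 => //; apply: addr_gt0; last by apply: mulr_gt0 => //; exact: mulr_gt0.
by apply: divr_gt0 => //; apply: mulr_gt0 => //; exact: mulr_gt0.
Qed.
Let Z_gt0 : 0 < Z.
Proof. by do 4 (apply: addr_gt0 => //). Qed.

Lemma ball_radius_gt0 : 0 < ball_radius. Proof. exact: r_gt0. Qed.

Lemma ball_radius_le1 : ball_radius <= 1. Proof. exact: r1. Qed.

Lemma delta_radius_gt0 : 0 < delta_radius.
Proof. by rewrite divr_gt0// mulr_gt0. Qed.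

Let delta_le delta Y : `|delta| <= delta_radius -> 0 <= Y -> Y <= Z -> `|delta| * Y <= r / 2.
Proof.
move=> dd Y0 YZ; apply: (@le_trans _ _ (delta_radius * Z)).
  by apply: ler_pM.
have -> : delta_radius * Z = r / 2 by rewrite /delta_radius; field; rewrite gt_eqF.
exact: lexx.
Qed.

Lemma adm_g2 : adm (fun x => g x * g x). Proof. exact: adm_mul. Qed.

Lemma adm_w0 : adm w0. Proof. exact: adm_G1 adm_g2. Qed.

Lemma wb_w0 : wb (K * (Kg * Kg)) w0.
Proof.
apply: G1_le; first exact: adm_g2.
move=> x; rewrite normrM -mulrA; apply: ler_pM => //.
exact: wb_le1 wb_g (ltW Kg0).
Qed.

Definition in_ball w h := [/\ adm w, adm h, wb r (fun x => w x - w0 x) & wb r h].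

Section ball.
Variables w h : R -> R.
Hypothesis wh : in_ball w h.

Let aw : adm w. Proof. by case: wh. Qed.
Let ah : adm h. Proof. by case: wh. Qed.
Let bw : wb r (fun x => w x - w0 x). Proof. by case: wh. Qed.
Let bh : wb r h. Proof. by case: wh. Qed.

Lemma adm_gh : adm (fun x => g x + h x). Proof. exact: adm_add. Qed.

Lemma adm_wgh : adm (fun x => w x * (g x + h x)). Proof. exact: adm_mul adm_gh. Qed.

Lemma ball_w : wb B w.
Proof.
move=> x; have := bw x; have := wb_w0 x; rewrite /B mulrDl mul1r => h1 h2.
have h3 : r * rho x <= rho x by rewrite ler_piMl.
have -> : w x = w0 x + (w x - w0 x) by ring.
apply: le_trans (ler_normD _ _) _; lra.
Qed.

Lemma ball_gh : wb A (fun x => g x + h x).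
Proof.
move=> x; have := bh x; have := wb_g x; rewrite /A mulrDl mul1r => h1 h2.
have h3 : r * rho x <= rho x by rewrite ler_piMl.
apply: le_trans (ler_normD _ _) _; lra.
Qed.

Let w_le x : `|w x| <= B. Proof. exact: wb_le1 ball_w (ltW B_gt0). Qed.
Let gh_le x : `|g x + h x| <= A. Proof. exact: wb_le1 ball_gh (ltW A_gt0). Qed.

Lemma num_close : `|bt (fun x => w x * (g x + h x)) - N0| <= `|N0| / 2.
Proof.
rewrite /N0 -btB; [|exact: adm_wgh|exact: adm_mul adm_w0 adm_g].
apply: le_trans rN; rewrite /NL -mulrA; apply: bt_le.
  by apply: adm_sub; [exact: adm_wgh|exact: adm_mul adm_w0 adm_g].
move=> x; have -> : (A + B) * r = A * r + B * r by ring.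
have -> : w x * (g x + h x) - w0 x * g x = (g x + h x) * w x - g x * w0 x by ring.
apply: mul_lip => //.
- have KB : 0 <= K * (Kg * Kg) by rewrite !mulr_ge0// ltW.
  by apply: le_trans (wb_le1 x wb_w0 KB) _; rewrite /B lerDl.
- by rewrite addrAC subrr add0r; exact: bh x.
Qed.

Lemma num_ge : `|N0| / 2 <= `|bt (fun x => w x * (g x + h x))|.
Proof.
have := num_close; have := lerB_dist N0 (N0 - bt (fun x => w x * (g x + h x))).
by rewrite subKr [`|N0 - _|]distrC; lra.
Qed.

Lemma den_le : `|bt (fun x => g x + h x)| <= Kt * A.
Proof. exact: bt_le adm_gh ball_gh. Qed.

Lemma den_ge : bt g / 2 <= bt (fun x => g x + h x).
Proof.
rewrite btD//; have := le_trans (bt_le ah bh) rD.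
by rewrite ler_norml => /andP[]; lra.
Qed.

Lemma coupling_le : `|coupling w h| <= E.
Proof.
rewrite /coupling normrM normfV normrN normrM (gtr0_norm k0).
have kN : 0 < k * (`|N0| / 2) by rewrite mulr_gt0// divr_gt0.
have kN2 : k * (`|N0| / 2) <= k * `|bt (fun x => w x * (g x + h x))|.
  by rewrite ler_wpM2l ?num_ge// ltW.
have -> : E = Kt * A / (k * (`|N0| / 2)) by rewrite /E; field; rewrite !gt_eqF.
apply: ler_pM; [by []|by rewrite invr_ge0 mulr_ge0// ltW|exact: den_le|].
by rewrite lef_pV2 ?posrE// (lt_le_trans kN).
Qed.

(** [bt (g + h)] is positive and the pairing in the denominator has the sign of [N0], so only the
    minus sign in [coupling] remains. *)
Lemma coupling_sign : coupling w h * N0 < 0.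
Proof.
set Nn := bt (fun x => w x * (g x + h x)).
have D1 : 0 < bt (fun x => g x + h x) by apply: lt_le_trans den_ge; rewrite divr_gt0.
have NN : 0 < Nn * N0.
  have := num_close; rewrite -/Nn; have [n0|n0|n0] := ltgtP N0 0.
  - by rewrite (ltr0_norm n0) ler_norml => /andP[h1 h2]; rewrite nmulr_lgt0//; lra.
  - by rewrite (gtr0_norm n0) ler_norml => /andP[h1 h2]; rewrite pmulr_lgt0//; lra.
  - by move: N0_neq0; rewrite n0 eqxx.
have Nn0 : Nn != 0 by apply: contraTneq NN => ->; rewrite mul0r ltxx.
have -> : coupling w h * N0 = - (bt (fun x => g x + h x) * (Nn * N0) / (k * Nn ^+ 2)).
  by rewrite /coupling -/Nn; field; rewrite Nn0 gt_eqF.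
rewrite oppr_lt0; apply: divr_gt0; apply: mulr_gt0 => //.
by rewrite lt_def sqrf_eq0 Nn0 sqr_ge0.
Qed.

Lemma adm_amp_source : adm (amp_source w h).
Proof.
have a1 := adm_add adm_gh (adm_scale (coupling w h * k) adm_wgh).
rewrite /amp_source.
have -> : (fun x => (1 + coupling w h * k * w x) * (g x + h x)) =
  (fun x => g x + h x + coupling w h * k * (w x * (g x + h x))).
  by apply/funext => x; ring.
exact: a1.
Qed.

Lemma amp_source_orth : bt (amp_source w h) = 0.
Proof.
have -> : amp_source w h = (fun x => g x + h x + coupling w h * k * (w x * (g x + h x))).
  by apply/funext => x; rewrite /amp_source; ring.
rewrite btD ?btZ; [|exact: adm_wgh|exact: adm_gh|exact/adm_scale/adm_wgh].
have n0 : bt (fun x => w x * (g x + h x)) != 0.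
  by rewrite -normr_gt0; apply: lt_le_trans num_ge; rewrite divr_gt0.
by rewrite /coupling; field; rewrite n0 gt_eqF.
Qed.

Lemma wb_amp_source : wb FB (amp_source w h).
Proof.
move=> x; rewrite /amp_source.
move: (coupling w h) coupling_le => cc hcc.
rewrite normrM /FB -[_ * A * _]mulrA; apply: ler_pM => //; last exact: ball_gh x.
apply: le_trans (ler_normD _ _) _; rewrite normr1 lerD2l !normrM (gtr0_norm k0).
apply: ler_pM => //; first by rewrite mulr_ge0// ltW.
by apply: ler_wpM2r; [exact: ltW|].
Qed.

Lemma adm_amp_step delta : adm (amp_step delta w h).
Proof. exact/adm_scale/(adm_G2 adm_amp_source amp_source_orth). Qed.

Lemma amp_step_le delta : wb (`|delta| * (K * FB)) (amp_step delta w h).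
Proof.
move=> x; rewrite /amp_step normrM -mulrA ler_wpM2l//.
exact: G2_le adm_amp_source amp_source_orth wb_amp_source x.
Qed.

Lemma amp_step_ball delta : `|delta| <= delta_radius -> wb r (amp_step delta w h).
Proof.
move=> dd x; apply: le_trans (amp_step_le delta x) _; rewrite ler_wpM2r//.
apply: le_trans (delta_le dd _ _) _.
- by rewrite mulr_ge0 ?ltW.
- by rewrite /Z; move: HL_gt0 WL_gt0 WB_gt0; lra.
- by move: r_gt0; lra.
Qed.

Lemma adm_pot_source delta h1 : adm h1 -> adm (pot_source delta w h h1).
Proof.
move=> ah1; apply: adm_add; first exact/adm_scale/adm_mul.
by apply: adm_mul; exact: adm_add.
Qed.

Lemma pot_step_ball delta : `|delta| <= delta_radius ->
  adm (pot_step delta w h) /\ wb r (fun x => pot_step delta w h x - w0 x).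
Proof.
move=> dd; have ah1 := adm_amp_step delta; have ap := adm_pot_source delta ah1.
split; first exact: adm_G1.
move=> x; rewrite /pot_step /w0 G1B//; last exact: adm_g2.
(* The deviation of the source from [g^2] carries a factor [delta]: explicitly in the term with
   [w^2], through [amp_step] in the other. *)
have step2 : wb (`|delta| * (E * B * B / 2 + 2 * A * (K * FB)))
    (fun y => pot_source delta w h (amp_step delta w h) y - g y * g y).
  move=> y; rewrite /pot_source.
  set h1 := amp_step delta w h.
  have h1r : `|h1 y| <= 1.
    by apply: le_trans r1; apply: wb_le1 (amp_step_ball dd) _; exact: ltW.
  have h1d := amp_step_le delta y; rewrite -/h1 in h1d.
  have -> : delta * coupling w h / 2 * (w y * w y) + (g y + h1 y) * (g y + h1 y) - g y * g y
     = delta * (coupling w h / 2 * (w y * w y)) + h1 y * (2 * g y + h1 y) by ring.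
  have gy : `|2 * g y + h1 y| <= 2 * A.
    have := wb_le1 y wb_g (ltW Kg0); rewrite /A => gy.
    apply: le_trans (ler_normD _ _) _; rewrite normrM normr_nat; lra.
  have e1 : `|coupling w h / 2 * (w y * w y)| <= E * B * B / 2 * rho y.
    have := coupling_le; have := ball_w y; have := w_le y.
    move: (coupling w h) => cc a1 a2 a3; rewrite !normrM normfV normr_nat.
    have -> : E * B * B / 2 * rho y = E / 2 * (B * (B * rho y)) by ring.
    by apply: ler_pM; rewrite ?mulr_ge0// ?ler_pM// ler_wpM2r.
  apply: le_trans (ler_normD _ _) _; rewrite normrM [`|h1 y * _|]normrM.
  have -> : `|delta| * (E * B * B / 2 + 2 * A * (K * FB)) * rho y =
    `|delta| * (E * B * B / 2 * rho y) + (`|delta| * (K * FB) * rho y) * (2 * A) by ring.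
  by apply: lerD; [rewrite ler_wpM2l|apply: ler_pM].
have := G1_le (adm_sub ap adm_g2) step2 x; move=> /le_trans; apply.
rewrite ler_wpM2r//.
have -> : K * (`|delta| * (E * B * B / 2 + 2 * A * (K * FB))) = `|delta| * WB by rewrite /WB; ring.
apply: le_trans (delta_le dd (ltW WB_gt0) _) _.
  by rewrite /Z; have : 0 < K * FB by [rewrite mulr_gt0]; move: HL_gt0 WL_gt0; lra.
by move: r_gt0; lra.
Qed.

End ball.

Lemma step_ball delta w h : `|delta| <= delta_radius -> in_ball w h ->
  in_ball (pot_step delta w h) (amp_step delta w h).
Proof.
move=> dd wh; have [a1 b1] := pot_step_ball wh dd.
by split=> //; [exact: adm_amp_step|exact: amp_step_ball].
Qed.

Section contraction.
Variables (w h w' h' : R -> R) (d : R).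
Hypotheses (wh : in_ball w h) (wh' : in_ball w' h').
Hypotheses (dw : wb d (fun x => w x - w' x)) (dh : wb d (fun x => h x - h' x)).

Let w_le x : `|w x| <= B. Proof. exact: wb_le1 (ball_w wh) (ltW B_gt0). Qed.
Let gh_le x : `|g x + h x| <= A. Proof. exact: wb_le1 (ball_gh wh) (ltW A_gt0). Qed.
Let w'_le x : `|w' x| <= B. Proof. exact: wb_le1 (ball_w wh') (ltW B_gt0). Qed.
Let gh'_le x : `|g x + h' x| <= A. Proof. exact: wb_le1 (ball_gh wh') (ltW A_gt0). Qed.

Let dgh x : `|g x + h x - (g x + h' x)| <= d * rho x.
Proof. by have -> : g x + h x - (g x + h' x) = h x - h' x by ring; exact: dh x. Qed.

Lemma wgh_lip : wb ((A + B) * d) (fun x => w x * (g x + h x) - w' x * (g x + h' x)).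
Proof.
move=> x; have -> : (A + B) * d = B * d + A * d by ring.
exact: mul_lip.
Qed.

(** A difference of quotients; the 4 in [EL] stems from two denominators of size at least
    [|N0| / 2]. *)
Lemma coupling_lip : `|coupling w h - coupling w' h'| <= EL * d.
Proof.
rewrite /coupling; set D := bt (fun x => g x + h x); set D' := bt (fun x => g x + h' x).
set N := bt _; set N' := bt (fun x => w' x * _).
have dN : `|N' - N| <= NL * d.
  rewrite distrC /NL -mulrA -btB; [|exact: adm_wgh wh|exact: adm_wgh wh'].
  apply: bt_le wgh_lip; exact: adm_sub (adm_wgh wh) (adm_wgh wh').
have dD : `|D - D'| <= Kt * d.
  rewrite -btB; [|exact: adm_gh wh|exact: adm_gh wh'].
  by apply: bt_le; [exact: adm_sub (adm_gh wh) (adm_gh wh')|exact: dgh].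
have D'_le : `|D| <= Kt * A := den_le wh.
have Nge : `|N0| / 2 <= `|N| := num_ge wh.
have N'ge : `|N0| / 2 <= `|N'| := num_ge wh'.
have N2 : 0 < `|N0| / 2 by rewrite divr_gt0.
have aN : 0 < `|N| := lt_le_trans N2 Nge.
have aN' : 0 < `|N'| := lt_le_trans N2 N'ge.
have n0 : N != 0 by rewrite -normr_gt0.
have n0' : N' != 0 by rewrite -normr_gt0.
have -> : - D / (k * N) - - D' / (k * N') =
   - ((D * (N' - N) / (N * N') + (D - D') / N') / k).
  by field; rewrite n0 n0' gt_eqF.
rewrite normrN normrM normfV (gtr0_norm k0) /EL [leRHS]mulrAC ler_pM2r ?invr_gt0//.
apply: le_trans (ler_normD _ _) _; rewrite [leRHS]mulrDl; apply: lerD.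
  rewrite !normrM normfV normrM.
  have -> : Kt * A * NL * 4 / N0 ^+ 2 * d = (Kt * A) * (NL * d) * ((`|N0| / 2) * (`|N0| / 2))^-1.
    have -> : N0 ^+ 2 = `|N0| ^+ 2 by rewrite real_normK ?num_real.
    by field; rewrite gt_eqF.
  apply: ler_pM; rewrite ?mulr_ge0 ?invr_ge0//.
    exact: ler_pM.
  rewrite lef_pV2 ?posrE ?mulr_gt0//; apply: ler_pM => //; exact: ltW.
rewrite normrM normfV.
have -> : Kt * 2 / `|N0| * d = Kt * d * (`|N0| / 2)^-1 by field; rewrite gt_eqF.
by apply: ler_pM => //; rewrite ?invr_ge0// lef_pV2 ?posrE.
Qed.

Lemma amp_source_lip : wb (FL * d) (fun x => amp_source w h x - amp_source w' h' x).
Proof.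
move=> x; rewrite /amp_source.
have -> : (1 + coupling w h * k * w x) * (g x + h x) - (1 + coupling w' h' * k * w' x) * (g x + h' x) =
  (h x - h' x) + k * ((w x * (g x + h x)) * (coupling w h - coupling w' h') +
     coupling w' h' * (w x * (g x + h x) - w' x * (g x + h' x))) by ring.
apply: le_trans (ler_normD _ _) _; rewrite normrM (gtr0_norm k0).
have -> : FL * d * rho x = d * rho x + k * ((A * B * rho x) * (EL * d) + E * ((A + B) * d * rho x)).
  by rewrite /FL; ring.
apply: lerD; first exact: dh x.
apply: ler_wpM2l; first exact: ltW.
have := coupling_le wh'; have := coupling_lip.
move: (coupling w h) (coupling w' h') => cc cc' h1 h2.
apply: le_trans (ler_normD _ _) _.
rewrite [`|cc' * _|]normrM [`|_ * (cc - cc')|]normrM.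
apply: lerD; last first.
  by apply: ler_pM => //; exact: wgh_lip x.
apply: ler_pM => //.
rewrite normrM mulrC -mulrA; apply: ler_pM => //; exact: ball_w wh x.
Qed.

(** Both sources are orthogonal to [g], hence so is their difference, and the bound on [G2] applies
    to it. *)
Lemma amp_step_lip delta :
  wb (`|delta| * (HL * d)) (fun x => amp_step delta w h x - amp_step delta w' h' x).
Proof.
move=> x; rewrite /amp_step -mulrBr normrM -mulrA ler_wpM2l//.
rewrite G2B; [|exact: adm_amp_source wh|exact: adm_amp_source wh'].
rewrite /HL -[K * FL * d]mulrA.
have as1 := adm_amp_source wh; have as2 := adm_amp_source wh'.
apply: G2_le amp_source_lip x; first exact: adm_sub.
by rewrite btB// (amp_source_orth wh) (amp_source_orth wh') subrr.
Qed.

Lemma pot_step_lip delta : `|delta| <= delta_radius ->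
  wb (`|delta| * (WL * d)) (fun x => pot_step delta w h x - pot_step delta w' h' x).
Proof.
move=> dd x; rewrite /pot_step.
have ap := adm_pot_source wh delta (adm_amp_step wh delta).
have ap' := adm_pot_source wh' delta (adm_amp_step wh' delta).
rewrite G1B//.
have -> : `|delta| * (WL * d) * rho x =
  K * (`|delta| * (((EL * B * B + 2 * E * B) / 2 + 2 * A * HL) * d)) * rho x by rewrite /WL; ring.
apply: G1_le x; first exact: adm_sub.
move=> y; rewrite /pot_source.
set a := amp_step delta w h; set a' := amp_step delta w' h'.
have ay : `|a y| <= 1 by apply: le_trans r1; apply: wb_le1 (amp_step_ball wh dd) _; exact: ltW.
have ay' : `|a' y| <= 1 by apply: le_trans r1; apply: wb_le1 (amp_step_ball wh' dd) _; exact: ltW.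
have gy := wb_le1 y wb_g (ltW Kg0).
have da := amp_step_lip delta y; rewrite /= -/a -/a' in da.
have -> : delta * coupling w h / 2 * (w y * w y) + (g y + a y) * (g y + a y) -
   (delta * coupling w' h' / 2 * (w' y * w' y) + (g y + a' y) * (g y + a' y)) =
  delta * ((w y * w y * (coupling w h - coupling w' h') +
            coupling w' h' * (w y * w y - w' y * w' y)) / 2) +
  (a y - a' y) * (2 * g y + a y + a' y) by ring.
have s : `|2 * g y + a y + a' y| <= 2 * A.
  apply: le_trans (ler_normD _ _) _; apply: le_trans (lerD (ler_normD _ _) (lexx _)) _.
  by rewrite normrM normr_nat /A; lra.
have ww := mul_lip (rho0 y) (w_le y) (w'_le y) (dw y) (dw y).
apply: le_trans (ler_normD _ _) _.
have -> : `|delta| * (((EL * B * B + 2 * E * B) / 2 + 2 * A * HL) * d) * rho y =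
  `|delta| * ((B * (B * rho y) * (EL * d) + E * ((B * d + B * d) * rho y)) / 2) +
  (`|delta| * (HL * d) * rho y) * (2 * A) by field.
apply: lerD; last by rewrite normrM; apply: ler_pM.
rewrite normrM ler_wpM2l// normrM normfV normr_nat ler_wpM2r//.
have := coupling_le wh'; have := coupling_lip.
move: (coupling w h) (coupling w' h') => cc cc' h1 h2.
apply: le_trans (ler_normD _ _) _.
rewrite [`|cc' * _|]normrM [`|_ * (cc - cc')|]normrM; apply: lerD.
  apply: ler_pM => //.
  by rewrite normrM; apply: ler_pM => //; exact: ball_w wh y.
by apply: ler_pM.
Qed.

Lemma step_contraction delta : `|delta| <= delta_radius -> 0 <= d ->
  wb (d / 2) (fun x => pot_step delta w h x - pot_step delta w' h' x) /\
  wb (d / 2) (fun x => amp_step delta w h x - amp_step delta w' h' x).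
Proof.
move=> dd d0.
have r2 : r / 2 <= 1 / 2 by rewrite ler_wpM2r.
split=> x.
  apply: le_trans (pot_step_lip dd x) _; rewrite ler_wpM2r// mulrA.
  have h1 : `|delta| * WL <= 1 / 2.
    apply: le_trans r2; apply: delta_le => //; first exact: ltW.
    by rewrite /Z; move: HL_gt0 WB_gt0 KFB; lra.
  by have := ler_wpM2r d0 h1; rewrite mul1r [2^-1 * d]mulrC.
apply: le_trans (amp_step_lip delta x) _; rewrite ler_wpM2r// mulrA.
have h1 : `|delta| * HL <= 1 / 2.
  apply: le_trans r2; apply: delta_le => //; first exact: ltW.
  by rewrite /Z; move: WL_gt0 WB_gt0 KFB; lra.
by have := ler_wpM2r d0 h1; rewrite mul1r [2^-1 * d]mulrC.
Qed.

End contraction.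

Lemma even_limit (fn : nat -> R -> R) f C : 0 <= C ->
  (forall n x, fn n (- x) = fn n x) -> (forall n, wb (C / 2 ^+ n) (fun x => f x - fn n x)) ->
  forall x, f (- x) = f x.
Proof.
move=> C0 en Hf x; apply/eqP; rewrite -subr_eq0 -normr_le0.
apply: (@le0_half_pow _ (2 * C)) => n.
have Cn : 0 <= C / 2 ^+ n by rewrite divr_ge0// exprn_ge0.
have h1 := wb_le1 x (Hf n) Cn; have h2 := wb_le1 (- x) (Hf n) Cn.
have -> : f (- x) - f x = (f (- x) - fn n (- x)) - (f x - fn n x) by rewrite en; ring.
apply: le_trans (ler_normB _ _) _; rewrite -mulrA; lra.
Qed.

Lemma wb_limit (fn : nat -> R -> R) f f0 M C :
  (forall n, wb M (fun x => fn n x - f0 x)) ->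
  (forall n, wb (C / 2 ^+ n) (fun x => f x - fn n x)) -> wb M (fun x => f x - f0 x).
Proof.
move=> Mn Hf x; rewrite -subr_le0; apply: (@le0_half_pow _ (C * rho x)) => n.
have h1 := Mn n x; have h2 := Hf n x.
have -> : f x - f0 x = (f x - fn n x) + (fn n x - f0 x) by ring.
rewrite mulrAC lerBlDr; apply: le_trans (ler_normD _ _) _; exact: lerD.
Qed.

(** The closedness demanded by [picard_fixpoint]: geometric uniform convergence preserves
    continuity, parity and weighted bounds. *)
Lemma in_ball_limit (wn hn : nat -> R -> R) w h C : 0 <= C ->
  (forall n, in_ball (wn n) (hn n)) ->
  (forall n, wb (C / 2 ^+ n) (fun x => w x - wn n x)) ->
  (forall n, wb (C / 2 ^+ n) (fun x => h x - hn n x)) -> in_ball w h.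
Proof.
move=> C0 Hn Hw Hh.
have Cn n : 0 <= C / 2 ^+ n by rewrite divr_ge0// exprn_ge0.
have bw : wb r (fun x => w x - w0 x).
  by apply: wb_limit Hw => n; case: (Hn n).
have bh : wb r h.
  move=> x; rewrite -[h x]subr0; apply: (@wb_limit hn h (fun=> 0) r C) => // n y.
  by rewrite subr0; case: (Hn n) => _ _ _; exact.
split=> //; split.
- apply: (@continuous_unif_limit _ _ C wn) => [n|n x]; first by case: (Hn n) => -[].
  exact: wb_le1 (Hw n) (Cn n).
- by apply: (even_limit C0) Hw => n; case: (Hn n) => -[].
- exists (K * (Kg * Kg) + r) => x; rewrite mulrDl -[w x](subrK (w0 x)) addrC.
  by apply: le_trans (ler_normD _ _) _; apply: lerD; [exact: wb_w0|exact: bw].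
- apply: (@continuous_unif_limit _ _ C hn) => [n|n x]; first by case: (Hn n) => _ [].
  exact: wb_le1 (Hh n) (Cn n).
- by apply: (even_limit C0) Hh => n; case: (Hn n) => _ [].
- by exists r.
Qed.

Lemma in_ball0 : in_ball w0 (fun=> 0).
Proof.
split; [exact: adm_w0| |by move=> x; rewrite subrr normr0 mulr_ge0// ltW|].
  split; [exact: cont_cst|by []|exists 0 => x; by rewrite normr0 mul0r].
by move=> x; rewrite normr0 mulr_ge0// ltW.
Qed.

Lemma reduced_exists delta : `|delta| <= delta_radius -> exists w h,
  [/\ in_ball w h, w = pot_step delta w h & h = amp_step delta w h].
Proof.
move=> dd.
(* The pair is coded as one function on [bool * R], with [true] for [w] and [false] for [h]. *)
pose W (p : bool * R -> R) x := p (true, x).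
pose H (p : bool * R -> R) x := p (false, x).
pose T (p : bool * R -> R) (i : bool * R) :=
  if i.1 then pot_step delta (W p) (H p) i.2 else amp_step delta (W p) (H p) i.2.
pose p0 (i : bool * R) := if i.1 then w0 i.2 else 0.
pose S p := in_ball (W p) (H p).
have Sp0 : S p0 by exact: in_ball0.
have ST p : S p -> S (T p) by move=> Sp; exact: step_ball dd Sp.
have [|||||p Sp Tp] := @picard_fixpoint _ _ (fun i => rho i.2) S T p0 r _ _ Sp0 ST.
- by move=> i; exact: rho0.
- exact: ltW.
- move=> [[] x]; rewrite /T /p0/=.
    by case: (step_ball dd Sp0) => _ _ h _; exact: h.
  by rewrite subr0; case: (step_ball dd Sp0) => _ _ _ h; exact: h.
- move=> p q d d0 Sp Sq pq.
  have dw : wb d (fun x => W p x - W q x) by move=> x; exact: (pq (true, x)).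
  have dh : wb d (fun x => H p x - H q x) by move=> x; exact: (pq (false, x)).
  have [c1 c2] := step_contraction Sp Sq dw dh dd d0.
  by move=> [[] x]; [exact: c1|exact: c2].
- move=> pn p Spn pnp.
  apply: (@in_ball_limit (fun n => W (pn n)) (fun n => H (pn n)) _ _ (2 * r)) => //.
  + by rewrite mulr_ge0// ltW.
  + by move=> n x; exact: (pnp n (true, x)).
  + by move=> n x; exact: (pnp n (false, x)).
exists (W p), (H p); split => //.
- by apply/funext => x; rewrite -[LHS]/(p (true, x)) -{1}Tp.
- by apply/funext => x; rewrite -[LHS]/(p (false, x)) -{1}Tp.
Qed.

(** Two fixed points in the ball are at weighted distance at most [2 r], and each application of the
    map halves that bound. *)
Lemma reduced_uniq delta w h w' h' : `|delta| <= delta_radius ->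
  in_ball w h -> in_ball w' h' ->
  w = pot_step delta w h -> h = amp_step delta w h ->
  w' = pot_step delta w' h' -> h' = amp_step delta w' h' ->
  w = w' /\ h = h'.
Proof.
move=> dd b b' ew eh ew' eh'.
have C n : wb (2 * r / 2 ^+ n) (fun x => w x - w' x) /\ wb (2 * r / 2 ^+ n) (fun x => h x - h' x).
  elim: n => [|n [IH1 IH2]].
    rewrite expr0 divr1; case: b => _ _ bw bh; case: b' => _ _ bw' bh'; split=> x.
      have -> : w x - w' x = (w x - w0 x) - (w' x - w0 x) by ring.
      apply: le_trans (ler_normB _ _) _; have := bw x; have := bw' x; lra.
    apply: le_trans (ler_normB _ _) _; have := bh x; have := bh' x; lra.
  have d0 : 0 <= 2 * r / 2 ^+ n by rewrite divr_ge0 ?exprn_ge0// mulr_ge0// ltW.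
  have := step_contraction b b' IH1 IH2 dd d0.
  by rewrite -ew -ew' -eh -eh' exprSr invfM mulrA.
split; apply/funext => x; apply/eqP; rewrite -subr_eq0 -normr_le0;
  apply: (@le0_half_pow _ (2 * r * rho x)) => n; rewrite mulrAC.
- by case: (C n) => h1 _; exact: h1.
- by case: (C n) => _ h1; exact: h1.
Qed.

End reduced_equation.

(** * Parity, exponential decay and integrals over the line *)

Section even_functions.
Context {R : realType}.
Local Notation mu := (@lebesgue_measure R).
Implicit Types (f u v : R -> R) (x M eta : R).

Lemma ae_opp (P : R -> Prop) : {ae mu, forall x, P x} -> {ae mu, forall x, P (- x)}.
Proof.
move=> [N [mN N0 PN]]; exists ((-%R : R -> R) @^-1` N); split.
- rewrite -[X in measurable X]setTI.
  have mo : measurable_fun [set: measurableTypeR R] (-%R : R -> R) by exact: oppr_measurable.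
  exact: mo.
- by have := lebesgue_measureN mN; rewrite N0.
- by move=> x /= nP; apply: PN.
Qed.

Lemma even_representative u f : continuous f -> u = f %[ae mu] ->
  {ae mu, forall x, u (- x) = u x} -> forall x, f (- x) = f x.
Proof.
move=> cf uf eu x; apply: (@ae_continuous_eq _ (fun y => f (- y)) f) => //.
  by move=> y; apply: continuous_comp; [exact: opp_continuous|exact: cf].
have uf' := ae_opp uf.
have h : {ae mu, forall y, u (- y) = f y} by apply: aeI2 eu uf => y -> ; exact.
by apply: aeI2 h uf' => y <- h _; rewrite h.
Qed.

Lemma deriv_even f f' : has_deriv f f' -> (forall x, f (- x) = f x) ->
  forall x, f' (- x) = - f' x.
Proof.
move=> df ef x; have [_ e1] := has_deriv_opp df x.
have [_ e2] := df x.
have E : (fun y => f (- y)) = f by apply/funext => y; exact: ef.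
by move: e1; rewrite E e2 => ->; rewrite opprK.
Qed.

(** Parity is asked of [u^2], which covers the odd first derivatives too. The bound is twice the
    half-line integral of [M^2 exp (- 2 eta x)]. *)
Lemma exp_decay_L2 u M eta : continuous u -> 0 < eta ->
  (forall x, u (- x) ^+ 2 = u x ^+ 2) -> (forall x, 0 <= x -> `|u x| <= M * expR (- eta * x)) ->
  L2 u /\ L2inner u u <= M ^+ 2 / eta.
Proof.
move=> cu eta0 eu hu; apply: continuous_L2 => // n.
have cu2 := contX (n := 2) cu.
rewrite prim_even// opprK -mulr2n.
have dG := has_deriv_exp_lin (- (M ^+ 2 / (2 * eta))) (- (2 * eta)).
have n0 : (0 : R) <= n%:R by [].
have := has_deriv_dominated (has_deriv_prim cu2) dG n0.
rewrite prim0 subr0 mulr0 expR0 mulr1 opprK => H.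
have {}H : `|prim (fun x => u x ^+ 2) n%:R| <=
   - (M ^+ 2 / (2 * eta)) * expR (- (2 * eta) * n%:R) + M ^+ 2 / (2 * eta).
  apply: H => y y0 _; rewrite ger0_norm ?sqr_ge0//.
  have -> : - (M ^+ 2 / (2 * eta)) * - (2 * eta) * expR (- (2 * eta) * y) =
     (M * expR (- eta * y)) ^+ 2.
    have -> : - (2 * eta) * y = 2%:R * (- eta * y) by ring.
    by rewrite expRM_natl exprMn; field; rewrite gt_eqF.
  by rewrite -[u y ^+ 2]real_normK ?num_real// lerXn2r ?nnegrE//; [exact: le_trans (hu y y0)|exact: hu].
have M20 : 0 <= M ^+ 2 / (2 * eta) by rewrite divr_ge0 ?sqr_ge0// mulr_ge0// ltW.
have := ler_norm (prim (fun x => u x ^+ 2) n%:R).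
have : 0 <= M ^+ 2 / (2 * eta) * expR (- (2 * eta) * n%:R) by rewrite mulr_ge0// expR_ge0.
have -> : M ^+ 2 / eta = M ^+ 2 / (2 * eta) *+ 2 by rewrite -mulr_natr; field; rewrite gt_eqF.
rewrite ler_pMn2r//; move: H; rewrite mulNr; lra.
Qed.

(** Connects the Lebesgue integral of the theorem with [tint]: both sides are limits of integrals
    over [[- n, n]]. *)
Lemma Rintegral_even u : continuous u -> mu.-integrable setT (EFin \o u) ->
  (forall x, u (- x) = u x) -> tint_cvg u -> \int[mu]_x u x = 2 * tint u.
Proof.
move=> cu iu eu tu.
pose In n : set R := [set` `[- n%:R, n%:R]].
pose un n : R -> \bar R := (EFin \o u) \_ (In n).
have [|||||] := @dominated_convergence _ _ _ mu setT measurableT un (EFin \o u) (fun x => `|(u x)%:E|%E).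
- move=> n; apply/(measurable_restrictT _ _).1; first exact: measurable_itv.
  by apply/measurable_EFinP; apply: measurable_funTS; exact: continuous_measurable_fun.
- by apply/measurable_EFinP; exact: continuous_measurable_fun.
- by apply: aeW => x _; exact: restrict_itv_cvg.
- exact: integrable_abse iu.
- by apply: aeW => x n _; rewrite /un patchE; case: ifPn => // _; rewrite abse0 abse_ge0.
move=> _ _ /= H.
have E n : (\int[mu]_x un n x)%E = (2 * prim u n%:R)%:E.
  rewrite /un -integral_mkcond.
  have nn : - n%:R <= n%:R :> R by have n0 : (0 : R) <= n%:R by []; lra.
  have -> : 2 * prim u n%:R = \int[mu]_(t in In n) u t.
    rewrite /In -primB// prim_even//; ring.
  rewrite /Rintegral fineK//; exact: integrable_fin_num (continuous_integrable_itv _ _ cu).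
have fi : (\int[mu]_x (u x)%:E)%E \is a fin_num by exact: integrable_fin_num iu.
have {}H : (2 * prim u n%:R)%:E @[n --> \oo] --> (fine (\int[mu]_x (u x)%:E)%E)%:E.
  by rewrite fineK//; under eq_fun do rewrite -E.
have {}H : 2 * prim u n%:R @[n --> \oo] --> \int[mu]_x u x by exact: fine_cvg H.
have H2 : 2 * prim u n%:R @[n --> \oo] --> 2 * tint u.
  apply: cvgM; first exact: cvg_cst.
  apply: (@cvg_comp _ _ _ (fun n : nat => n%:R) (prim u)); last exact: tu.
  exact: cvgr_idn.
by rewrite -(cvg_lim _ H)// -(cvg_lim _ H2).
Qed.

End even_functions.

(** * The explicit Green operators satisfy the abstract bounds *)

Section model.
Context {R : realType}.
Variables a p k : R.
Hypotheses (a0 : 0 < a) (p0 : 0 < p) (k0 : 0 < k).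
Implicit Types (f w h F b v : R -> R) (x M delta eta : R).

Definition rho eta x := expR (- eta * `|x|).
Definition G1 := green (dec1 a) (gro1 a) (8 * a).
Definition G1' := green1 (dec1 a) (dec1' a) (gro1 a) (gro1' a) (8 * a).
Definition G2 := green (dec2 a p) (gro2 a p) 1.
Definition G2' := green1 (dec2 a p) (dec2' a p) (gro2 a p) (gro2' a p) 1.
Definition bt F := tint (fun x => dec2 a p x * F x).

(** [K1c] and [K2c] are the constants of [green_le] for the two operators, free of [eta]; [Kc]
    serves both and is positive by its summand 1. *)
Definition K1c := 3 * bnd1 a ^+ 2 / (2 * a * `|8 * a|).
Definition K2c := 3 * bnd2 a p ^+ 2 / (p * a * `|1 : R|).
Definition Kc := K1c + K2c + 1.
Definition Ktc := bnd2 a p / (p * a).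
Definition Kgc := bnd2 a p.

Let ta0 : 0 < 2 * a. Proof. exact: mulr_gt0. Qed.
Let pa0 : 0 < p * a. Proof. exact: mulr_gt0. Qed.
Let W1 : 8 * a != 0. Proof. by rewrite gt_eqF// mulr_gt0. Qed.
Let W2 : (1 : R) != 0. Proof. exact: oner_neq0. Qed.
Let d1 := has_deriv_dec1 a.
Let e1 := has_deriv_gro1 a.
Let d2 := has_deriv_dec2 a p.
Let e2 := has_deriv_gro2 a p.
Let l2 x : 0 <= x -> `|dec2 a p x| <= bnd2 a p * expR (- (p * a) * x).
Proof. by move=> _; exact: dec2_norm_le. Qed.
Let l2' x : 0 <= x -> `|dec2' a p x| <= bnd2 a p * expR (- (p * a) * x).
Proof. by move=> _; exact: dec2'_le. Qed.

Lemma bnd2_gt0 : 0 < bnd2 a p.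
Proof.
have := dec2_norm_le a0 p0 0; rewrite mulr0 expR0 mulr1; apply: lt_le_trans.
by rewrite normr_gt0 gt_eqF// dec2_gt0.
Qed.

Lemma K1c_ge0 : 0 <= K1c.
Proof. by rewrite divr_ge0// mulr_ge0 ?sqr_ge0// ltW. Qed.

Lemma K2c_ge0 : 0 <= K2c.
Proof. by rewrite divr_ge0// mulr_ge0 ?sqr_ge0// ltW. Qed.

Lemma Kc_gt0 : 0 < Kc.
Proof. by have := K1c_ge0; have := K2c_ge0; rewrite /Kc; lra. Qed.

Lemma Ktc_gt0 : 0 < Ktc. Proof. by rewrite divr_gt0 ?bnd2_gt0. Qed.

(** Half the smaller of the decay rates of [dec1] and [dec2], as [green_le] requires for both
    operators. *)
Definition eta_max := Num.min (2 * a) (p * a) / 2.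

Lemma eta_max_gt0 : 0 < eta_max.
Proof. by rewrite divr_gt0// lt_min ta0 pa0. Qed.

Section weight.
Variable eta : R.
Hypotheses (eta0 : 0 <= eta) (eta_le : eta <= eta_max).

Let eta1 : eta <= 2 * a / 2.
Proof. by apply: le_trans eta_le _; rewrite ler_wpM2r// ge_min lexx. Qed.
Let eta2 : eta <= p * a / 2.
Proof. by apply: le_trans eta_le _; rewrite ler_wpM2r// ge_min lexx orbT. Qed.

Lemma rho_ge0 x : 0 <= rho eta x. Proof. exact: expR_ge0. Qed.

Lemma rho_le1 x : rho eta x <= 1.
Proof. by rewrite /rho expR_le1 mulNr oppr_le0 mulr_ge0. Qed.

Lemma wb_pos M f : wb (rho eta) M f -> forall x, 0 <= x -> `|f x| <= M * expR (- eta * x).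
Proof. by move=> h x x0; have := h x; rewrite /rho (ger0_norm x0). Qed.

Lemma pos_wb M f : (forall x, `|f (- x)| = `|f x|) ->
  (forall x, 0 <= x -> `|f x| <= M * expR (- eta * x)) -> wb (rho eta) M f.
Proof.
move=> ef h x; rewrite /rho; have [x0|/ltW x0] := leP 0 x.
  by rewrite (ger0_norm x0); exact: h.
by rewrite (ler0_norm x0) -ef; apply: h; rewrite oppr_ge0.
Qed.

Lemma wb_M_ge0 M f : wb (rho eta) M f -> 0 <= M.
Proof.
move=> h; have := h 0; rewrite /rho normr0 mulr0 expR0 mulr1; exact: le_trans.
Qed.

Lemma wb_bounded M f : wb (rho eta) M f -> forall x, `|f x| <= M.
Proof.
by move=> h x; apply: le_trans (h x) _; rewrite ler_piMr ?(wb_M_ge0 h)// rho_le1.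
Qed.

Lemma adm_cont f : adm (rho eta) f -> continuous f. Proof. by case. Qed.
Lemma adm_even f : adm (rho eta) f -> forall x, f (- x) = f x. Proof. by case. Qed.
Lemma adm_bounded f : adm (rho eta) f -> exists M, forall x, 0 <= x -> `|f x| <= M.
Proof. by move=> [_ _ [M h]]; exists M => x _; exact: wb_bounded h x. Qed.

Lemma adm_dec2 : adm (rho eta) (dec2 a p).
Proof.
split; [exact: has_deriv_cont d2|exact: dec2N|].
exists (bnd2 a p); apply: pos_wb => [x|x x0]; first by rewrite dec2N.
apply: le_trans (dec2_norm_le a0 p0 x) _.
apply: ler_wpM2l; first exact/ltW/bnd2_gt0.
rewrite ler_expR ler_wpM2r// lerN2.
by move: eta2 pa0; lra.
Qed.

Lemma wb_dec2 : wb (rho eta) Kgc (dec2 a p).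
Proof.
apply: pos_wb => [x|x x0]; first by rewrite dec2N.
apply: le_trans (dec2_norm_le a0 p0 x) _.
apply: ler_wpM2l; first exact/ltW/bnd2_gt0.
rewrite ler_expR ler_wpM2r// lerN2.
by move: eta2 pa0; lra.
Qed.

Lemma G1_even F : adm (rho eta) F -> forall x, G1 F (- x) = G1 F x.
Proof.
move=> aF x; apply: (green_even_odd _ d1 e1); [exact: adm_cont|exact: adm_even| |].
  exact: dec1N.
exact: gro1N.
Qed.

Lemma G2_even F : adm (rho eta) F -> bt F = 0 -> forall x, G2 F (- x) = G2 F x.
Proof.
move=> aF b0 x; apply: (green_even_even _ d2 e2); [exact: adm_cont|exact: adm_even|exact: dec2N|
  exact: gro2N|exact: b0].
Qed.

Let widenK Q M x : 0 <= Q -> Q <= Kc -> 0 <= M ->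
  Q * M * expR (- eta * x) <= Kc * M * expR (- eta * x).
Proof. by move=> Q0 QK M0; rewrite ler_wpM2r ?expR_ge0// ler_wpM2r. Qed.

Let K1K : K1c <= Kc. Proof. by have := K2c_ge0; rewrite /Kc; lra. Qed.
Let K2K : K2c <= Kc. Proof. by have := K1c_ge0; rewrite /Kc; lra. Qed.

Lemma G1_pos F M : adm (rho eta) F -> wb (rho eta) M F -> forall x, 0 <= x ->
  `|G1 F x| <= Kc * M * expR (- eta * x) /\ `|G1' F x| <= Kc * M * expR (- eta * x).
Proof.
move=> aF bF x x0; have M0 := wb_M_ge0 bF; have cF := adm_cont aF.
split.
- apply: le_trans (green_le ta0 W1 d1 e1 (dec1_le a0) (gro1_le a0) cF eta0 eta1 (wb_pos bF) x0) _.
  exact: widenK K1c_ge0 K1K M0.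
- apply: le_trans (green1_le ta0 W1 d1 e1 (dec1_le a0) (dec1'_le a0) (gro1_le a0) (gro1'_le a0) cF eta0 eta1 (wb_pos bF) x0) _.
  exact: widenK K1c_ge0 K1K M0.
Qed.

Lemma G2_pos F M : adm (rho eta) F -> wb (rho eta) M F -> forall x, 0 <= x ->
  `|G2 F x| <= Kc * M * expR (- eta * x) /\ `|G2' F x| <= Kc * M * expR (- eta * x).
Proof.
move=> aF bF x x0; have M0 := wb_M_ge0 bF; have cF := adm_cont aF.
split.
- apply: le_trans (green_le pa0 W2 d2 e2 l2 (gro2_le a0 p0) cF eta0 eta2 (wb_pos bF) x0) _.
  exact: widenK K2c_ge0 K2K M0.
- apply: le_trans (green1_le pa0 W2 d2 e2 l2 l2' (gro2_le a0 p0) (gro2'_le a0 p0) cF eta0 eta2 (wb_pos bF) x0) _.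
  exact: widenK K2c_ge0 K2K M0.
Qed.

Lemma G1_wb F M : adm (rho eta) F -> wb (rho eta) M F -> wb (rho eta) (Kc * M) (G1 F).
Proof.
move=> aF bF; apply: pos_wb => [x|x x0]; first by rewrite G1_even.
by case: (G1_pos aF bF x0).
Qed.

Lemma G2_wb F M : adm (rho eta) F -> bt F = 0 -> wb (rho eta) M F -> wb (rho eta) (Kc * M) (G2 F).
Proof.
move=> aF b0 bF; apply: pos_wb => [x|x x0]; first by rewrite G2_even.
by case: (G2_pos aF bF x0).
Qed.

Lemma adm_G1 F : adm (rho eta) F -> adm (rho eta) (G1 F).
Proof.
move=> aF; split; [exact: has_deriv_cont (has_deriv_green _ d1 e1 (adm_cont aF))|exact: G1_even|].
by case: (aF) => _ _ [M bF]; exists (Kc * M); exact: G1_wb.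
Qed.

Lemma adm_G2 F : adm (rho eta) F -> bt F = 0 -> adm (rho eta) (G2 F).
Proof.
move=> aF b0; split; [exact: has_deriv_cont (has_deriv_green _ d2 e2 (adm_cont aF))|exact: G2_even|].
by case: (aF) => _ _ [M bF]; exists (Kc * M); exact: G2_wb.
Qed.

Lemma G1B F F' : adm (rho eta) F -> adm (rho eta) F' -> forall x,
  G1 F x - G1 F' x = G1 (fun x => F x - F' x) x.
Proof.
move=> aF aF' x; have [M bF] := adm_bounded aF; have [M' bF'] := adm_bounded aF'.
by rewrite -(greenB _ ta0 d1 e1 (dec1_le a0) x (adm_cont aF) (adm_cont aF') bF bF').
Qed.

Lemma G2B F F' : adm (rho eta) F -> adm (rho eta) F' -> forall x,
  G2 F x - G2 F' x = G2 (fun x => F x - F' x) x.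
Proof.
move=> aF aF' x; have [M bF] := adm_bounded aF; have [M' bF'] := adm_bounded aF'.
by rewrite -(greenB _ pa0 d2 e2 l2 x (adm_cont aF) (adm_cont aF') bF bF').
Qed.

Lemma bt_cvg F : adm (rho eta) F -> tint_cvg (fun x => dec2 a p x * F x).
Proof.
move=> aF; have [M bF] := adm_bounded aF.
exact: (@pd_tint_cvg _ _ _ _ _ pa0 d2 l2 _ _ (adm_cont aF) bF).
Qed.

Let cgF F : adm (rho eta) F -> continuous (fun x => dec2 a p x * F x).
Proof. by move=> aF; apply: contM; [exact: has_deriv_cont d2|exact: adm_cont]. Qed.

Lemma btB F F' : adm (rho eta) F -> adm (rho eta) F' ->
  bt (fun x => F x - F' x) = bt F - bt F'.
Proof.
move=> aF aF'; rewrite /bt -tintB; [|exact: cgF|exact: cgF|exact: bt_cvg|exact: bt_cvg].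
by congr tint; apply/funext => x; rewrite mulrBr.
Qed.

Lemma btD F F' : adm (rho eta) F -> adm (rho eta) F' ->
  bt (fun x => F x + F' x) = bt F + bt F'.
Proof.
move=> aF aF'; rewrite /bt -tintD; [|exact: cgF|exact: cgF|exact: bt_cvg|exact: bt_cvg].
by congr tint; apply/funext => x; rewrite mulrDr.
Qed.

Lemma btZ q F : adm (rho eta) F -> bt (fun x => q * F x) = q * bt F.
Proof.
move=> aF; rewrite /bt -tintZ; [|exact: cgF|exact: bt_cvg].
by congr tint; apply/funext => x; rewrite mulrCA.
Qed.

Lemma bt_le F M : adm (rho eta) F -> wb (rho eta) M F -> `|bt F| <= Ktc * M.
Proof.
move=> aF bF; have M0 := wb_M_ge0 bF.
have -> : Ktc * M = bnd2 a p * M / (p * a) by rewrite /Ktc mulrAC.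
apply: (tint_le (cgF aF) pa0) => x x0.
have h y : 0 <= y -> `|F y| <= M * expR (- 0 * y).
  by move=> _; rewrite oppr0 mul0r expR0 mulr1; exact: wb_bounded.
by have := pd_mul_le l2 h x0; rewrite addr0.
Qed.

End weight.

Lemma bt_dec2_gt0 : 0 < bt (dec2 a p).
Proof.
have ad : adm (rho 0) (dec2 a p) by apply: adm_dec2; exact: ltW eta_max_gt0.
have cv : tint_cvg (fun x => dec2 a p x * dec2 a p x) by apply: (bt_cvg _ ad).
have cg : continuous (fun x => dec2 a p x * dec2 a p x) by apply: contM; exact: has_deriv_cont d2.
have dp := has_deriv_prim cg.
have g0 x : 0 < dec2 a p x * dec2 a p x by rewrite mulr_gt0 ?dec2_gt0.
have p1 : 0 < prim (fun x => dec2 a p x * dec2 a p x) 1.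
  have [|c _] := @MVT R _ _ 0 1 ltr01 (fun z _ => dp z).
    exact/continuous_subspaceT/(has_deriv_cont dp).
  by rewrite prim0 !subr0 mulr1 => ->.
apply: lt_le_trans p1 _; apply: limr_ge; first by apply/cvg_ex; exists (bt (dec2 a p)).
near=> x; apply: (has_deriv_ge0_le dp) => [|y _ _]; last exact/ltW.
near: x; apply: nbhs_pinfty_ge; exact: num_real.
Unshelve. all: by end_near. Qed.

End model.

(** * The branch of fixed points and its differential equations *)

Section branch.
Context {R : realType}.
Variables a p k : R.
Hypotheses (a0 : 0 < a) (p0 : 0 < p) (k0 : 0 < k).
Implicit Types (f w h F b v : R -> R) (x M C delta eta : R).

Local Notation g := (dec2 a p).
Local Notation g' := (dec2' a p).
Local Notation G1 := (G1 a).
Local Notation G1' := (G1' a).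
Local Notation G2 := (G2 a p).
Local Notation G2' := (G2' a p).
Local Notation bt := (bt a p).
Local Notation K := (Kc a p).
Local Notation Kt := (Ktc a p).
Local Notation Kg := (Kgc a p).
Local Notation ball eta := (in_ball K Kt Kg (rho eta) g G1 bt).
Local Notation rad := (ball_radius K Kt Kg g G1 bt).
Local Notation drad := (delta_radius k K Kt Kg g G1 bt).
Local Notation e := (coupling k g bt).
Local Notation psi_step := (amp_step k g G2 bt).
Local Notation u_step := (pot_step k g G1 G2 bt).
Local Notation N := (N0 g G1 bt).

Hypothesis N_neq0 : N != 0.

Let K0 : 0 < K. Proof. exact: Kc_gt0. Qed.
Let Kt0 : 0 < Kt. Proof. exact: Ktc_gt0. Qed.
Let Kg0 : 0 < Kg. Proof. exact: bnd2_gt0. Qed.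

Let Kp : 0 <= K. Proof. exact: ltW. Qed.
Let Ktp : 0 <= Kt. Proof. exact: ltW. Qed.
Let Kgp : 0 <= Kg. Proof. exact: ltW. Qed.
Let kp : 0 <= k. Proof. exact: ltW. Qed.
Let pap : 0 <= p * a. Proof. by apply: mulr_ge0; exact: ltW. Qed.

(** The last conclusion is the source of orthogonality: an even [f] has [f1 0 = 0], hence
    [bt F = 0]. *)
Lemma G2_uniq f f1 F M Q : continuous F -> has_deriv f f1 ->
  has_deriv f1 (fun x => pot2 a p x * f x - F x) ->
  (forall x, 0 <= x -> `|f x| <= M) -> (forall x, 0 <= x -> `|f1 x| <= M) ->
  (forall x, 0 <= x -> `|F x| <= Q) -> f 0 = 0 ->
  (forall x, f x = G2 F x /\ f1 x = G2' F x) /\ bt F = f1 0.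
Proof.
move=> cF df df1 fM f1M FQ f0.
have pa0 : 0 < p * a by rewrite mulr_gt0.
have d2 := has_deriv_dec2 a p; have d2' := has_deriv_dec2' a p.
have l2 x : 0 <= x -> `|g x| <= bnd2 a p * expR (- (p * a) * x) by move=> _; exact: dec2_norm_le.
have l2' x : 0 <= x -> `|g' x| <= bnd2 a p * expR (- (p * a) * x) by move=> _; exact: dec2'_le.
split; last first.
  rewrite /bt (green_tint pa0 d2 d2' l2 l2' cF df df1 fM f1M) f0 dec20.
  by rewrite mulr1 mul0r subr0.
apply: (green_uniq pa0 (oner_neq0 _) d2 d2' (has_deriv_gro2 a p) (has_deriv_gro2' a p)
  (wronskian2 a p) l2 l2' cF df df1 fM f1M).
by rewrite f0 gro20 mul0r mulr0.
Qed.

Lemma G1_uniq f f1 F M Q : continuous F -> has_deriv f f1 ->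
  has_deriv f1 (fun x => pot1 a x * f x - F x) ->
  (forall x, 0 <= x -> `|f x| <= M) -> (forall x, 0 <= x -> `|f1 x| <= M) ->
  (forall x, 0 <= x -> `|F x| <= Q) -> f1 0 = 0 ->
  forall x, f x = G1 F x /\ f1 x = G1' F x.
Proof.
move=> cF df df1 fM f1M FQ f10.
have ta0 : 0 < 2 * a by rewrite mulr_gt0.
have W : 8 * a != 0 by rewrite gt_eqF// mulr_gt0.
apply: (green_uniq ta0 W (has_deriv_dec1 a) (has_deriv_dec1' a) (has_deriv_gro1 a)
  (has_deriv_gro1' a) (wronskian1 a) (dec1_le a0) (dec1'_le a0) cF df df1 fM f1M).
by rewrite f10 gro1'0 mul0r mulr0.
Qed.

Section at_weight.
Variable eta : R.
Hypotheses (eta0 : 0 <= eta) (eta_le : eta <= eta_max a p).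

Let H1 := rho_ge0 eta.
Let H2 := rho_le1 eta0.
Let H3 : adm (rho eta) g. Proof. exact: adm_dec2. Qed.
Let H4 : wb (rho eta) Kg g. Proof. exact: wb_dec2. Qed.
Let H5 F : adm (rho eta) F -> adm (rho eta) (G1 F). Proof. exact: (adm_G1 a0 p0 eta0 eta_le). Qed.
Let H6 F M : adm (rho eta) F -> wb (rho eta) M F -> wb (rho eta) (K * M) (G1 F).
Proof. exact: (G1_wb a0 p0 eta0 eta_le). Qed.
Let H7 F F' : adm (rho eta) F -> adm (rho eta) F' ->
  forall x, G1 F x - G1 F' x = G1 (fun x => F x - F' x) x.
Proof. exact: G1B. Qed.
Let H8 F : adm (rho eta) F -> bt F = 0 -> adm (rho eta) (G2 F). Proof. exact: adm_G2. Qed.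
Let H9 F M : adm (rho eta) F -> bt F = 0 -> wb (rho eta) M F -> wb (rho eta) (K * M) (G2 F).
Proof. exact: G2_wb. Qed.
Let H10 F F' : adm (rho eta) F -> adm (rho eta) F' ->
  forall x, G2 F x - G2 F' x = G2 (fun x => F x - F' x) x.
Proof. exact: G2B. Qed.
Let H11 F F' : adm (rho eta) F -> adm (rho eta) F' ->
  bt (fun x => F x - F' x) = bt F - bt F'.
Proof. exact: btB. Qed.
Let H12 F F' : adm (rho eta) F -> adm (rho eta) F' ->
  bt (fun x => F x + F' x) = bt F + bt F'.
Proof. exact: btD. Qed.
Let H13 q F : adm (rho eta) F -> bt (fun x => q * F x) = q * bt F.
Proof. exact: btZ. Qed.
Let H14 F M : adm (rho eta) F -> wb (rho eta) M F -> `|bt F| <= Kt * M.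
Proof. exact: bt_le. Qed.
Let H15 : 0 < bt g. Proof. exact: bt_dec2_gt0. Qed.

Lemma branch_exists delta : `|delta| <= drad -> exists w h,
  [/\ ball eta w h, w = u_step delta w h & h = psi_step delta w h].
Proof.
exact: (@reduced_exists R k K Kt Kg (rho eta) g G1 G2 bt k0 K0 Kt0 Kg0 H1 H2 H3 H4 H5 H6 H7
  H8 H9 H10 H11 H12 H13 H14 N_neq0 H15).
Qed.

Lemma branch_uniq delta w h w' h' : `|delta| <= drad -> ball eta w h -> ball eta w' h' ->
  w = u_step delta w h -> h = psi_step delta w h ->
  w' = u_step delta w' h' -> h' = psi_step delta w' h' -> w = w' /\ h = h'.
Proof.
exact: (@reduced_uniq R k K Kt Kg (rho eta) g G1 G2 bt k0 K0 Kt0 Kg0 H1 H2 H3 H4 H5 H6 H7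
  H8 H9 H10 H11 H12 H13 H14 N_neq0 H15).
Qed.

Lemma rad_gt0 : 0 < rad.
Proof. exact: ball_radius_gt0. Qed.

Lemma rad_le1 : rad <= 1.
Proof. exact: ball_radius_le1. Qed.

Lemma drad_gt0 : 0 < drad.
Proof. exact: delta_radius_gt0. Qed.

(** The constant [E] of the abstract section, which is local there; likewise [ball_bound] adds up
    [B], [A], [E] and [FB]. *)
Definition cpl_bound := 2 * (Kt * (Kg + 1)) / (k * `|N|).

Definition ball_bound := (K * (Kg * Kg) + 1) + (Kg + 1) + cpl_bound +
  (1 + cpl_bound * k * (K * (Kg * Kg) + 1)) * (Kg + 1).

Let E0 : 0 <= cpl_bound.
Proof. by rewrite divr_ge0// mulr_ge0// mulr_ge0// addr_ge0. Qed.
Let B0 : 0 <= K * (Kg * Kg) + 1.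
Proof. by rewrite addr_ge0// !mulr_ge0. Qed.
Let A0 : 0 <= Kg + 1. Proof. by rewrite addr_ge0. Qed.
Let F0 : 0 <= (1 + cpl_bound * k * (K * (Kg * Kg) + 1)) * (Kg + 1).
Proof. by rewrite mulr_ge0// addr_ge0// mulr_ge0// mulr_ge0. Qed.

Lemma ball_bound_ge0 : 0 <= ball_bound.
Proof. by apply: addr_ge0 => //; apply: addr_ge0 => //; exact: addr_ge0. Qed.

Let widen M f : wb (rho eta) M f -> M <= ball_bound -> wb (rho eta) ball_bound f.
Proof. by move=> h MB x; apply: le_trans (h x) _; rewrite ler_wpM2r. Qed.

Lemma ball_bounds w h : ball eta w h ->
  [/\ wb (rho eta) ball_bound w, wb (rho eta) ball_bound (fun x => g x + h x),
    `|e w h| <= ball_bound & wb (rho eta) ball_bound (amp_source k g bt w h)].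
Proof.
move=> wh; split.
- apply: widen (ball_w Kg0 H1 H2 H3 H4 H6 wh) _.
  by rewrite /ball_bound; move: E0 A0 F0; lra.
- apply: widen (ball_gh H1 H4 wh) _.
  by rewrite /ball_bound; move: E0 B0 F0; lra.
- apply: le_trans (coupling_le k0 K0 Kt0 Kg0 H1 H2 H3 H4 H5 H6 H11 H14 N_neq0 wh) _.
  by rewrite -/cpl_bound /ball_bound; move: B0 A0 F0; lra.
- apply: widen (wb_amp_source k0 K0 Kt0 Kg0 H1 H2 H3 H4 H5 H6 H11 H14 N_neq0 wh) _.
  by rewrite -/cpl_bound /ball_bound; move: B0 A0 E0; lra.
Qed.

Lemma ball_sign w h : ball eta w h -> e w h * N < 0.
Proof. exact: (coupling_sign k0 K0 Kt0 Kg0 H1 H2 H3 H4 H5 H6 H11 H12 H14 N_neq0 H15). Qed.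

Lemma ball_num_neq0 w h : ball eta w h -> bt (fun x => w x * (g x + h x)) != 0.
Proof.
move=> wh; rewrite -normr_gt0.
apply: lt_le_trans (num_ge K0 Kt0 Kg0 H1 H2 H3 H4 H5 H6 H11 H14 wh).
by rewrite divr_gt0// normr_gt0.
Qed.

Lemma ball_source_adm w h : ball eta w h -> adm (rho eta) (amp_source k g bt w h).
Proof. exact: (adm_amp_source k H1 H2 H3). Qed.

Lemma ball_source_orth w h : ball eta w h -> bt (amp_source k g bt w h) = 0.
Proof. exact: (amp_source_orth k0 K0 Kt0 Kg0 H1 H2 H3 H4 H5 H6 H11 H12 H13 H14 N_neq0). Qed.

Lemma pot1_le x : `|pot1 a x| <= 16 * a ^+ 2.
Proof.
have := sech_le1 (a * x); have := sech_gt0 (a * x); have := sqr_ge0 a.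
rewrite /pot1; set q := sech _ => ha q0 q1.
have : q ^+ 2 <= 1 by rewrite -(expr1n _ 2) lerXn2r ?nnegrE// ltW.
have := sqr_ge0 q; rewrite ler_norml => ? ?; apply/andP; split; nra.
Qed.

Lemma pot2_le x : `|pot2 a p x| <= a ^+ 2 * (2 * p ^+ 2 + p).
Proof.
have := sech_le1 (a * x); have := sech_gt0 (a * x); have := sqr_ge0 a.
rewrite /pot2; set q := sech _ => ha q0 q1.
have q2 : q ^+ 2 <= 1 by rewrite -(expr1n _ 2) lerXn2r ?nnegrE// ltW.
rewrite normrM ger0_norm// ler_wpM2l//.
have := sqr_ge0 q; have := sqr_ge0 p => ? ?.
rewrite ler_norml; apply/andP; split; move: p0; nra.
Qed.

Definition curve_bound := ball_bound + (K * (ball_bound ^+ 3 + ball_bound ^+ 2)) +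
  (16 * a ^+ 2 * ball_bound + (ball_bound ^+ 3 + ball_bound ^+ 2)) +
  (Kg * (p * a) + Kg + K * ball_bound) +
  (a ^+ 2 * (2 * p ^+ 2 + p) + 1 + k * ball_bound ^+ 2) * ball_bound.

(** Values of Green operators are twice differentiable, and their derivatives obey the same weighted
    bounds; a fixed point therefore solves the rescaled system classically. *)
Lemma branch_curve delta w h : `|delta| <= 1 -> ball eta w h ->
  w = u_step delta w h -> h = psi_step delta w h ->
  exists w1 q1,
  [/\ has_deriv w w1,
   has_deriv w1 (fun x => pot1 a x * w x -
     (delta * e w h / 2 * (w x * w x) + (g x + h x) * (g x + h x))),
   has_deriv (fun x => g x + h x) q1,
   has_deriv q1 (fun x => pot2 a p x * (g x + h x) -
     (delta + k * (delta * e w h) * w x) * (g x + h x)) &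
   forall x, 0 <= x -> `|w1 x| <= curve_bound * expR (- eta * x) /\
     `|q1 x| <= curve_bound * expR (- eta * x)].
Proof.
move=> d1 wh ew eh.
have [bw bq be bs] := ball_bounds wh.
have as_ := ball_source_adm wh; have ao := ball_source_orth wh.
have ah : adm (rho eta) h by case: wh.
have aw : adm (rho eta) w by case: wh.
pose S := pot_source k g bt delta w h h.
have aS : adm (rho eta) S by exact: (adm_pot_source k H1 H2 H3 wh).
have ta0 : 0 < 2 * a by rewrite mulr_gt0.
have W : 8 * a != 0 by rewrite gt_eqF// mulr_gt0.
(* At a fixed point the updated amplitude in [pot_step] is [h] itself. *)
have ew' : w = G1 S by rewrite {1}ew /pot_step -eh.
have Ew x : G1 S x = w x by rewrite [in RHS]ew'.
have B_ge0 := ball_bound_ge0.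
exists (G1' S), (fun x => g' x + delta * G2' (amp_source k g bt w h) x).
have bS : wb (rho eta) (ball_bound ^+ 3 + ball_bound ^+ 2) S.
  move=> x; rewrite /S /pot_source.
  have wx := wb_bounded eta0 bw x; have qx := wb_bounded eta0 bq x.
  have wx' := bw x; have qx' := bq x.
  move: (e w h) be => ee be.
  apply: le_trans (ler_normD _ _) _; rewrite [leRHS]mulrDl; apply: lerD; last first.
    by rewrite normrM expr2 -mulrA; apply: ler_pM.
  rewrite [`|_ * (w x * w x)|]normrM [`|w x * w x|]normrM.
  have -> : ball_bound ^+ 3 * rho eta x = ball_bound * (ball_bound * (ball_bound * rho eta x)) by ring.
  apply: ler_pM => //; last by apply: ler_pM.
  rewrite normrM normfV normr_nat normrM.
  have : `|delta| * `|ee| <= 1 * ball_bound by apply: ler_pM.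
  have := mulr_ge0 (normr_ge0 delta) (normr_ge0 ee); lra.
have rho_pos x : 0 <= x -> rho eta x = expR (- eta * x) by move=> x0; rewrite /rho ger0_norm.
have dw1 : has_deriv (G1' S) (fun x => pot1 a x * w x - S x).
  have := has_deriv_green1 W (has_deriv_dec1 a) (has_deriv_dec1' a) (has_deriv_gro1 a)
    (has_deriv_gro1' a) (wronskian1 a) (adm_cont aS).
  by move=> /has_deriv_eq; apply => x; congr (_ * _ - _); exact: Ew.
have dw : has_deriv w (G1' S).
  have d : has_deriv (G1 S) (G1' S).
    exact: has_deriv_green (8 * a) (has_deriv_dec1 a) (has_deriv_gro1 a) _ (adm_cont aS).
  have <- : G1 S = w by apply/funext => x; exact: Ew.
  exact: d.
have dG2 := has_deriv_green 1 (has_deriv_dec2 a p) (has_deriv_gro2 a p) (adm_cont as_).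
have dG2' := has_deriv_green1 (oner_neq0 R) (has_deriv_dec2 a p) (has_deriv_dec2' a p)
  (has_deriv_gro2 a p) (has_deriv_gro2' a p) (wronskian2 a p) (adm_cont as_).
have Kg_pa : 0 <= Kg * (p * a) by rewrite mulr_ge0.
have KB : 0 <= K * ball_bound by rewrite mulr_ge0.
have B23 : 0 <= ball_bound ^+ 3 + ball_bound ^+ 2 by rewrite addr_ge0// exprn_ge0.
have c1 : 0 <= 16 * a ^+ 2 * ball_bound by rewrite mulr_ge0// mulr_ge0// sqr_ge0.
have c2 : 0 <= (a ^+ 2 * (2 * p ^+ 2 + p) + 1 + k * ball_bound ^+ 2) * ball_bound.
  by rewrite mulr_ge0// !addr_ge0 ?ler01// mulr_ge0 ?sqr_ge0// addr_ge0 ?mulr_ge0 ?sqr_ge0// ltW.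
have c3 : 0 <= K * (ball_bound ^+ 3 + ball_bound ^+ 2) by rewrite mulr_ge0.
have hx x : h x = delta * G2 (amp_source k g bt w h) x by rewrite {1}eh.
split; [exact: dw|exact: dw1| | |].
- have <- : (fun x => g x + delta * G2 (amp_source k g bt w h) x) = (fun x => g x + h x).
    by apply/funext => x; rewrite -hx.
  exact: has_derivD (has_deriv_dec2 a p) (has_derivZ delta dG2).
- have := has_derivD (has_deriv_dec2' a p) (has_derivZ delta dG2').
  move=> /has_deriv_eq; apply => x.
  rewrite -/(G2 (amp_source k g bt w h) x) mulrBr mulrCA -hx /amp_source; ring.
- move=> x x0; split.
    have [_ h1] := G1_pos a0 p0 eta0 eta_le aS bS x0.
    apply: le_trans h1 _; rewrite ler_wpM2r ?expR_ge0// /curve_bound.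
    by move: B_ge0 KB c1 c2 c3 Kg_pa B23 Kg0; lra.
  have [_ h2] := G2_pos a0 p0 eta0 eta_le as_ bs x0.
  apply: (@le_trans _ _ ((Kg * (p * a) + Kg + K * ball_bound) * expR (- eta * x))); last first.
    rewrite ler_wpM2r ?expR_ge0// /curve_bound.
    by move: B_ge0 KB c1 c2 c3 Kg_pa B23 Kg0; lra.
  apply: le_trans (ler_normD _ _) _; rewrite [leRHS]mulrDl; apply: lerD; last first.
    rewrite normrM; apply: le_trans h2; rewrite ler_piMl//.
  have := wb_pos H4 x0 => hg.
  have := dec2'_le a0 p0 x => hg'.
  apply: le_trans hg' _; rewrite -/Kg.
  have hE : expR (- (p * a) * x) <= expR (- eta * x).
    rewrite ler_expR ler_wpM2r// lerN2; apply: le_trans eta_le _.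
    rewrite /eta_max; have : Num.min (2 * a) (p * a) <= p * a by rewrite ge_min lexx orbT.
    have : 0 < Num.min (2 * a) (p * a) by rewrite lt_min ta0 mulr_gt0.
    lra.
  apply: (@le_trans _ _ (Kg * expR (- eta * x))); first by apply: ler_wpM2l; [exact: ltW|].
  by rewrite ler_wpM2r ?expR_ge0// lerDr.
Qed.

End at_weight.

End branch.

(** * Bounded profiles lie in the contraction ball *)

Section uniqueness.
Context {R : realType}.
Variables a p k : R.
Hypotheses (a0 : 0 < a) (p0 : 0 < p) (k0 : 0 < k).
Implicit Types (f w h F b v : R -> R) (x M C delta : R).

Local Notation g := (dec2 a p).
Local Notation g' := (dec2' a p).
Local Notation G1 := (G1 a).
Local Notation G2 := (G2 a p).
Local Notation bt := (bt a p).
Local Notation K := (Kc a p).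
Local Notation Kt := (Ktc a p).
Local Notation Kg := (Kgc a p).
Local Notation ball := (in_ball K Kt Kg (rho 0) g G1 bt).
Local Notation rad := (ball_radius K Kt Kg g G1 bt).
Local Notation drad := (delta_radius k K Kt Kg g G1 bt).
Local Notation e := (coupling k g bt).
Local Notation psi_step := (amp_step k g G2 bt).
Local Notation u_step := (pot_step k g G1 G2 bt).
Local Notation N := (N0 g G1 bt).

Hypothesis N_neq0 : N != 0.

Let K0 : 0 < K. Proof. exact: Kc_gt0. Qed.
Let Kg0 : 0 < Kg. Proof. exact: bnd2_gt0. Qed.
Let Kp : 0 <= K. Proof. exact: ltW. Qed.
Let Kgp : 0 <= Kg. Proof. exact: ltW. Qed.
Let kp : 0 <= k. Proof. exact: ltW. Qed.
Let r0 : (0 : R) <= 0. Proof. exact: lexx. Qed.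
Let rm : 0 <= eta_max a p. Proof. exact/ltW/eta_max_gt0. Qed.
Let rad1 : rad <= 1. Proof. exact: (rad_le1 a p). Qed.

Lemma rho0 x : rho 0 x = 1 :> R.
Proof. by rewrite /rho oppr0 mul0r expR0. Qed.

Lemma wb0 M f : (forall x, `|f x| <= M) -> wb (rho 0) M f.
Proof. by move=> h x; rewrite rho0 mulr1. Qed.

Lemma adm0 M f : continuous f -> (forall x, f (- x) = f x) -> (forall x, `|f x| <= M) ->
  adm (rho 0) f.
Proof. by move=> cf ef h; split=> //; exists M; exact: wb0. Qed.

(** [|delta| * Ch C] will bound the rescaled [h], and [Cw C] the rescaled [w]. *)
Let Ch C := K * (1 + k * C) * (2 * Kg).
Let Cw C := 2 * (K * Kg ^+ 2) * 4.
(** Times [|delta|], the first two summands must be small for absorbing remainders in the bounds on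
    [b] and [v], the next two for placing [h] and [w] in the ball. *)
Definition smallness C := 2 * (K * (1 + k * C)) + K * C + Ch C +
  K * (C ^+ 2 * (Cw C) ^+ 2 / 2 + (2 * Kg + 1) * Ch C) + 1.

Let g_le x : `|g x| <= Kg.
Proof. by have := wb_dec2 a0 p0 rm x; rewrite rho0 mulr1. Qed.

(** Absorption: the a priori bound [M] only starts the iteration. Each pass halves the excess over
    [2 c], so [M] disappears in the limit. *)
Lemma halving_bound (f : R -> R) c M : (forall x, `|f x| <= M) ->
  (forall Q, (forall x, `|f x| <= Q) -> forall x, `|f x| <= c + Q / 2) ->
  forall x, `|f x| <= 2 * c.
Proof.
move=> fM imp x; rewrite -subr_le0; apply: (@le0_half_pow _ (M - 2 * c)) => n.
suff h y : `|f y| <= 2 * c + (M - 2 * c) / 2 ^+ n by rewrite lerBlDr addrC.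
elim: n y => [|n IH] y; first by rewrite expr0 divr1 addrC subrK.
apply: le_trans (imp _ IH y) _; rewrite exprSr invfM; set q := (2 ^+ n)^-1.
by rewrite le_eqVlt; apply/orP; left; apply/eqP; field.
Qed.

Lemma G2_bounded F Q : continuous F -> (forall x, F (- x) = F x) -> (forall x, `|F x| <= Q) ->
  bt F = 0 -> forall x, `|G2 F x| <= K * Q.
Proof.
move=> cF eF FQ b0 x.
have := G2_wb a0 p0 r0 rm (adm0 cF eF FQ) b0 (wb0 FQ) x.
by rewrite rho0 mulr1.
Qed.

Lemma G1_bounded F Q : continuous F -> (forall x, F (- x) = F x) -> (forall x, `|F x| <= Q) ->
  forall x, `|G1 F x| <= K * Q.
Proof.
move=> cF eF FQ x.
have := G1_wb a0 p0 r0 rm (adm0 cF eF FQ) (wb0 FQ) x.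
by rewrite rho0 mulr1.
Qed.

Lemma G2Z q F x : adm (rho 0) F -> G2 (fun y => q * F y) x = q * G2 F x.
Proof.
move=> aF; have cF := adm_cont aF; have := btZ a0 p0 r0 q aF.
rewrite /bt /G2 /green => ->.
have P (u : R -> R) : continuous u ->
    prim (fun y => u y * (q * F y)) x = q * prim (fun y => u y * F y) x.
  move=> cu; rewrite -primZ; last exact: contM.
  by congr (prim _ x); apply/funext => y; rewrite mulrCA.
rewrite (P _ (has_deriv_cont (has_deriv_dec2 a p))) (P _ (has_deriv_cont (has_deriv_gro2 a p))).
move: (prim _ x) (prim _ x) (tint _) (gro2 a p x) (g x) => A A' I y z.
ring.
Qed.

Lemma smallness_gt0 C : 0 <= C -> 0 < smallness C.
Proof.
move=> C0; have Ch0 : 0 <= Ch C by rewrite mulr_ge0 ?mulr_ge0// addr_ge0// mulr_ge0.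
have h1 : 0 <= K * (1 + k * C) by rewrite mulr_ge0// addr_ge0// mulr_ge0.
have h2 : 0 <= K * C by exact: mulr_ge0.
have h3 : 0 <= K * (C ^+ 2 * (Cw C) ^+ 2 / 2 + (2 * Kg + 1) * Ch C).
  rewrite mulr_ge0// addr_ge0//; first by rewrite mulr_ge0// mulr_ge0// sqr_ge0.
  by rewrite mulr_ge0// addr_ge0// mulr_ge0.
by rewrite /smallness; move: h1 h2 h3 Ch0; lra.
Qed.

Section profile.
Variables (C delta : R) (v v1 b b1 : R -> R).
Hypotheses (C0 : 0 < C) (dY : `|delta| * smallness C <= rad).
Hypotheses (dv : has_deriv v v1)
  (dv1 : has_deriv v1 (fun x => pot1 a x * v x - (v x ^+ 2 / 2 + b x ^+ 2)))
  (db : has_deriv b b1)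
  (db1 : has_deriv b1 (fun x => pot2 a p x * b x - (delta + k * v x) * b x)).
Hypotheses (ev : forall x, v (- x) = v x) (eb : forall x, b (- x) = b x).
Hypotheses (v_le : forall x, `|v x| <= C * `|delta|) (v1_le : forall x, `|v1 x| <= C * `|delta|)
  (b_le : forall x, `|b x| <= C * Num.sqrt `|delta|)
  (b1_le : forall x, `|b1 x| <= C * Num.sqrt `|delta|).
Hypothesis b_neq0 : exists x, b x != 0.

Let cv := has_deriv_cont dv.
Let cb := has_deriv_cont db.
Let ad0 : 0 <= `|delta|. Proof. exact: normr_ge0. Qed.
Let Cp : 0 <= C. Proof. exact: ltW. Qed.
Let Ch0 : 0 <= Ch C. Proof. by rewrite mulr_ge0 ?mulr_ge0// addr_ge0// mulr_ge0. Qed.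
Let Cw0 : 0 <= Cw C. Proof. by rewrite mulr_ge0// mulr_ge0// mulr_ge0// sqr_ge0. Qed.
Let y1 : 0 <= K * (1 + k * C). Proof. by rewrite mulr_ge0// addr_ge0// mulr_ge0. Qed.
Let y2 : 0 <= K * C. Proof. exact: mulr_ge0. Qed.
Let y3 : 0 <= K * (C ^+ 2 * (Cw C) ^+ 2 / 2 + (2 * Kg + 1) * Ch C).
Proof.
rewrite mulr_ge0// addr_ge0//; first by rewrite mulr_ge0// mulr_ge0// sqr_ge0.
by rewrite mulr_ge0// addr_ge0// mulr_ge0.
Qed.

Let small Q q : 0 <= q -> Q <= q -> q <= smallness C -> `|delta| * Q <= rad.
Proof.
move=> q0 Qq qY; apply: le_trans dY; apply: ler_wpM2l => //; exact: le_trans qY.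
Qed.

Let s1 : `|delta| * (2 * (K * (1 + k * C))) <= 1.
Proof.
apply: le_trans rad1; apply: (@small _ (2 * (K * (1 + k * C)))) => //; first exact: mulr_ge0.
by rewrite /smallness; move: y2 y3 Ch0; lra.
Qed.
Let s2 : `|delta| * (K * C) <= 1.
Proof.
apply: le_trans rad1; apply: (@small _ (K * C)) => //.
by rewrite /smallness; move: y1 y3 Ch0; lra.
Qed.
Let s3 : `|delta| * Ch C <= rad.
Proof. by apply: (@small _ (Ch C)) => //; rewrite /smallness; move: y1 y2 y3; lra. Qed.
Let s4 : `|delta| * (K * (C ^+ 2 * (Cw C) ^+ 2 / 2 + (2 * Kg + 1) * Ch C)) <= rad.
Proof.
apply: (@small _ (K * (C ^+ 2 * (Cw C) ^+ 2 / 2 + (2 * Kg + 1) * Ch C))) => //.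
by rewrite /smallness; move: y1 y2 Ch0; lra.
Qed.

(** As [g 0 = 1], the remainder [ht] vanishes at 0, which is the condition in [G2_uniq]. *)
Let alpha := b 0.
Let ht x := b x - alpha * g x.
Let F x := (delta + k * v x) * b x.

Let cF : continuous F.
Proof. by apply: contM => //; apply: contD; [exact: cont_cst|exact: contZ]. Qed.

Let eF x : F (- x) = F x. Proof. by rewrite /F ev eb. Qed.

Let F_le Q : (forall x, `|b x| <= Q) -> forall x, `|F x| <= `|delta| * (1 + k * C) * Q.
Proof.
move=> bQ x; rewrite /F normrM; apply: ler_pM => //.
apply: le_trans (ler_normD _ _) _; rewrite normrM (gtr0_norm k0) mulrDr mulr1 lerD2l.
have := ler_wpM2l kp (v_le x); rewrite mulrCA; lra.
Qed.

Let b10 : b1 0 = 0.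
Proof. by have := deriv_even db eb 0; rewrite oppr0; lra. Qed.

Let v10 : v1 0 = 0.
Proof. by have := deriv_even dv ev 0; rewrite oppr0; lra. Qed.

Let htE : (forall x, ht x = G2 F x) /\ bt F = 0.
Proof.
have dg := has_deriv_dec2 a p; have dg' := has_deriv_dec2' a p.
have dh : has_deriv ht (fun x => b1 x - alpha * g' x).
  exact: has_derivB db (has_derivZ alpha dg).
have dh1 : has_deriv (fun x => b1 x - alpha * g' x) (fun x => pot2 a p x * ht x - F x).
  apply: has_deriv_eq (has_derivB db1 (has_derivZ alpha dg')) _ => x.
  rewrite /ht /F; ring.
pose M := C * Num.sqrt `|delta| + `|alpha| * Kg.
have g'_le x : 0 <= x -> `|g' x| <= Kg.
  move=> x0; apply: le_trans (dec2'_le a0 p0 x) _; rewrite ler_piMr// expR_le1 mulNr oppr_le0.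
  by rewrite !mulr_ge0// ltW.
have hM x : 0 <= x -> `|ht x| <= M.
  move=> _; apply: le_trans (ler_normB _ _) _; rewrite normrM; apply: lerD => //.
  exact: ler_wpM2l.
have h1M x : 0 <= x -> `|b1 x - alpha * g' x| <= M.
  move=> x0; apply: le_trans (ler_normB _ _) _; rewrite normrM; apply: lerD => //.
  by apply: ler_wpM2l => //; exact: g'_le.
have h0 : ht 0 = 0 by rewrite /ht dec20 mulr1 subrr.
have [h1 h2] := G2_uniq a0 p0 cF dh dh1 hM h1M (fun x _ => F_le b_le x) h0.
split=> [x|]; first by case: (h1 x).
by rewrite h2 b10 dec2'0 mulr0 subr0.
Qed.

Let ht_le Q : (forall x, `|b x| <= Q) -> forall x, `|ht x| <= `|delta| * (K * (1 + k * C)) * Q.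
Proof.
move=> bQ x; rewrite htE.1.
have -> : `|delta| * (K * (1 + k * C)) * Q = K * (`|delta| * (1 + k * C) * Q) by ring.
exact: (G2_bounded cF eF (F_le bQ) htE.2).
Qed.

Let bE x : b x = alpha * g x + ht x. Proof. by rewrite /ht addrC subrK. Qed.

(** The remainder [ht] is at most [O(delta)] times any bound on [b]; absorbing it controls [b] by
    [alpha] alone. *)
Let b_alpha x : `|b x| <= 2 * (`|alpha| * Kg).
Proof.
apply: (halving_bound b_le) => Q bQ {}x.
rewrite bE; apply: le_trans (ler_normD _ _) _; rewrite normrM; apply: lerD.
  exact: ler_wpM2l.
have Q0 : 0 <= Q by exact: le_trans (normr_ge0 _) (bQ 0).
apply: le_trans (ht_le bQ x) _; rewrite mulrC ler_wpM2l//.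
by move: s1; lra.
Qed.

(** Here a nontrivial amplitude is used: [alpha = 0] would force [b = 0] by [b_alpha]. *)
Let alpha_neq0 : alpha != 0.
Proof.
apply/eqP => al0; have [x /eqP] := b_neq0; apply; apply/eqP; rewrite -normr_le0.
by have := b_alpha x; rewrite al0 normr0 mul0r mulr0.
Qed.

Let asq : 0 < alpha ^+ 2. Proof. by rewrite exprn_even_gt0. Qed.

Let vE x : v x = G1 (fun x => v x ^+ 2 / 2 + b x ^+ 2) x.
Proof.
have cF1 : continuous (fun x => v x ^+ 2 / 2 + b x ^+ 2).
  apply: contD; last exact: contX.
  by apply: contM; [exact: contX|exact: cont_cst].
pose Q := (C * `|delta|) ^+ 2 / 2 + (C * Num.sqrt `|delta|) ^+ 2.
have FQ x1 : 0 <= x1 -> `|v x1 ^+ 2 / 2 + b x1 ^+ 2| <= Q.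
  move=> _; apply: le_trans (ler_normD _ _) _; rewrite normrM normfV normr_nat !normrX.
  apply: lerD; last by rewrite lerXn2r// nnegrE// (le_trans (normr_ge0 _) (b_le x1)).
  by rewrite ler_wpM2r// lerXn2r// nnegrE// (le_trans (normr_ge0 _) (v_le x1)).
by case: (G1_uniq a0 cF1 dv dv1 (fun x _ => v_le x) (fun x _ => v1_le x) FQ v10 x).
Qed.

(** One factor of [v^2] is at most [C * |delta|], so that term is absorbed and [b^2], of order
    [alpha^2], remains. Dividing by [alpha^2] then gives a bounded [w]. *)
Let v_alpha x : `|v x| <= Cw C * alpha ^+ 2.
Proof.
have -> : Cw C * alpha ^+ 2 = 2 * (K * (2 * (`|alpha| * Kg)) ^+ 2).
  by rewrite /Cw !exprMn real_normK ?num_real//; ring.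
apply: (halving_bound v_le) => Q vQ {}x; rewrite vE.
have cF1 : continuous (fun x => v x ^+ 2 / 2 + b x ^+ 2).
  apply: contD; last exact: contX.
  by apply: contM; [exact: contX|exact: cont_cst].
have eF1 y : v (- y) ^+ 2 / 2 + b (- y) ^+ 2 = v y ^+ 2 / 2 + b y ^+ 2 by rewrite ev eb.
have FQ y : `|v y ^+ 2 / 2 + b y ^+ 2| <= C * `|delta| * Q / 2 + (2 * (`|alpha| * Kg)) ^+ 2.
  apply: le_trans (ler_normD _ _) _; rewrite normrM normfV normr_nat !normrX; apply: lerD.
    by rewrite ler_wpM2r// expr2; apply: ler_pM.
  by rewrite lerXn2r// nnegrE// (le_trans (normr_ge0 _) (b_alpha y)).
apply: le_trans (G1_bounded cF1 eF1 FQ x) _; rewrite mulrDr addrC lerD2l.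
have Q0 : 0 <= Q by exact: le_trans (normr_ge0 _) (vQ 0).
have -> : K * (C * `|delta| * Q / 2) = `|delta| * (K * C) * (Q / 2) by ring.
rewrite ler_piMl// divr_ge0//.
Qed.

Let w x := v x / alpha ^+ 2.
Let h x := ht x / alpha.

Let vw x : v x = alpha ^+ 2 * w x.
Proof. by rewrite /w mulrC divfK// gt_eqF. Qed.

Let bh x : b x = alpha * (g x + h x).
Proof. by rewrite /h mulrDr [alpha * (_ / _)]mulrC divfK// bE. Qed.

Let w_le x : `|w x| <= Cw C.
Proof. by rewrite /w normrM normfV (gtr0_norm asq) ler_pdivrMr. Qed.

Let h_le x : `|h x| <= `|delta| * Ch C.
Proof.
rewrite /h normrM normfV ler_pdivrMr ?normr_gt0//.
apply: le_trans (ht_le b_alpha x) _; rewrite /Ch.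
by rewrite le_eqVlt; apply/orP; left; apply/eqP; ring.
Qed.

Let h_le1 x : `|h x| <= 1.
Proof. by apply: le_trans (h_le x) _; exact: le_trans s3 rad1. Qed.

Let cw : continuous w. Proof. by apply: contM => //; exact: cont_cst. Qed.
Let cht : continuous ht.
Proof. by apply: contB => //; apply: contZ; exact: has_deriv_cont (has_deriv_dec2 a p). Qed.
Let ch : continuous h. Proof. by apply: contM => //; exact: cont_cst. Qed.
Let ew x : w (- x) = w x. Proof. by rewrite /w ev. Qed.
Let eh x : h (- x) = h x. Proof. by rewrite /h /ht eb dec2N. Qed.
Let aw : adm (rho 0) w. Proof. exact: adm0 cw ew w_le. Qed.
Let ah : adm (rho 0) h. Proof. exact: adm0 ch eh h_le. Qed.
Let ag : adm (rho 0) g. Proof. exact: adm_dec2. Qed.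
Let agh : adm (rho 0) (fun x => g x + h x). Proof. exact: adm_add. Qed.
Let arho x : 0 <= rho 0 x :> R. Proof. by rewrite rho0. Qed.
Let rho_1 x : rho 0 x <= 1 :> R. Proof. by rewrite rho0. Qed.
Let awgh : adm (rho 0) (fun x => w x * (g x + h x)).
Proof. exact: adm_mul. Qed.

Let wE : w = G1 (fun x => alpha ^+ 2 / 2 * (w x * w x) + (g x + h x) * (g x + h x)).
Proof.
have dw : has_deriv w (fun x => v1 x / alpha ^+ 2).
  apply: has_deriv_eq (has_derivM dv (has_deriv_cst _)) _ => x.
  by rewrite mulr0 addr0.
apply/funext => x.
have dw1 : has_deriv (fun x => v1 x / alpha ^+ 2) (fun x => pot1 a x * w x -
    (alpha ^+ 2 / 2 * (w x * w x) + (g x + h x) * (g x + h x))).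
  apply: has_deriv_eq (has_derivM dv1 (has_deriv_cst _)) _ => y.
  by rewrite mulr0 addr0 vw bh; field.
(* This bound degenerates as [alpha] tends to 0, but [G1_uniq] asks for mere boundedness. *)
pose M := Cw C + C * `|delta| / alpha ^+ 2.
have CwM : Cw C <= M by rewrite lerDl; apply: divr_ge0; [exact: mulr_ge0|exact: sqr_ge0].
have M1 x1 : 0 <= x1 -> `|w x1| <= M by move=> _; exact: le_trans (w_le x1) CwM.
have M2 x1 : 0 <= x1 -> `|v1 x1 / alpha ^+ 2| <= M.
  move=> _; rewrite normrM normfV (gtr0_norm asq) /M.
  apply: (@le_trans _ _ (C * `|delta| / alpha ^+ 2)); last by rewrite lerDr.
  by rewrite ler_wpM2r// invr_ge0 ltW.
have aS : adm (rho 0) (fun x => alpha ^+ 2 / 2 * (w x * w x) + (g x + h x) * (g x + h x)).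
  by apply: adm_add; [apply: adm_scale|]; exact: adm_mul.
have [cS _ [Q SQ]] := aS.
have w10 : v1 0 / alpha ^+ 2 = 0 by rewrite v10 mul0r.
have SQ' x1 : 0 <= x1 -> `|alpha ^+ 2 / 2 * (w x1 * w x1) + (g x1 + h x1) * (g x1 + h x1)| <= Q.
  by move=> _; have := SQ x1; rewrite rho0 mulr1.
by case: (G1_uniq a0 cS dw dw1 M1 M2 SQ' w10 x).
Qed.

Let asq_le : alpha ^+ 2 <= C ^+ 2 * `|delta|.
Proof.
rewrite -[alpha ^+ 2]ger0_norm ?sqr_ge0// normrX -(sqr_sqrtr ad0) -exprMn.
by rewrite lerXn2r ?nnegrE ?mulr_ge0 ?sqrtr_ge0//; exact: b_le.
Qed.

(** [w - w0] is [G1] of a difference of sources, small because [alpha^2 <= C^2 |delta|] and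
    [h = O(delta)]. *)
Let close x : `|w x - w0 g G1 x| <= rad.
Proof.
have agg : adm (rho 0) (fun x => g x * g x) by exact: adm_mul.
have aS : adm (rho 0) (fun x => alpha ^+ 2 / 2 * (w x * w x) + (g x + h x) * (g x + h x)).
  by apply: adm_add; [apply: adm_scale|]; exact: adm_mul.
rewrite {1}wE /w0 (G1B a0 r0 aS agg).
have [cD eD _] := adm_sub aS agg.
have bD y : `|alpha ^+ 2 / 2 * (w y * w y) + (g y + h y) * (g y + h y) - g y * g y| <=
    `|delta| * (C ^+ 2 * (Cw C) ^+ 2 / 2 + (2 * Kg + 1) * Ch C).
  have -> : alpha ^+ 2 / 2 * (w y * w y) + (g y + h y) * (g y + h y) - g y * g y =
    alpha ^+ 2 / 2 * w y ^+ 2 + (2 * g y + h y) * h y by ring.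
  apply: le_trans (ler_normD _ _) _; rewrite mulrDr; apply: lerD.
    rewrite ger0_norm; last by rewrite mulr_ge0 ?sqr_ge0// divr_ge0// sqr_ge0.
    have -> : `|delta| * (C ^+ 2 * Cw C ^+ 2 / 2) = C ^+ 2 * `|delta| / 2 * Cw C ^+ 2 by ring.
    apply: ler_pM; [by rewrite divr_ge0// sqr_ge0|exact: sqr_ge0|by rewrite ler_wpM2r|].
    by rewrite -[w y ^+ 2]ger0_norm ?sqr_ge0// normrX lerXn2r// nnegrE.
  rewrite [leRHS]mulrCA normrM; apply: ler_pM => //.
  apply: le_trans (ler_normD _ _) _; apply: lerD => //.
  by rewrite normrM normr_nat ler_wpM2l.
apply: le_trans (G1_bounded cD eD bD x) _; rewrite mulrCA; exact: s4.
Qed.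

Lemma profile_ball : ball w h.
Proof.
split; [exact: aw|exact: ah|exact: wb0 close|].
by apply: wb0 => x; exact: le_trans (h_le x) s3.
Qed.

Let FE x : F x = alpha * (delta * (g x + h x) + k * alpha ^+ 2 * (w x * (g x + h x))).
Proof. by rewrite /F bh vw; ring. Qed.

(** Orthogonality [bt F = 0], divided by [alpha], is a linear equation for [alpha^2], whose leading
    coefficient is nonzero on the ball. *)
Let alpha2 : alpha ^+ 2 = delta * e w h.
Proof.
have := htE.2; have -> : F = (fun x => alpha * (delta * (g x + h x) + k * alpha ^+ 2 * (w x * (g x + h x)))).
  by apply/funext => x; exact: FE.
have a1 := adm_scale delta agh; have a2 := adm_scale (k * alpha ^+ 2) awgh.
rewrite (btZ a0 p0 r0 _ (adm_add a1 a2)) (btD a0 p0 r0 a1 a2).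
rewrite (btZ a0 p0 r0 _ agh) (btZ a0 p0 r0 _ awgh).
move=> /eqP; rewrite mulf_eq0 (negbTE alpha_neq0)/= => /eqP.
have := ball_num_neq0 a0 p0 N_neq0 r0 rm profile_ball; rewrite /coupling.
move: (bt _) (bt _) => D n n0 E.
have k1 : k != 0 by rewrite gt_eqF.
apply: (mulfI (mulf_neq0 k1 n0)).
have -> : k * n * (delta * (- D / (k * n))) = - (delta * D) by field; apply/andP.
by move: E; lra.
Qed.

Let hE x : h x = delta * G2 (amp_source k g bt w h) x.
Proof.
have as_ := ball_source_adm k a0 p0 r0 rm profile_ball.
rewrite /h (htE.1 x); have -> : F = (fun x => alpha * delta * amp_source k g bt w h x).
  by apply/funext => y; rewrite FE alpha2 /amp_source; ring.
rewrite (G2Z _ _ as_); by rewrite -[alpha * delta * _]mulrA [alpha * _]mulrC mulfK.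
Qed.

Lemma profile_in_ball : exists w h alpha,
  [/\ ball w h, w = u_step delta w h, h = psi_step delta w h,
    alpha ^+ 2 = delta * e w h &
    (forall x, v x = alpha ^+ 2 * w x) /\ (forall x, b x = alpha * (g x + h x))].
Proof.
have hE' : h = psi_step delta w h by apply/funext => x; exact: hE.
exists w, h, alpha; split; [exact: profile_ball| |exact: hE'|exact: alpha2|].
- by rewrite /pot_step -hE' /pot_source -alpha2; exact: wE.
- by split; [exact: vw|exact: bh].
Qed.

End profile.

End uniqueness.

(** * Sobolev profiles *)

Section even_sobolev.
Context {R : realType}.
Local Notation mu := (@lebesgue_measure R).
Implicit Types (f u v : R -> R) (x M : R).

Lemma H2even_rep u : H2even u -> exists f f1,
  [/\ has_deriv f f1, continuous f1, u = f %[ae mu], wderiv u = f1 %[ae mu] &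
   forall x, f (- x) = f x].
Proof.
move=> [h2 eu]; have [f [f1 [d c1 E E1]]] := H2_rep_C1 h2.
exists f, f1; split; [exact: d|exact: c1|exact: E|exact: E1|].
exact: even_representative (has_deriv_cont d) E eu.
Qed.

Lemma H2_rep_L2 u f f1 : H2 u -> continuous f -> continuous f1 ->
  u = f %[ae mu] -> wderiv u = f1 %[ae mu] -> L2 f /\ L2 f1.
Proof.
move=> [[Lu ?] [Lu' ?]] cf cf1 E E1; split.
- exact: ae_eq_L2 (continuous_measurable_fun cf) E Lu.
- exact: ae_eq_L2 (continuous_measurable_fun cf1) E1 Lu'.
Qed.

Lemma H2_wderiv2_L2 u f2 : H2 u -> continuous f2 -> wderiv (wderiv u) = f2 %[ae mu] -> L2 f2.
Proof.
move=> [_ h1] cf E; apply: ae_eq_L2 (continuous_measurable_fun cf) E _.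
by have [] := wderivP h1.
Qed.

(** From [sobolev_sup], with the constant [sqrt 2] rounded up to 2. *)
Lemma H2_sup f f1 f2 M : has_deriv f f1 -> has_deriv f1 f2 -> continuous f2 ->
  L2 f -> L2 f1 -> L2 f2 ->
  Num.sqrt (L2inner f f + L2inner f1 f1 + L2inner f2 f2) <= M ->
  forall x, `|f x| <= 2 * M /\ `|f1 x| <= 2 * M.
Proof.
move=> d d1 c2 L L1 L2' h x.
have M0 : 0 <= M by apply: le_trans h; exact: sqrtr_ge0.
have i0 := L2inner_ge0 f; have i1 := L2inner_ge0 f1; have i2 := L2inner_ge0 f2.
have {}h : L2inner f f + L2inner f1 f1 + L2inner f2 f2 <= M ^+ 2.
  rewrite -[leLHS]sqr_sqrtr; last by rewrite !addr_ge0.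
  by rewrite lerXn2r ?nnegrE ?sqrtr_ge0.
have key (t : R) : t ^+ 2 <= 2 * M ^+ 2 -> `|t| <= 2 * M.
  move=> tM; rewrite -[2 * M]ger0_norm ?mulr_ge0// -ler_sqr ?nnegrE// !real_normK ?num_real//.
  by have := sqr_ge0 M; rewrite exprMn; lra.
split; apply: key.
- by have := sobolev_sup x d (has_deriv_cont d1) L L1; lra.
- by have := sobolev_sup x d1 c2 L1 L2'; lra.
Qed.

End even_sobolev.

(** * The KdV soliton in terms of the explicit potentials *)

Section soliton.
Context {R : realType}.
Variables c k : R.
Hypotheses (c0 : 0 < c) (k0 : 0 < k).
Implicit Types (x : R).

Local Notation a := (Num.sqrt c / 2).
Local Notation p := (p_exp k).

Lemma half_sqrt_gt0 : 0 < a.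
Proof. by rewrite divr_gt0// sqrtr_gt0. Qed.

Lemma half_sqrt_sq : 4 * a ^+ 2 = c.
Proof. by rewrite expr_div_n sqr_sqrtr ?ltW//; field. Qed.

Let sq : Num.sqrt (1 + 48 * k) ^+ 2 = 1 + 48 * k.
Proof. by rewrite sqr_sqrtr// addr_ge0// mulr_ge0// ltW. Qed.

Lemma p_exp_gt0 : 0 < p.
Proof.
rewrite divr_gt0// subr_gt0 -[ltLHS]sqrtr1 ltr_sqrt; last by rewrite addr_gt0// mulr_gt0.
by rewrite ltrDl mulr_gt0.
Qed.

Lemma p_expE : p * (p + 1) = 12 * k.
Proof.
rewrite /p_exp; move: sq; set q := Num.sqrt _ => h.
have -> : (q - 1) / 2 * ((q - 1) / 2 + 1) = (q ^+ 2 - 1) / 4 by field.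
by rewrite h; field.
Qed.

Lemma Omega_cE : Omega_c c k = - (a ^+ 2 * p ^+ 2).
Proof. by rewrite /Omega_c /p_exp -{1}half_sqrt_sq; field. Qed.

Lemma U0E x : U0 c x = 12 * a ^+ 2 * sech (a * x) ^+ 2.
Proof. by rewrite /U0 -{1}half_sqrt_sq; ring. Qed.

Lemma pot1_U0 x : pot1 a x = c - U0 c x.
Proof. by rewrite /pot1 half_sqrt_sq U0E. Qed.

Lemma pot2_U0 x : pot2 a p x = - Omega_c c k - k * U0 c x.
Proof. by rewrite /pot2 p_expE Omega_cE U0E; ring. Qed.

Lemma gE : g c k = dec2 a p.
Proof. by []. Qed.

Definition U0' x : R := - 24 * a ^+ 3 * dec1 a x.

Lemma has_deriv_U0 : has_deriv (U0 c) U0'.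
Proof.
have -> : U0 c = (fun x => 12 * a ^+ 2 * (sech (a * x) * sech (a * x))).
  by apply/funext => x; rewrite U0E expr2.
have d := has_deriv_comp has_deriv_sech (has_derivZ a has_deriv_id).
apply: has_deriv_eq (has_derivZ (12 * a ^+ 2) (has_derivM d d)) _ => x.
by rewrite /U0' /dec1; ring.
Qed.

Lemma has_deriv_U0' : has_deriv U0' (fun x => c * U0 c x - U0 c x ^+ 2 / 2).
Proof.
apply: has_deriv_eq (has_derivZ (- 24 * a ^+ 3) (has_deriv_dec1 a)) _ => x.
have -> : c * U0 c x = 4 * a ^+ 2 * U0 c x by rewrite half_sqrt_sq.
by rewrite /dec1' U0E; field.
Qed.

Lemma U0N x : U0 c (- x) = U0 c x.
Proof. by rewrite !U0E mulrN sechN. Qed.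

Let sech2_L2 (u : R -> R) M : continuous u -> (forall x, u (- x) ^+ 2 = u x ^+ 2) ->
  (forall x, `|u x| <= M * sech (a * x) ^+ 2) -> L2 u.
Proof.
move=> cu eu uM; have a2 : 0 < 2 * a by rewrite mulr_gt0// half_sqrt_gt0.
have M0 : 0 <= M.
  have := le_trans (normr_ge0 _) (uM 0).
  by rewrite pmulr_lge0// exprn_gt0// sech_gt0.
suff h x : 0 <= x -> `|u x| <= M * 4 * expR (- (2 * a) * x).
  by have [] := exp_decay_L2 cu a2 eu h.
move: x => x x0; apply: le_trans (uM x) _; rewrite -[leRHS]mulrA ler_wpM2l//.
have -> : - (2 * a) * x = - (a * x) + - (a * x) by ring.
rewrite expRD; have := sech_le (a * x); have := sech_gt0 (a * x).
set q := sech _; set t := expR _ => q0 qt.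
have -> : 4 * (t * t) = (2 * t) ^+ 2 by ring.
by rewrite lerXn2r ?nnegrE//; [exact: ltW|exact: le_trans (ltW q0) qt].
Qed.

Let S_le1 x : sech (a * x) ^+ 2 <= 1.
Proof. by rewrite -(expr1n _ 2) lerXn2r ?nnegrE ?sech_le1// ltW// sech_gt0. Qed.

Let cU0 : continuous (U0 c). Proof. exact: has_deriv_cont has_deriv_U0. Qed.

Let cU0'' : continuous (fun x => c * U0 c x - U0 c x ^+ 2 / 2).
Proof. by apply: contB; [exact: contZ|apply: contM; [exact: contX|exact: cont_cst]]. Qed.

Lemma U0_L2 : [/\ L2 (U0 c), L2 U0' & L2 (fun x => c * U0 c x - U0 c x ^+ 2 / 2)].
Proof.
split.
- apply: (@sech2_L2 _ (12 * a ^+ 2)) => // x; first by rewrite U0N.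
  by rewrite U0E ger0_norm// mulr_ge0 ?sqr_ge0// mulr_ge0// sqr_ge0.
- apply: (@sech2_L2 _ (24 * a ^+ 3)) => [|x|x].
  + exact: has_deriv_cont has_deriv_U0'.
  + by rewrite (deriv_even has_deriv_U0 U0N) sqrrN.
  + rewrite /U0' /dec1 normrM; apply: ler_pM => //.
      by rewrite normrM normrN normr_nat ger0_norm// exprn_ge0.
    by rewrite normrM ger0_norm ?sqr_ge0// ler_piMr ?sqr_ge0// th_le1.
- apply: (@sech2_L2 _ (48 * a ^+ 4 + 72 * a ^+ 4)) => // x; first by rewrite U0N.
  have -> : c * U0 c x - U0 c x ^+ 2 / 2 =
    (48 * a ^+ 4 - 72 * a ^+ 4 * sech (a * x) ^+ 2) * sech (a * x) ^+ 2.
    have -> : c * U0 c x = 4 * a ^+ 2 * U0 c x by rewrite half_sqrt_sq.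
    by rewrite U0E; field.
  rewrite normrM; apply: ler_pM => //; last by rewrite ger0_norm// sqr_ge0.
  apply: le_trans (ler_normB _ _) _; apply: lerD.
    by rewrite ger0_norm// mulr_ge0// exprn_ge0.
  rewrite normrM ger0_norm ?mulr_ge0 ?exprn_ge0// ger0_norm ?sqr_ge0//.
  by rewrite ler_piMr// mulr_ge0// exprn_ge0.
Qed.

End soliton.

(** * The nondegeneracy pairing as a half-line integral *)

Section nondegeneracy.
Context {R : realType}.
Local Notation mu := (@lebesgue_measure R).
Implicit Types (f u w h : R -> R) (x M eta : R).

Lemma wb_L2 eta f M : 0 < eta -> continuous f -> (forall x, f (- x) = f x) ->
  (forall x, 0 <= x -> `|f x| <= M * expR (- eta * x)) ->
  L2 f /\ L2inner f f <= M ^+ 2 / eta.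
Proof. by move=> e0 cf ef h; apply: exp_decay_L2 h => // x; rewrite ef. Qed.

Variables c k : R.
Hypotheses (c0 : 0 < c) (k0 : 0 < k).

Local Notation a := (Num.sqrt c / 2).
Local Notation p := (p_exp k).
Local Notation N := (N0 (dec2 a p) (G1 a) (bt a p)).

Let a0 : 0 < a. Proof. exact: half_sqrt_gt0. Qed.
Let p0 : 0 < p. Proof. exact: p_exp_gt0. Qed.
Let E := eta_max a p.
Let E0 : 0 < E. Proof. exact: eta_max_gt0. Qed.
Let E0' : 0 <= E. Proof. exact: ltW. Qed.
Let EE : E <= eta_max a p. Proof. exact: lexx. Qed.

(** A nonzero pairing means that [xget] found a preimage and not its default 0. That preimage has a
    [C^2] representative, bounded with its derivative, hence equal to the Green operator; the 2
    counts the half-lines. *)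
Lemma L2inner_L_1inv :
  L2inner (g c k ^+ 2) (L_1inv c (g c k ^+ 2)) != 0 ->
  L2inner (g c k ^+ 2) (L_1inv c (g c k ^+ 2)) = 2 * N.
Proof.
set G := fun x => dec2 a p x * dec2 a p x.
have -> : g c k ^+ 2 = G by rewrite exprfctE gE; apply/funext => x; rewrite expr2.
have GE : G = (fun x => dec2 a p x * dec2 a p x) by [].
clearbody G.
rewrite /L_1inv; case: xgetP => [f _ [[h2f ef] Lf] _|_ /negP[]]; last first.
  apply/eqP; rewrite /L2inner.
  by under eq_Rintegral do rewrite mulr0; rewrite Rintegral_cst// mul0r.
have ag := adm_dec2 a0 p0 EE; have bg := wb_dec2 a0 p0 EE.
have aG : adm (rho E) G by rewrite GE; exact: (adm_mul (rho_ge0 E) (rho_le1 E0') ag ag).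
have [cG eG [MG bG]] := aG.
have aw : adm (rho E) (G1 a G) := adm_G1 a0 p0 E0' EE aG.
have [cw ew [Mw bw]] := aw.
have [LG _] := wb_L2 E0 cG eG (wb_pos bG).
have [Lw _] := wb_L2 E0 cw ew (wb_pos bw).
have [f0 [f1 [d c1 Ef Ef1 ef0]]] := H2even_rep (conj h2f ef).
pose f2 x := pot1 a x * f0 x - G x.
have cf0 := has_deriv_cont d.
have cU : continuous (U0 c) := has_deriv_cont (has_deriv_U0 c0).
have cf2 : continuous f2.
  apply: contB => //; apply: contM => //.
  have -> : pot1 a = (fun x => c - U0 c x) by apply/funext => x; exact: pot1_U0.
  by apply: contB => //; exact: cont_cst.
have Ef2 : wderiv (wderiv f) = f2 %[ae mu].
  apply: aeI2 Ef Lf => x h1 h2 t; have := h2 t; rewrite /L_1 h1// /f2 pot1_U0// => <-; ring.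
have d1 : has_deriv f1 f2 := H2_rep_C2 h2f d c1 Ef1 cf2 Ef2.
have [L0 L1] := H2_rep_L2 h2f cf0 c1 Ef Ef1.
have L2_ := H2_wderiv2_L2 h2f cf2 Ef2.
have sup := H2_sup d d1 cf2 L0 L1 L2_ (lexx _).
have f10 : f1 0 = 0 by have := deriv_even d ef0 0; rewrite oppr0; lra.
have E1 : f0 = G1 a G.
  apply/funext => x.
  by case: (G1_uniq a0 cG d d1 (fun x _ => (sup x).1) (fun x _ => (sup x).2)
    (fun x _ => wb_bounded E0' bG x) f10 x).
have Lf0 : L2 f by case: h2f => -[].
have -> : L2inner G f = L2inner G (G1 a G).
  apply: ae_eq_L2inner; [exact: LG|exact: Lf0|exact: LG|exact: Lw|exact: ae_eqW|].
  by rewrite -E1; exact: Ef.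
rewrite /L2inner (@Rintegral_even _ (fun x => G x * G1 a G x)).
- congr (2 * _); rewrite /N0 /bt /w0; congr tint; apply/funext => x.
  by rewrite -GE GE; ring.
- exact: contM.
- exact/Lfun1_integrable/Lfun2_mul_Lfun1.
- by move=> x; rewrite eG ew.
- have := bt_cvg a0 p0 E0' (adm_mul (rho_ge0 E) (rho_le1 E0') ag aw).
  have -> : (fun x => dec2 a p x * (dec2 a p x * G1 a G x)) = (fun x => G x * G1 a G x).
    by apply/funext => x; rewrite mulrA; congr (_ * _); rewrite GE.
  exact.
Qed.

End nondegeneracy.

(** * From decaying classical solutions to coupled profiles *)

Section existence.
Context {R : realType}.
Local Notation mu := (@lebesgue_measure R).
Implicit Types (f u v w h : R -> R) (x M eta t delta : R).

(** The 3 counts the integrals in the H^2 norm, each at most [(t M)^2 / eta]. The amplitude [t] is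
    kept apart from [M] to expose the dependence on [delta]. *)
Lemma decay_H2 u f f1 f2 M eta t : measurable_fun setT u -> u = f %[ae mu] ->
  has_deriv f f1 -> has_deriv f1 f2 -> continuous f2 ->
  (forall x, f (- x) = f x) -> (forall x, f2 (- x) = f2 x) ->
  0 < eta -> 0 <= M -> 0 <= t ->
  (forall x, 0 <= x -> `|f x| <= t * M * expR (- eta * x)) ->
  (forall x, 0 <= x -> `|f1 x| <= t * M * expR (- eta * x)) ->
  (forall x, 0 <= x -> `|f2 x| <= t * M * expR (- eta * x)) ->
  [/\ L2 f, L2 f1, L2 f2 & H2norm u <= t * (M * Num.sqrt (3 / eta))].
Proof.
move=> mu_ Eu d d1 c2 ef ef2 e0 M0 t0 b b1 b2.
have ef1 x : f1 (- x) ^+ 2 = f1 x ^+ 2 by rewrite (deriv_even d ef) sqrrN.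
have [L i] := wb_L2 e0 (has_deriv_cont d) ef b.
have [L1 i1] := exp_decay_L2 (has_deriv_cont d1) e0 ef1 b1.
have [L2_ i2] := wb_L2 e0 c2 ef2 b2.
split; [exact: L|exact: L1|exact: L2_|].
have [_ _ _ ->] := C2_H2 mu_ Eu d d1 c2 L L1 L2_.
have T : 0 <= t * M by rewrite mulr_ge0.
have -> : t * (M * Num.sqrt (3 / eta)) = Num.sqrt ((t * M) ^+ 2 * (3 / eta)).
  by rewrite [RHS]sqrtrM ?sqr_ge0// sqrtr_sqr ger0_norm// mulrA.
apply: ler_wsqrtr; move: i i1 i2; set q := (t * M) ^+ 2.
have -> : q * (3 / eta) = q / eta + q / eta + q / eta by ring.
by move=> *; apply: lerD => //; exact: lerD.
Qed.

Variables c k : R.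
Hypotheses (c0 : 0 < c) (k0 : 0 < k).

Local Notation a := (Num.sqrt c / 2).
Local Notation p := (p_exp k).

Let pot1E : pot1 a = (fun x => c - U0 c x).
Proof. by apply/funext => x; exact: pot1_U0. Qed.
Let pot2E : pot2 a p = (fun x => - Omega_c c k - k * U0 c x).
Proof. by apply/funext => x; exact: pot2_U0. Qed.
Let cU : continuous (U0 c). Proof. exact: has_deriv_cont (has_deriv_U0 c0). Qed.

(** [tv] and [tb] are the amplitudes of the two components, [alpha^2] and [alpha] on the branch;
    they carry different powers of [delta]. *)
Lemma decaying_coupled_profile delta v v1 b b1 M eta tv tb C :
  let v2 x := pot1 a x * v x - (v x ^+ 2 / 2 + b x ^+ 2) in
  let b2 x := pot2 a p x * b x - (delta + k * v x) * b x in
  has_deriv v v1 -> has_deriv v1 v2 -> has_deriv b b1 -> has_deriv b1 b2 ->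
  (forall x, v (- x) = v x) -> (forall x, b (- x) = b x) -> b 0 != 0 ->
  0 < eta -> 0 <= M -> 0 <= tv -> 0 <= tb ->
  (forall x, 0 <= x -> [/\ `|v x| <= tv * M * expR (- eta * x),
     `|v1 x| <= tv * M * expR (- eta * x) & `|v2 x| <= tv * M * expR (- eta * x)]) ->
  (forall x, 0 <= x -> [/\ `|b x| <= tb * M * expR (- eta * x),
     `|b1 x| <= tb * M * expR (- eta * x) & `|b2 x| <= tb * M * expR (- eta * x)]) ->
  tv * (M * Num.sqrt (3 / eta)) <= C * `|delta| ->
  tb * (M * Num.sqrt (3 / eta)) <= C * Num.sqrt `|delta| ->
  coupled_profile c k 1 (Omega_c c k + delta) C (fun x => U0 c x + v x) b.
Proof.
move=> v2 b2 dv dv1 db db1 ev eb b0 e0 M0 tv0 tb0 bv bb Cv Cb.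
have cv := has_deriv_cont dv; have cb := has_deriv_cont db.
have cv2 : continuous v2.
  apply: contB; first by apply: contM => //; rewrite pot1E; apply: contB => //; exact: cont_cst.
  by apply: contD; [apply: contM; [exact: contX|exact: cont_cst]|exact: contX].
have cb2 : continuous b2.
  apply: contB.
    by apply: contM => //; rewrite pot2E; apply: contB; [exact: cont_cst|exact: contZ].
  by apply: contM => //; apply: contD; [exact: cont_cst|exact: contZ].
have ev2 x : v2 (- x) = v2 x by rewrite /v2 pot1E U0N// ev eb.
have eb2 x : b2 (- x) = b2 x by rewrite /b2 pot2E U0N// ev eb.
pose W := (fun x => U0 c x + v x) \- U0 c.
have EW : W = v by apply/funext => x; rewrite /W/= addrC addKr.
have mb : measurable_fun setT b := continuous_measurable_fun cb.
have mv : measurable_fun setT v := continuous_measurable_fun cv.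
have [Lv Lv1 Lv2 nv] := decay_H2 mv (ae_eqW (frefl v)) dv dv1 cv2 ev ev2 e0 M0 tv0
  (fun x xp => let: And3 q _ _ := bv x xp in q) (fun x xp => let: And3 _ q _ := bv x xp in q)
  (fun x xp => let: And3 _ _ q := bv x xp in q).
have [Lb Lb1 Lb2 nb] := decay_H2 mb (ae_eqW (frefl b)) db db1 cb2 eb eb2 e0 M0 tb0
  (fun x xp => let: And3 q _ _ := bb x xp in q) (fun x xp => let: And3 _ q _ := bb x xp in q)
  (fun x xp => let: And3 _ _ q := bb x xp in q).
have [L0 L0' L0''] := U0_L2 c0.
have cU'' : continuous (fun x => c * U0 c x - U0 c x ^+ 2 / 2).
  by apply: contB; [exact: contZ|apply: contM; [exact: contX|exact: cont_cst]].
have cUv : continuous (fun x => U0 c x + v x) by exact: contD.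
have [HU _ wU _] := C2_H2 (continuous_measurable_fun cUv) (ae_eqW (frefl _))
  (has_derivD (has_deriv_U0 c0) dv) (has_derivD (has_deriv_U0' c0) dv1) (contD cU'' cv2)
  (L2D L0 Lv) (L2D L0' Lv1) (L2D L0'' Lv2).
have [HA _ wA _] := C2_H2 mb (ae_eqW (frefl b)) db db1 cb2 Lb Lb1 Lb2.
split.
- split; split; [exact: HU| |exact: HA|].
  + by apply: aeW => x; rewrite U0N// ev.
  + exact: aeW.
- split.
  + by apply: (aeS _ wU) => x /(_ I) ->; rewrite /v2 pot1E; field.
  + apply: (aeS _ wA) => x /(_ I) ->; rewrite /b2 pot2E; ring.
- move=> h; have := @ae_continuous_eq _ b (cst 0) 0 cb (@cst_continuous _ _ 0) h.
  by move=> /eqP; rewrite (negbTE b0).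
- by rewrite -/W EW [_ + delta]addrC addrK; exact: le_trans nv Cv.
- by rewrite [_ + delta]addrC addrK; exact: le_trans nb Cb.
Qed.

End existence.

(** * The fixed points give coupled profiles *)

Section branch_profile.
Context {R : realType}.
Implicit Types (f u v w h : R -> R) (x M t delta C : R).
Variables c k : R.
Hypotheses (c0 : 0 < c) (k0 : 0 < k).

Local Notation a := (Num.sqrt c / 2).
Local Notation p := (p_exp k).
Local Notation g := (dec2 a p).
Local Notation G1 := (G1 a).
Local Notation G2 := (G2 a p).
Local Notation bt := (bt a p).
Local Notation K := (Kc a p).
Local Notation Kt := (Ktc a p).
Local Notation Kg := (Kgc a p).
Local Notation eta := (eta_max a p).
Local Notation ball := (in_ball K Kt Kg (rho eta) g G1 bt).
Local Notation e := (coupling k g bt).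
Local Notation psi_step := (amp_step k g G2 bt).
Local Notation u_step := (pot_step k g G1 G2 bt).
Local Notation N := (N0 g G1 bt).

Hypothesis N_neq0 : N != 0.

Let a0 : 0 < a. Proof. exact: half_sqrt_gt0. Qed.
Let p0 : 0 < p. Proof. exact: p_exp_gt0. Qed.
Let eta0 : 0 < eta. Proof. exact: eta_max_gt0. Qed.
Let eta0' : 0 <= eta. Proof. exact: ltW. Qed.
Let etal : eta <= eta_max a p. Proof. exact: lexx. Qed.
(** [D] bounds [w], [g + h] and their first derivatives. Through the equations, [Q1] and [Q2] pass
    to the second derivatives, [M] covers all orders, and [S] is the resulting H^2 bound per unit of
    amplitude. *)
Let B := ball_bound a p k.
Let B0 : 0 <= B. Proof. exact: (ball_bound_ge0 a0 p0 k0). Qed.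
Let D := B + `|curve_bound a p k|.
Let D0 : 0 <= D. Proof. exact: addr_ge0. Qed.
Let BD : B <= D. Proof. by rewrite lerDl. Qed.
Let Q1 := 16 * a ^+ 2 + B * B + B.
Let Q2 := a ^+ 2 * (2 * p ^+ 2 + p) + 1 + k * (B * B).
Let Q10 : 0 <= Q1.
Proof.
apply: addr_ge0 => //; apply: addr_ge0; last exact: mulr_ge0.
by apply: mulr_ge0 => //; exact: sqr_ge0.
Qed.
Let Q20 : 0 <= Q2.
Proof.
have pp : 0 <= p by exact: ltW.
have kk : 0 <= k by exact: ltW.
apply: addr_ge0; last by apply: mulr_ge0 => //; exact: mulr_ge0.
apply: addr_ge0 => //; apply: mulr_ge0; first exact: sqr_ge0.
by apply: addr_ge0 => //; apply: mulr_ge0 => //; exact: sqr_ge0.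
Qed.
Let M := (1 + Q1 + Q2) * D.
Let M0 : 0 <= M. Proof. by apply: mulr_ge0 => //; apply: addr_ge0 => //; exact: addr_ge0. Qed.
Let DM : D <= M.
Proof. by rewrite /M ler_peMl// -addrA lerDl; exact: addr_ge0. Qed.
Let S := M * Num.sqrt (3 / eta).
Let S0 : 0 <= S. Proof. by apply: mulr_ge0 => //; exact: sqrtr_ge0. Qed.

(** [B + 1] dominates both [B] and its square root, which enter the bounds on [U - U0] and on [A];
    the final 1 ensures positivity. *)
Definition profile_bound := (B + 1) * S + 1.

Lemma profile_bound_gt0 : 0 < profile_bound.
Proof. by apply: ltr_wpDl => //; apply: mulr_ge0 => //; exact: addr_ge0. Qed.

Section at_delta.
Variables (delta : R) (w h : R -> R).
Hypotheses (d1 : `|delta| <= 1) (dN : delta * N < 0) (wh : ball w h)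
  (wE : w = u_step delta w h) (hE : h = psi_step delta w h).

Local Notation eps := (delta * e w h).

(** Both [delta] and the coupling have the sign opposite to [N]. The sign condition of the theorem
    is what makes [alpha] real. *)
Lemma eps_gt0 : 0 < eps.
Proof.
have s := ball_sign a0 p0 k0 N_neq0 eta0' etal wh.
have : 0 < eps * N ^+ 2.
  have -> : eps * N ^+ 2 = (delta * N) * (e w h * N) by ring.
  by rewrite nmulr_rgt0.
by rewrite pmulr_lgt0// exprn_even_gt0.
Qed.

Let eps_ge0 : 0 <= eps. Proof. exact: ltW eps_gt0. Qed.

Lemma branch_coupled C : profile_bound <= C ->
  coupled_profile c k 1 (Omega_c c k + delta) C
    (fun x => U0 c x + eps * w x) (fun x => Num.sqrt eps * (g x + h x)).
Proof.
move=> CC; set t := Num.sqrt eps.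
have tt : t ^+ 2 = eps by rewrite sqr_sqrtr.
have t0 : 0 <= t by exact: sqrtr_ge0.
have [bw bq be _] := ball_bounds a0 p0 k0 N_neq0 eta0' etal wh.
have [w1 [q1 [dw dw1 dq dq1 b1]]] := branch_curve a0 p0 k0 N_neq0 eta0' etal d1 wh wE hE.
have ew x : w (- x) = w x by case: wh => -[].
have eh x : h (- x) = h x by case: wh => _ -[].
have epsB : eps <= B * `|delta|.
  by rewrite (le_trans (ler_norm _))// normrM mulrC ler_wpM2r.
have epsB1 : eps <= B by apply: le_trans epsB _; rewrite ler_piMr.
have wB x : `|w x| <= B := wb_bounded eta0' bw x.
have qB x : `|g x + h x| <= B := wb_bounded eta0' bq x.
have bdD x : 0 <= x -> [/\ `|w x| <= D * expR (- eta * x), `|g x + h x| <= D * expR (- eta * x),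
    `|w1 x| <= D * expR (- eta * x) & `|q1 x| <= D * expR (- eta * x)].
  move=> x0; have [h1 h2] := b1 x x0.
  have h3 := wb_pos bw x0; have h4 := wb_pos bq x0.
  have E0 : 0 <= expR (- eta * x) by exact: expR_ge0.
  have cD : curve_bound a p k <= D.
    by apply: le_trans (ler_norm _) _; rewrite lerDr.
  split; [exact: le_trans h3 (ler_wpM2r E0 BD)|exact: le_trans h4 (ler_wpM2r E0 BD)|
    exact: le_trans h1 (ler_wpM2r E0 cD)|exact: le_trans h2 (ler_wpM2r E0 cD)].
have up (s y z : R) : 0 <= s -> `|y| <= D * z -> 0 <= z -> `|s * y| <= s * M * z.
  move=> s0 yD z0; rewrite normrM ger0_norm// -mulrA ler_wpM2l//.
  by apply: le_trans yD _; rewrite ler_wpM2r.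
have E0 x : 0 <= expR (- eta * x) by exact: expR_ge0.
apply: (@decaying_coupled_profile _ c k c0 k0 delta (fun x => eps * w x) (fun x => eps * w1 x)
  (fun x => t * (g x + h x)) (fun x => t * q1 x) M eta eps t C _ _ _ _ _ _ _ eta0 M0 eps_ge0 t0).
- exact: has_derivZ.
- apply: has_deriv_eq (has_derivZ eps dw1) _ => x; by rewrite exprMn -tt; field.
- exact: (has_derivZ t dq).
- apply: has_deriv_eq (has_derivZ t dq1) _ => x; ring.
- by move=> x; rewrite ew.
- by move=> x; rewrite eh dec2N.
(* As [gro2] vanishes at 0, so does [h], and the amplitude at 0 is [sqrt eps]. *)
- have -> : h 0 = 0 by rewrite hE /amp_step /G2 green0 ?mulr0// gro20.
  by rewrite dec20 addr0 mulr1 gt_eqF// sqrtr_gt0 eps_gt0.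
- move=> x x0; have [h1 h2 h3 h4] := bdD x x0; split; [exact: up|exact: up|].
  have -> : pot1 a x * (eps * w x) - ((eps * w x) ^+ 2 / 2 + (t * (g x + h x)) ^+ 2) =
    eps * ((pot1 a x - eps * w x / 2) * w x - (g x + h x) * (g x + h x)).
    by rewrite [(t * _) ^+ 2]exprMn tt; field.
  rewrite normrM (ger0_norm eps_ge0) -[leRHS]mulrA ler_wpM2l//.
  apply: le_trans (ler_normB _ _) _.
  apply: (@le_trans _ _ (Q1 * D * expR (- eta * x))); last first.
    rewrite ler_wpM2r// ler_wpM2r// [1 + Q1]addrC -addrA lerDl; exact: addr_ge0.
  have -> : Q1 * D * expR (- eta * x) =
    (16 * a ^+ 2 + B * B) * (D * expR (- eta * x)) + B * (D * expR (- eta * x)).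
    by rewrite /Q1; ring.
  rewrite !normrM; apply: lerD; last exact: ler_pM.
  apply: ler_pM => //; apply: le_trans (ler_normB _ _) _; apply: lerD; first exact: pot1_le.
  rewrite normrM normfV normr_nat normrM (ger0_norm eps_ge0).
  have : eps * `|w x| <= B * B by exact: ler_pM.
  by have := mulr_ge0 eps_ge0 (normr_ge0 (w x)); lra.
- move=> x x0; have [h1 h2 h3 h4] := bdD x x0; split; [exact: up|exact: up|].
  have -> : pot2 a p x * (t * (g x + h x)) - (delta + k * (eps * w x)) * (t * (g x + h x)) =
    t * ((pot2 a p x - (delta + k * (eps * w x))) * (g x + h x)) by ring.
  rewrite normrM (ger0_norm t0) -[leRHS]mulrA ler_wpM2l//.
  apply: (@le_trans _ _ (Q2 * (D * expR (- eta * x)))); last first.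
    by rewrite mulrA ler_wpM2r// ler_wpM2r// lerDr addr_ge0.
  rewrite normrM; apply: ler_pM => //; apply: le_trans (ler_normB _ _) _.
  rewrite /Q2 -addrA; apply: lerD; first exact: pot2_le.
  apply: le_trans (ler_normD _ _) _; apply: lerD => //.
  by rewrite normrM (gtr0_norm k0) ler_wpM2l ?(ltW k0)// normrM (ger0_norm eps_ge0); exact: ler_pM.
- rewrite -/S; apply: (@le_trans _ _ (profile_bound * `|delta|)); last by rewrite ler_wpM2r.
  apply: (@le_trans _ _ (B * `|delta| * S)); first by rewrite ler_wpM2r.
  rewrite mulrAC ler_wpM2r//; have -> : profile_bound = B * S + (S + 1) by rewrite /profile_bound; ring.
  by rewrite lerDl; exact: addr_ge0.
- rewrite -/S; apply: (@le_trans _ _ (profile_bound * Num.sqrt `|delta|)); last first.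
    by rewrite ler_wpM2r// sqrtr_ge0.
  apply: (@le_trans _ _ ((B + 1) * Num.sqrt `|delta| * S)); last first.
    by rewrite mulrAC ler_wpM2r ?sqrtr_ge0// lerDl.
  rewrite ler_wpM2r//; apply: le_trans (ler_wsqrtr epsB) _.
  have sB : Num.sqrt B <= B + 1.
    have B10 : 0 <= B + 1 by exact: addr_ge0.
    have E1 : Num.sqrt ((B + 1) ^+ 2) = B + 1 by rewrite sqrtr_sqr ger0_norm.
    by rewrite -[leRHS]E1; apply: ler_wsqrtr; move: B0; nra.
  by rewrite sqrtrM// ler_wpM2r ?sqrtr_ge0.
Qed.

End at_delta.

End branch_profile.

(** * Sobolev profiles reduce to fixed points *)

Section profile_uniqueness.
Context {R : realType}.
Local Notation mu := (@lebesgue_measure R).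
Implicit Types (f u v w h : R -> R) (x delta C : R).
Variables c k : R.
Hypotheses (c0 : 0 < c) (k0 : 0 < k).

Local Notation a := (Num.sqrt c / 2).
Local Notation p := (p_exp k).
Local Notation g := (dec2 a p).
Local Notation G1 := (G1 a).
Local Notation G2 := (G2 a p).
Local Notation bt := (bt a p).
Local Notation K := (Kc a p).
Local Notation Kt := (Ktc a p).
Local Notation Kg := (Kgc a p).
Local Notation ball eta := (in_ball K Kt Kg (rho eta) g G1 bt).
Local Notation rad := (ball_radius K Kt Kg g G1 bt).
Local Notation e := (coupling k g bt).
Local Notation psi_step := (amp_step k g G2 bt).
Local Notation u_step := (pot_step k g G1 G2 bt).
Local Notation N := (N0 g G1 bt).

Hypothesis N_neq0 : N != 0.

Let a0 : 0 < a. Proof. exact: half_sqrt_gt0. Qed.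
Let p0 : 0 < p. Proof. exact: p_exp_gt0. Qed.

(** The argument [2 * C] pays for the factor 2 that [H2_sup] loses between the H^2 norm and sup
    bounds. *)
Lemma coupled_profile_reduced delta C V B : 0 < C ->
  `|delta| * smallness a p k (2 * C) <= rad ->
  coupled_profile c k 1 (Omega_c c k + delta) C V B ->
  exists w h alpha, [/\ ball 0 w h, w = u_step delta w h, h = psi_step delta w h,
    alpha ^+ 2 = delta * e w h &
    V = (fun x => U0 c x + alpha ^+ 2 * w x) %[ae mu] /\
    B = (fun x => alpha * (g x + h x)) %[ae mu]].
Proof.
move=> C0 dC [[HV HB] [pV pB] nB nV nA].
have [f [f1 [df cf1 EV EV1 ef]]] := H2even_rep HV.
have [b [b1 [db cb1 EB EB1 eb]]] := H2even_rep HB.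
have cf := has_deriv_cont df; have cb := has_deriv_cont db.
have cU : continuous (U0 c) := has_deriv_cont (has_deriv_U0 c0).
pose U2 x := c * U0 c x - U0 c x ^+ 2 / 2.
have cU2 : continuous U2.
  by apply: contB; [exact: contZ|apply: contM; [exact: contX|exact: cont_cst]].
pose f2 x := c * f x - f x ^+ 2 / 2 - b x ^+ 2.
pose b2 x := - ((Omega_c c k + delta + k * f x) * b x).
have cf2 : continuous f2.
  apply: contB; last exact: contX.
  by apply: contB; [exact: contZ|apply: contM; [exact: contX|exact: cont_cst]].
have cb2 : continuous b2.
  by apply: contN; apply: contM => //; apply: contD; [exact: cont_cst|exact: contZ].
have Ef2 : wderiv (wderiv V) = f2 %[ae mu].
  have P : {ae mu, forall x, V x = f x /\ B x = b x}.
    by apply: (aeI2 _ EV EB) => x /(_ I) h1 /(_ I) h2.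
  apply: (aeI2 _ P pV) => x [h1 h2] h3 _; rewrite /f2 -h1 -h2.
  by apply/eqP; rewrite -subr_eq0 -h3; apply/eqP; field.
have Eb2 : wderiv (wderiv B) = b2 %[ae mu].
  have P : {ae mu, forall x, V x = f x /\ B x = b x}.
    by apply: (aeI2 _ EV EB) => x /(_ I) h1 /(_ I) h2.
  apply: (aeI2 _ P pB) => x [h1 h2] h3 _; rewrite /b2 -h1 -h2.
  by apply/eqP; rewrite -subr_eq0 -h3; apply/eqP; ring.
have df1 : has_deriv f1 f2 := H2_rep_C2 HV.1 df cf1 EV1 cf2 Ef2.
have db1 : has_deriv b1 b2 := H2_rep_C2 HB.1 db cb1 EB1 cb2 Eb2.
have [Lf Lf1] := H2_rep_L2 HV.1 cf cf1 EV EV1.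
have [Lb Lb1] := H2_rep_L2 HB.1 cb cb1 EB EB1.
have Lf2 := H2_wderiv2_L2 HV.1 cf2 Ef2; have Lb2 := H2_wderiv2_L2 HB.1 cb2 Eb2.
have [L0 L0' L0''] := U0_L2 c0.
have mV : measurable_fun setT V by case: HV => -[[LV _] _] _; exact: L2_measurable.
have mB : measurable_fun setT B by case: HB => -[[LB _] _] _; exact: L2_measurable.
have mU : measurable_fun setT (U0 c) := continuous_measurable_fun cU.
have dv := has_derivB df (has_deriv_U0 c0).
have dv1 := has_derivB df1 (has_deriv_U0' c0).
have cv2 : continuous (fun x => f2 x - U2 x) by exact: contB.
have Ev : V \- U0 c = (fun x => f x - U0 c x) %[ae mu].
  by apply: (aeS _ EV) => x /(_ I) h1 _; rewrite /= h1.
have [_ _ _ nv] := C2_H2 (measurable_funB mV mU) Ev dv dv1 cv2 (L2B Lf L0) (L2B Lf1 L0')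
  (L2B Lf2 L0'').
have [_ _ _ nb] := C2_H2 mB EB db db1 cb2 Lb Lb1 Lb2.
have bv := H2_sup dv dv1 cv2 (L2B Lf L0) (L2B Lf1 L0') (L2B Lf2 L0'').
have bb := H2_sup db db1 cb2 Lb Lb1 Lb2.
have dE : Omega_c c k + delta - Omega_c c k = delta by rewrite addrC addKr.
have {}bv := bv (C * `|delta|); have {}bb := bb (C * Num.sqrt `|delta|).
rewrite -nv -nb in bv bb; rewrite dE in nV nA.
have {}bv x := bv nV x; have {}bb x := bb nA x.
have b_neq0 : exists x, b x != 0.
  apply: contrapT => h; apply: nB; apply: (aeS _ EB) => x /(_ I) -> _.
  by apply/eqP/negPn/negP => bx; apply: h; exists x.
have dv1' : has_deriv (fun x => f1 x - U0' c x) (fun x => pot1 a x * (f x - U0 c x) -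
    ((f x - U0 c x) ^+ 2 / 2 + b x ^+ 2)).
  by apply: has_deriv_eq dv1 _ => x; rewrite /f2 pot1_U0//; field.
have db1' : has_deriv b1 (fun x => pot2 a p x * b x - (delta + k * (f x - U0 c x)) * b x).
  by apply: has_deriv_eq db1 _ => x; rewrite /b2 pot2_U0//; ring.
have ev x : f (- x) - U0 c (- x) = f x - U0 c x by rewrite ef U0N.
have C20 : 0 < 2 * C by rewrite mulr_gt0.
have Bv x : `|f x - U0 c x| <= 2 * C * `|delta| by rewrite -mulrA; case: (bv x).
have Bv1 x : `|f1 x - U0' c x| <= 2 * C * `|delta| by rewrite -mulrA; case: (bv x).
have Bb x : `|b x| <= 2 * C * Num.sqrt `|delta| by rewrite -mulrA; case: (bb x).
have Bb1 x : `|b1 x| <= 2 * C * Num.sqrt `|delta| by rewrite -mulrA; case: (bb x).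
have [w [h [alpha [wh wE hE al [vE bE]]]]] :=
  profile_in_ball a0 p0 k0 N_neq0 C20 dC dv dv1' db db1' ev eb Bv Bv1 Bb Bb1 b_neq0.
exists w, h, alpha; split; [exact: wh|exact: wE|exact: hE|exact: al|split].
- by apply: (aeS _ EV) => x /(_ I) -> _; rewrite -vE addrC subrK.
- by apply: (aeS _ EB) => x /(_ I) -> _; rewrite bE.
Qed.

(** The weight is at most 1, and the radius is the same for all weights. *)
Lemma in_ball_weight eta w h : 0 <= eta -> ball eta w h -> ball 0 w h.
Proof.
have r1 x : 0 <= eta -> rho eta x <= rho 0 x by move=> e0; rewrite rho0; exact: rho_le1.
have r_ge0 := rad_gt0 a0 p0 N_neq0.
have up M f : 0 <= eta -> 0 <= M -> wb (rho eta) M f -> wb (rho 0) M f.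
  by move=> e0 M0 bf x; apply: le_trans (bf x) _; rewrite ler_wpM2l ?r1.
have aup f : 0 <= eta -> adm (rho eta) f -> adm (rho 0) f.
  move=> e0 [cf ef [M bf]]; split; [exact: cf|exact: ef|].
  by exists M; apply: up => //; exact: wb_M_ge0 bf.
move=> e0 [aw ah bw bh]; split; [exact: aup|exact: aup| |].
- exact: up e0 (ltW r_ge0) bw.
- exact: up e0 (ltW r_ge0) bh.
Qed.

End profile_uniqueness.

Unset Implicit Arguments.

Theorem proposition2 (R : realType) (c k s : R)
    (c_gt0 : 0 < c) (s_sgk : s = Num.sg k) (sgk1 : Num.sg k = 1)
    (nondeg : L2inner (g c k ^+ 2) (L_1inv c (g c k ^+ 2)) != 0) :
  exists2 C0 : R, 0 < C0 &
  forall C : R, C0 <= C ->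
  \forall Omega \near Omega_c c k,
    Omega < 0 ->
    Num.sg (Omega - Omega_c c k) =
      - Num.sg (L2inner (g c k ^+ 2) (L_1inv c (g c k ^+ 2))) ->
    exists U A : R -> R,
      coupled_profile c k s Omega C U A /\
      forall V B : R -> R, coupled_profile c k s Omega C V B ->
        V = U %[ae lebesgue_measure] /\
        (B = A %[ae lebesgue_measure] \/ B = \- A %[ae lebesgue_measure]).
Proof.
have k0 : 0 < k by rewrite -sgr_gt0 sgk1.
rewrite s_sgk sgk1; clear s s_sgk.
have a0 := half_sqrt_gt0 c_gt0; have p0 := p_exp_gt0 k0.
move: (nondeg); rewrite (L2inner_L_1inv c_gt0 k0 nondeg) => {}nondeg.
set a := Num.sqrt c / 2 in a0 nondeg *; set p := p_exp k in p0 nondeg *.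
set N := N0 (dec2 a p) (G1 a) (bt a p) in nondeg *.
have N_neq0 : N != 0 by move: nondeg; rewrite mulf_eq0 negb_or => /andP[].
exists (profile_bound c k); first exact: profile_bound_gt0.
move=> C CC.
have C0 : 0 < C by apply: lt_le_trans CC; exact: profile_bound_gt0.
have Y0 : 0 < smallness a p k (2 * C).
  by apply: smallness_gt0 => //; rewrite mulr_ge0// ltW.
have r0 := rad_gt0 a0 p0 N_neq0; have dr0 := drad_gt0 a0 p0 k0 N_neq0.
set rad := ball_radius _ _ _ _ _ _ in r0; set drad := delta_radius _ _ _ _ _ _ _ in dr0.
(* 1 serves the derivative bounds along the branch, [drad] the contraction, and the last entry,
   which depends on [C], the bootstrap for competing profiles. *)
apply/nbhs_ballP; exists (Num.min 1 (Num.min drad (rad / smallness a p k (2 * C)))).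
  by rewrite /= !lt_min ltr01 dr0 divr_gt0.
move=> Omega; rewrite /ball/= distrC !lt_min => /and3P[/ltW d1 /ltW dd dC] _ sgO.
move: d1 dd dC sgO; set delta := Omega - _ => d1 dd dC sgO.
have dN : delta * N < 0.
  rewrite -sgr_lt0 sgrM sgO sgrM gtr0_sg ?ltr0n// mul1r mulNr oppr_lt0.
  by rewrite -expr2 exprn_even_gt0//= sgr_eq0.
have {dC}dC : `|delta| * smallness a p k (2 * C) <= rad by rewrite -ler_pdivlMr// ltW.
have -> : Omega = Omega_c c k + delta by rewrite addrC subrK.
have e0 : 0 <= eta_max a p by exact/ltW/eta_max_gt0.
have [w [h [wh wE hE]]] := branch_exists a0 p0 k0 N_neq0 e0 (lexx _) dd.
exists (fun x => U0 c x + delta * coupling k (dec2 a p) (bt a p) w h * w x),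
  (fun x => Num.sqrt (delta * coupling k (dec2 a p) (bt a p) w h) * (dec2 a p x + h x)).
split; first exact: branch_coupled.
move=> V B /(coupled_profile_reduced c_gt0 k0 N_neq0 C0 dC).
move=> [w' [h' [alpha [wh' wE' hE' al [VE BE]]]]].
(* The branch was built with a decaying weight; the comparison with an arbitrary profile takes place
   at weight 0. *)
have wh0 := in_ball_weight c_gt0 k0 N_neq0 e0 wh.
have [Ew Eh] := branch_uniq a0 p0 k0 N_neq0 (lexx 0) e0 dd wh0 wh' wE hE wE' hE'.
rewrite -Ew -Eh in al VE BE; split; first by rewrite -al.
have eps0 : 0 <= delta * coupling k (dec2 a p) (bt a p) w h by rewrite -al sqr_ge0.
have /eqP : alpha ^+ 2 = Num.sqrt (delta * coupling k (dec2 a p) (bt a p) w h) ^+ 2.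
  by rewrite sqr_sqrtr.
(* The two square roots of [alpha^2] correspond to [A] and [- A]. *)
rewrite eqf_sqr => /orP[] /eqP {}al.
- by left; rewrite -al.
- right; apply: ae_eq_trans BE (ae_eqW _) => x.
  by rewrite al/= mulNr.
Qed.
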